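(* Fix $\theta_0>0$. Let $\{\theta_n\}_{n\ge1}$ be a sequence of positive estimators of $\theta$, with $\theta_n$ being $\mathcal F_{n-1}$-measurable, having asymptotic efficiency $\kappa(\theta)$ in the sense that $$E_\theta(\theta_n-\theta)^2=\frac{1+o(1)}{n\,I(\theta)\,\kappa(\theta)}\quad\text{as }n\to\infty,\text{ for all }\theta.$$ Assume that $E_\theta(\theta_n-\theta)^4=O(n^{-2})$ as $n\to\infty$ and that there exists $c>0$ depending on $\theta$ such that $$\sum_{n=1}^{\infty}E_\theta\left[(\log\theta_n^{-1})^+\,\mathbf 1(\theta_n<c)\right]<\infty .$$ Let $\Lambda_n=\prod_{i=1}^n f_{\theta_i}(X_i)/f_{\theta_0}(X_i)$ and $\tau_b=\min\{n\ge1:\Lambda_n\ge e^b\}$ ($\tau_b=\infty$ if no such $n$ exists). Then for all $\theta\neq\theta_0$, as $b\to\infty$, $$E_\theta\tau_b=I(\theta,\theta_0)^{-1}\left(b+\frac{\log b}{2\kappa(\theta)}\right)+o(\log b).$$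
   Context: $f_\theta(x)=x^{\theta-1}e^{-x}/\Gamma(\theta)$, $x>0$, is the Gamma$(\theta,1)$ density, $\theta>0$. Under $P_\theta$ (expectation $E_\theta$), $X_1,X_2,\ldots$ are i.i.d. Gamma$(\theta,1)$. $\mathcal F_n=\sigma(X_1,\ldots,X_n)$, with $\mathcal F_0$ trivial. The Fisher and Kullback--Leibler information numbers are $$I(\theta)=-E_\theta\left[\partial^2\log f_\theta(X)/\partial\theta^2\right]=\frac{d^2\log\Gamma(\theta)}{d\theta^2},$$ $$I(\theta,\phi)=E_\theta\log\frac{f_\theta(X)}{f_\phi(X)}=(\theta-\phi)\frac{d\log\Gamma(\theta)}{d\theta}-\log\frac{\Gamma(\theta)}{\Gamma(\phi)}.$$ Here $x^+=\max(x,0)$. *)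

(* Defs.v *)
From HB Require Import structures.
From mathcomp Require Import all_boot all_order all_algebra.
From mathcomp Require Import finmap all_classical all_reals all_analysis.

Set Implicit Arguments.
Unset Strict Implicit.
Unset Printing Implicit Defensive.

Import Order.TTheory GRing.Theory Num.Theory.
Import numFieldNormedType.Exports.

Local Open Scope classical_set_scope.
Local Open Scope ring_scope.

(* The Landau notations need a canonical [filter_on], which the library does not
   provide for the filter of neighbourhoods of [+oo] in [R]. *)
Canonical pinfty_filter_on (R : realType) :=
  FilterType (pinfty_nbhs R) _.

Section gamma_distribution.
Context {R : realType}.

Definition Gamma (theta : R) : R :=
  \int[lebesgue_measure]_(x in `]0, +oo[) (x `^ (theta - 1) * expR (- x)).

Definition gamma_pdf (theta x : R) : R :=
  if 0 < x then x `^ (theta - 1) * expR (- x) / Gamma theta else 0.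

(* [E_theta g(X)] for [X] with density [gamma_pdf theta] *)
Definition gamma_mean (theta : R) (g : R -> R) : R :=
  \int[lebesgue_measure]_(x in `]0, +oo[) (g x * gamma_pdf theta x).

Definition fisher_info (theta : R) : R :=
  - gamma_mean theta (fun x => (fun t => ln (gamma_pdf t x))^`(2)%classic theta).

Definition kl_info (theta phi : R) : R :=
  gamma_mean theta (fun x => ln (gamma_pdf theta x / gamma_pdf phi x)).

End gamma_distribution.

(* Sequences of observations and estimators are indexed from 1, so their values
   at 0 are never constrained nor used. *)
Section observations.
Context {d : measure_display} {T : measurableType d} {R : realType}.

Definition has_pdf (P : probability T R) (Y : {mfun T >-> R}) (f : R -> R) :=
  forall B : set R, measurable B ->
    distribution P Y B = (\int[lebesgue_measure]_(x in B) (f x)%:E)%E.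

Definition mutually_independent (P : probability T R)
    (X : nat -> {mfun T >-> R}) (D : set nat) :=
  forall (J : {fset nat}) (B : nat -> set R),
    [set` J] `<=` D -> (forall i, measurable (B i)) ->
    P (\bigcap_(i in [set` J]) (X i @^-1` B i)) =
      (\prod_(i <- J) P (X i @^-1` B i))%E.

Definition iid_gamma (P : probability T R) (X : nat -> {mfun T >-> R})
    (theta : R) :=
  (forall n, (0 < n)%N -> has_pdf P (X n) (gamma_pdf theta)) /\
  mutually_independent P X [set n | (0 < n)%N].

(* [sigma(X_1, ..., X_n)] *)
Definition observed (X : nat -> {mfun T >-> R}) (n : nat) : set (set T) :=
  g_sigma_preimage (fun i : 'I_n => X i.+1 : T -> R).

Definition nonanticipating (X : nat -> {mfun T >-> R}) (est : nat -> T -> R) :=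
  forall n, (0 < n)%N -> g_sigma_algebra_preimage (est n) `<=` observed X n.-1.

Definition likelihood_ratio (X : nat -> {mfun T >-> R}) (est : nat -> T -> R)
    (theta0 : R) (n : nat) (w : T) : R :=
  \prod_(1 <= i < n.+1) (gamma_pdf (est i w) (X i w) / gamma_pdf theta0 (X i w)).

Definition stopping_time (X : nat -> {mfun T >-> R}) (est : nat -> T -> R)
    (theta0 b : R) (w : T) : \bar R :=
  match pselect (exists n,
      (1 <= n)%N && (expR b <= likelihood_ratio X est theta0 n w)) with
  | left crossed => (ex_minn crossed)%:R%:E
  | right _ => +oo%E
  end.

End observations.

(* Main.v *)
(* Write [S n = log Lambda_n]. Given the past, the [i]-th increment of [S] has
   mean [I(theta, theta_0) - I(theta, theta_i)], so Wald's identity reads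
   [I(theta, theta_0) E tau = E S_tau + E sum_(i <= tau) I(theta, theta_i)].

   The overshoot [S_tau - b] has bounded mean: for suitable [lam] and [cap] the
   exponential [expR (lam * min (S - b) cap)] has, below level [b], a drift at
   least proportional to [expR (lam * (S - b))], which dominates the expected
   excess over [b] at the next step, and the drifts telescope. This uses
   increments with exponential moments, hence [theta_i] close to [theta]; the
   remaining steps contribute a convergent series, by the fourth moment and
   logarithmic hypotheses.

   Since [I(theta, phi) ~ I(theta) (phi - theta)^2 / 2], the [i]-th loss has mean
   [1 / (2 kappa i) + o(1 / i)]. The sum up to [tau] is the sum up to [b] within
   [o(log b)]: beyond [b] one uses [z^2 <= 1 / b + b z^4] and [E tau = O(b)], and
   for [n] a small fraction of [b] one uses [P(tau <= n) = O(n / b)]. *)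

Require Import Defs.
From HB Require Import structures.
From mathcomp Require Import all_boot all_order all_algebra.
From mathcomp Require Import finmap all_classical all_reals all_analysis.
From mathcomp Require Import measurable_realfun.
From mathcomp Require Import ring lra.

Set Implicit Arguments.
Unset Strict Implicit.
Unset Printing Implicit Defensive.

Import Order.TTheory GRing.Theory Num.Theory.
Import numFieldNormedType.Exports.

Local Open Scope classical_set_scope.
Local Open Scope ring_scope.

(** * Independence of an observation from the past *)

(** The increments are neither independent nor identically distributed: each carries an estimator
    built from earlier observations. Conditional expectations are avoided: [running b i] and the
    estimator entering step [i] are functions of the first [i] observations, so the next observation
    is integrated out by a product rule for independent variables.

    The cap is what closes the overshoot argument. Without it the drifts would telescope to the mean
    of [expR (lam * (S - b))] at passage, itself an overshoot moment. With it the telescoped sum is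
    at most [expR (lam * cap)], at the price of a second-moment term divided by [cap], small for
    large [cap].

    The hypotheses on the estimators meet in [ln_Gamma], which is at most quadratic at infinity and
    at most of order [ln phi^-1] at zero: far from [theta], coefficients and losses are bounded by a
    fourth power and by the logarithmic term, both with summable means.

    The smoothness of [ln_Gamma] comes from probability: the mean of [X ^ h] is
    [Gamma (theta + h) / Gamma theta], so derivatives are moments of [ln X], and positivity of both
    information numbers follows because [ln X] has no atom. *)

Section independence.
Context {d : measure_display} {T : measurableType d} {R : realType}.
Variables (P : probability T R) (X : nat -> {mfun T >-> R}).
Hypothesis indX : mutually_independent P X [set n | (0 < n)%N].

Let J n : {fset nat} := [fset i in iota 1 n]%fset.

Let memJ n i : ([set` J n] i) = (0 < i <= n)%N :> Prop.
Proof. by rewrite /= !inE mem_iota add1n ltnS. Qed.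

Let cylinder n : set (set T) :=
  [set A | exists2 B : nat -> set R, (forall i, measurable (B i)) &
           A = \bigcap_(i in [set` J n]) (X i @^-1` B i)].

Let measurable_cylinder n : cylinder n `<=` measurable.
Proof.
move=> _ [B mB ->]; apply: fin_bigcap_measurable; first exact: finite_fset.
by move=> i _; rewrite -[X in measurable X]setTI; apply: measurable_funP.
Qed.

Let cylinderI n : setI_closed (cylinder n).
Proof.
move=> _ _ [B mB ->] [C mC ->]; exists (fun i => B i `&` C i).
  by move=> i; exact: measurableI.
by rewrite -bigcapI; apply: eq_bigcapr => i _; rewrite preimage_setI.
Qed.

Let observed_cylinder n : observed X n `<=` <<s cylinder n >>.
Proof.
apply: smallest_sub; first exact: smallest_sigma_algebra.
case: n => [|n]; first by rewrite big_ord0.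
rewrite -bigcup_mkord_ord => A [i /= ltin [B mB <-]]; rewrite setTI.
apply: sub_sigma_algebra; exists (fun j => if j == i.+1 then B else setT).
  by move=> j; case: ifP.
rewrite /= inordK//; apply/seteqP; split=> [w Bw j /=|w /(_ i.+1)].
  by case: eqP => // ->.
by rewrite eqxx; apply; rewrite memJ.
Qed.

Lemma measurable_observed n : observed X n `<=` measurable.
Proof.
apply: smallest_sub; first exact: sigma_algebra_measurable.
case: n => [|n]; first by rewrite big_ord0.
rewrite -bigcup_mkord_ord => A [i /= ltin [B mB <-]].
exact: measurable_funP.
Qed.

(** Both sides are finite measures in [A]: the restriction [mrestr] of [P] to the event on [X n.+1],
    and a multiple [mscale] of [P]. By mutual independence they agree on the pi-system of cylinders
    over the first [n] observations, hence on the sigma-algebra it generates. *)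
Lemma observed_independent n A B : observed X n A -> measurable B ->
  P (A `&` X n.+1 @^-1` B) = (P A * P (X n.+1 @^-1` B))%E.
Proof.
move=> oA mB.
have mXB : measurable (X n.+1 @^-1` B).
  by rewrite -[X in measurable X]setTI; apply: measurable_funP.
pose c : {nonneg R} := NngNum (fine_ge0 (measure_ge0 P (X n.+1 @^-1` B))).
have cE : c%:num%:E = P (X n.+1 @^-1` B) by rewrite /= fineK// fin_num_measure.
suff : mrestr P mXB A = mscale c P A by rewrite /mrestr /mscale/= cE muleC.
apply: (@g_sigma_algebra_measure_unique _ _ _ (cylinder n) _
  (fun=> setT)) => //.
- move=> _; exists (fun=> setT) => //.
  by apply/seteqP; split=> // w _ i _ /=.
- by apply/seteqP; split=> // w _; exists 0%N.
- move=> _ [C mC ->].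
  rewrite (_ : _ (\bigcap_(_ in _) _) =
    P (\bigcap_(i in [set` J n]) X i @^-1` C i `&` X n.+1 @^-1` B)) //.
  rewrite [RHS](_ : _ = c%:num%:E * P (\bigcap_(i in [set` J n]) X i @^-1` C i))%E // cE.
  pose C' i := if i == n.+1 then B else C i.
  have mC' i : measurable (C' i) by rewrite /C'; case: ifP.
  have nJ : n.+1 \notin J n by rewrite !inE mem_iota add1n ltnn andbF.
  have -> : \bigcap_(i in [set` J n]) X i @^-1` C i `&` X n.+1 @^-1` B =
            \bigcap_(i in [set` (n.+1 |` J n)%fset]) X i @^-1` C' i.
    apply/seteqP; split=> [w [wC wB] i|w wC'].
      rewrite /= in_fset1U /C' => /orP[/eqP ->|Ji]; first by rewrite eqxx.
      case: eqP => [iE|_]; last exact: wC.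
      by move: nJ; rewrite -iE Ji.
    split=> [i Ji|]; last first.
      by have := wC' n.+1; rewrite /C' eqxx; apply; rewrite /= in_fset1U eqxx.
    have := wC' i; rewrite /C' ifF; first by apply; rewrite /= in_fset1U Ji orbT.
    by apply/negP => /eqP iE; move: nJ; rewrite -iE Ji.
  have JP : [set` J n] `<=` [set n | (0 < n)%N].
    by move=> i; rewrite memJ => /andP[].
  rewrite !indX//; last first.
    by move=> i /=; rewrite in_fset1U => /orP[/eqP ->//|/JP].
  rewrite big_fsetU1//= {1}/C' eqxx; congr (_ * _)%E.
  rewrite !big_seq; apply: eq_bigr => i Ji; rewrite /C' ifF//.
  by apply/negP => /eqP iE; move: nJ; rewrite -iE Ji.
- move=> _; rewrite (_ : _ setT = P (setT `&` X n.+1 @^-1` B))//.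
  by rewrite ltey_eq fin_num_measure// setTI.
- exact: observed_cylinder.
Qed.

End independence.

(** * Product rule for independent variables *)

Section product_rule.
Local Open Scope ereal_scope.
Context {d d1 d2 : measure_display} {T : measurableType d}
  {T1 : measurableType d1} {T2 : measurableType d2} {R : realType}.
Variables (P : probability T R) (U : {mfun T >-> T1}) (V : {mfun T >-> T2}).
Hypothesis indUV : forall A B, measurable A -> measurable B ->
  P (U @^-1` A `&` V @^-1` B) = P (U @^-1` A) * P (V @^-1` B).

(** Independence on rectangles makes the joint law of [U] and [V] the product of their laws, and
    Tonelli applies. The value space of [U] is left arbitrary because it will be the whole past. *)
Lemma ge0_integralM_independent (f : T1 -> \bar R) (q : T2 -> \bar R) :
  measurable_fun [set: T1] f -> measurable_fun [set: T2] q ->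
  (forall x, 0 <= f x) -> (forall x, 0 <= q x) ->
  \int[P]_w (f (U w) * q (V w)) = \int[P]_w f (U w) * \int[P]_w q (V w).
Proof.
move=> mf mq f0 q0.
have mUV : measurable_fun setT (fun w => (U w, V w)).
  by apply/measurable_fun_pairP; split => /=; exact: measurable_funP.
pose UV : {mfun T >-> (T1 * T2)%type} := mfun_Sub (mem_set mUV).
pose h := fun z : T1 * T2 => f z.1 * q z.2.
have mh : measurable_fun setT h.
  apply: emeasurable_funM.
  - exact: (measurableT_comp mf measurable_fst).
  - exact: (measurableT_comp mq measurable_snd).
have h0 z : 0 <= h z by rewrite mule_ge0.
rewrite -[LHS]/(\int[P]_w (h \o UV) w) -ge0_integral_distribution//.
transitivity (\int[distribution P U \x distribution P V]_z h z).
  apply: eq_measure_integral => A mA _; apply/esym.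
  by apply: product_measure_unique.
transitivity (\int[distribution P U]_x \int[distribution P V]_y h (x, y)).
  exact: fubini_tonelli1.
rewrite -(ge0_integral_distribution U)//.
rewrite -(ge0_integral_distribution V)//.
rewrite -ge0_integralZr//=; last exact: integral_ge0.
by apply: eq_integral => x _; rewrite /h/= ge0_integralZl.
Qed.

Lemma integrableM_independent (f : T1 -> R) (q : T2 -> R) :
  measurable_fun [set: T1] f -> measurable_fun [set: T2] q ->
  P.-integrable setT (fun w => (f (U w))%:E) ->
  P.-integrable setT (fun w => (q (V w))%:E) ->
  P.-integrable setT (fun w => (f (U w) * q (V w))%:E).
Proof.
move=> mf mq /integrableP[mfU fU] /integrableP[mqV qV]; apply/integrableP; split.
  by under eq_fun do rewrite EFinM; exact: emeasurable_funM.
under eq_integral do rewrite /= normrM EFinM.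
rewrite (ge0_integralM_independent (f := fun x => `|f x|%:E)
  (q := fun x => `|q x|%:E)) //.
- by rewrite lte_mul_pinfty// ?integral_ge0// ge0_fin_numE// integral_ge0.
- by apply/measurable_EFinP; exact: measurableT_comp.
- by apply/measurable_EFinP; exact: measurableT_comp.
Qed.

Lemma RintegralM_independent (f : T1 -> R) (q : T2 -> R) :
  measurable_fun [set: T1] f -> measurable_fun [set: T2] q ->
  P.-integrable setT (fun w => (f (U w))%:E) ->
  P.-integrable setT (fun w => (q (V w))%:E) ->
  (\int[P]_w (f (U w) * q (V w)) = \int[P]_w f (U w) * \int[P]_w q (V w))%R.
Proof.
pose I (g : T -> R) := P.-integrable setT (EFin \o g).
have rule0 (g : T1 -> R) (p : T2 -> R) : measurable_fun [set: T1] g ->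
    measurable_fun [set: T2] p -> (forall x, 0 <= g x)%R -> (forall x, 0 <= p x)%R ->
    I (g \o U) -> I (p \o V) ->
    (\int[P]_w (g (U w) * p (V w)) = \int[P]_w g (U w) * \int[P]_w p (V w))%R.
  move=> mg mp g0 p0 ig ip; rewrite /Rintegral.
  under eq_integral do rewrite EFinM.
  rewrite (ge0_integralM_independent (f := EFin \o g) (q := EFin \o p)) //.
  - by rewrite fineM//; exact: integrable_fin_num.
  - exact/measurable_EFinP.
  - exact/measurable_EFinP.
have rule (g : T1 -> R) (p : T2 -> R) : measurable_fun [set: T1] g ->
    measurable_fun [set: T2] p -> (forall x, 0 <= g x)%R -> I (g \o U) -> I (p \o V) ->
    (\int[P]_w (g (U w) * p (V w)) = \int[P]_w g (U w) * \int[P]_w p (V w))%R.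
  move=> mg mp g0 ig ip.
  have mpp : measurable_fun setT (p^\+)%R by exact: measurable_funrpos.
  have mpn : measurable_fun setT (p^\-)%R by exact: measurable_funrneg.
  have ipp : I ((p^\+)%R \o V) by exact: (integrable_funrpos measurableT ip).
  have ipn : I ((p^\-)%R \o V) by exact: (integrable_funrneg measurableT ip).
  have pE x : p x = (p^\+%R x - p^\-%R x)%R by rewrite -[in LHS](funrposBneg p).
  under eq_Rintegral do rewrite pE mulrBr.
  rewrite RintegralB//; [|exact: integrableM_independent..].
  have -> : (\int[P]_w p (V w) = \int[P]_w p^\+ (V w) - \int[P]_w p^\- (V w))%R.
    by rewrite -RintegralB//; apply: eq_Rintegral => w _; rewrite pE.
  rewrite mulrBr.
  by rewrite !rule0//; move=> x; rewrite ?funrpos_ge0 ?funrneg_ge0.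
move=> mf mq intf intq.
have mfp : measurable_fun setT (f^\+)%R by exact: measurable_funrpos.
have mfn : measurable_fun setT (f^\-)%R by exact: measurable_funrneg.
have ifp : I ((f^\+)%R \o U) by exact: (integrable_funrpos measurableT intf).
have ifn : I ((f^\-)%R \o U) by exact: (integrable_funrneg measurableT intf).
have fE x : f x = (f^\+%R x - f^\-%R x)%R by rewrite -[in LHS](funrposBneg f).
under eq_Rintegral do rewrite fE mulrBl.
rewrite RintegralB//; [|exact: integrableM_independent..].
have -> : (\int[P]_w f (U w) = \int[P]_w f^\+ (U w) - \int[P]_w f^\- (U w))%R.
  by rewrite -RintegralB//; apply: eq_Rintegral => w _; rewrite fE.
rewrite mulrBl.
by rewrite !rule//; move=> x; rewrite ?funrpos_ge0 ?funrneg_ge0.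
Qed.

End product_rule.

(** * Summable variables and their means *)

Section expectation.
Context {d : measure_display} {T : measurableType d} {R : realType}.
Variable P : probability T R.

Definition summable_rv (f : T -> R) := P.-integrable setT (fun w => (f w)%:E).

Local Notation intg := summable_rv.
Implicit Types f g : T -> R.

Lemma summable_rv_measurable f : intg f -> measurable_fun setT f.
Proof. by move/(measurable_int P)/measurable_EFinP. Qed.

Lemma summable_rv_le f g : measurable_fun [set: T] f -> intg g ->
  (forall w, `|f w| <= g w) -> intg f.
Proof.
move=> mf ig fg; apply: le_integrable ig => //; first exact/measurable_EFinP.
by move=> w _ /=; rewrite lee_fin (le_trans (fg w))// ler_norm.
Qed.

Lemma summable_rvD f g : intg f -> intg g -> intg (fun w => f w + g w).
Proof. by move=> fi gi; exact: (integrableD measurableT fi gi). Qed.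

Lemma summable_rvB f g : intg f -> intg g -> intg (fun w => f w - g w).
Proof. by move=> fi gi; exact: (integrableB measurableT fi gi). Qed.

Lemma summable_rvZ k f : intg f -> intg (fun w => k * f w).
Proof. by move=> fi; exact: (integrableZl measurableT k fi). Qed.

Lemma summable_rv_cst k : intg (fun=> k).
Proof. exact: finite_measure_integrable_cst. Qed.

Lemma summable_rv_norm f : intg f -> intg (fun w => `|f w|).
Proof. exact: integrable_norm. Qed.

Lemma summable_rv_sum n (f : nat -> T -> R) : (forall i, (i < n)%N -> intg (f i)) ->
  intg (fun w => \sum_(i < n) f i w).
Proof.
elim: n => [_|n IH fi].
  by under eq_fun do rewrite big_ord0; exact: summable_rv_cst.
under eq_fun do rewrite big_ord_recr/=.
by apply: summable_rvD; [apply: IH => i /ltnW|]; exact: fi.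
Qed.

Lemma summable_rv_bounded f k : measurable_fun setT f -> (forall w, `|f w| <= k) ->
  intg f.
Proof. by move=> mf fk; apply: summable_rv_le fk => //; exact: summable_rv_cst. Qed.

Definition mean (f : T -> R) : R := \int[P]_w f w.

Lemma eq_mean f g : f =1 g -> mean f = mean g.
Proof. by move=> fg; congr mean; apply/funext. Qed.

Lemma meanE f : intg f -> (\int[P]_w (f w)%:E)%E = (mean f)%:E.
Proof. by move=> fi; rewrite /mean /Rintegral fineK//; exact: integrable_fin_num. Qed.

Lemma meanD f g : intg f -> intg g -> mean (fun w => f w + g w) = mean f + mean g.
Proof. by move=> fi gi; exact: RintegralD. Qed.

Lemma meanB f g : intg f -> intg g -> mean (fun w => f w - g w) = mean f - mean g.
Proof. by move=> fi gi; exact: RintegralB. Qed.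

Lemma meanZ k f : intg f -> mean (fun w => k * f w) = k * mean f.
Proof. by move=> fi; exact: RintegralZl. Qed.

Lemma mean_cst k : mean (fun=> k) = k.
Proof. by rewrite /mean Rintegral_cst//= probability_setT mulr1. Qed.

Lemma ler_mean f g : intg f -> intg g -> (forall w, f w <= g w) -> mean f <= mean g.
Proof. by move=> fi gi fg; apply: le_Rintegral. Qed.

Lemma mean_ge0 f : (forall w, 0 <= f w) -> 0 <= mean f.
Proof. by move=> f0; exact: Rintegral_ge0. Qed.

Lemma ler_norm_mean f : intg f -> `|mean f| <= mean (fun w => `|f w|).
Proof. by move=> fi; exact: le_normr_Rintegral. Qed.

Lemma mean_sum n (f : nat -> T -> R) : (forall i, (i < n)%N -> intg (f i)) ->
  mean (fun w => \sum_(i < n) f i w) = \sum_(i < n) mean (f i).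
Proof.
elim: n => [_|n IH fi].
  by under eq_mean do rewrite big_ord0; rewrite mean_cst big_ord0.
under eq_mean do rewrite big_ord_recr/=.
rewrite meanD ?big_ord_recr ?IH//=; last exact: fi.
  by move=> i /ltnW; exact: fi.
by apply: summable_rv_sum => i /ltnW; exact: fi.
Qed.

Lemma summable_rv_fin (f : T -> R) (c : R) : measurable_fun setT f ->
  (forall w, 0 <= f w) -> (\int[P]_w (f w)%:E)%E = c%:E ->
  intg f /\ mean f = c.
Proof.
move=> mf f0 fc; split; last by rewrite /mean /Rintegral fc.
apply/integrableP; split; first exact/measurable_EFinP.
under eq_integral do rewrite /= ger0_norm//.
by rewrite fc ltry.
Qed.

Lemma integral_series (f : nat -> T -> R) c : (forall i w, 0 <= f i w) ->
  (forall i, intg (f i)) -> (forall n, \sum_(i < n) mean (f i) <= c) ->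
  cvgn (fun n => \sum_(i < n) mean (f i)) /\
  (\int[P]_w (\sum_(0 <= i <oo) (f i w)%:E) =
    (limn (fun n => \sum_(i < n) mean (f i)))%:E)%E.
Proof.
move=> f0 fi fc.
have m0 i : 0 <= mean (f i) by exact: mean_ge0.
have cf : cvgn (fun n => \sum_(i < n) mean (f i)).
  apply: nondecreasing_is_cvgn.
    move=> m n mn; rewrite -!(big_mkord xpredT (fun i => mean (f i))).
    by rewrite [leRHS](big_cat_nat (n := m))//= lerDl sumr_ge0.
  by exists c => _ [n _ <-].
split=> //; rewrite integral_nneseries//; last 2 first.
- by move=> i; apply/measurable_EFinP; exact: summable_rv_measurable.
- by move=> i w _; rewrite lee_fin.
rewrite -EFin_lim//; apply: congr_lim; apply/funext => n /=.
rewrite big_mkord -sumEFin; apply: eq_bigr => i _; exact: meanE.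
Qed.

End expectation.

(** * Variables determined by the first observations *)

Section adapted.
Context {d : measure_display} {T : measurableType d} {R : realType}.
Variables (P : probability T R) (X : nat -> {mfun T >-> R}).

(** The sample space with the sigma-algebra of the first [n] observations. As a measurable type of
    its own it turns adaptedness into plain measurability, with all its closure properties. *)
Definition past (n : nat) := g_sigma_algebraType
  (\big[setU/set0]_(i < n) preimage_set_system setT (X i.+1 : T -> R) measurable).

Definition adapted (n : nat) (f : T -> R) :=
  measurable_fun [set: past n] (f : past n -> R).

Lemma adapted_measurable n f : adapted n f -> measurable_fun [set: T] f.
Proof.
move=> nf _ B mB; apply: (@measurable_observed _ _ _ X n).
exact: (nf measurableT B mB).
Qed.

Lemma nonanticipating_adapted est n : nonanticipating X est ->
  adapted n (est n.+1).
Proof.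
move=> na _ B mB; apply: (na n.+1 (ltn0Sn _)).
by exists B.
Qed.

Let subset_observed n : observed X n `<=` observed X n.+1.
Proof.
apply: sub_sigma_algebra2; rewrite big_ord_recr/=; exact: subsetUl.
Qed.

Lemma adaptedS n f : adapted n f -> adapted n.+1 f.
Proof. by move=> nf _ B mB; apply: subset_observed; exact: (nf measurableT B mB). Qed.

Lemma adapted_last n (q : R -> R) : measurable_fun setT q ->
  adapted n.+1 (fun w => q (X n.+1 w)).
Proof.
move=> mq _ B mB; apply: sub_sigma_algebra; rewrite big_ord_recr/=; right.
exists (q @^-1` B); last by [].
by rewrite -[X in measurable X]setTI; exact: mq.
Qed.

Hypothesis indX : mutually_independent P X [set n | (0 < n)%N].

Let measurable_past_id n : measurable_fun [set: T] (fun w : T => w : past n).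
Proof.
by move=> _ B mB; rewrite setTI; exact: (@measurable_observed _ _ _ X n).
Qed.

(** The identity, read as a random variable with values in [past n]: it carries the whole past, and
    every adapted variable is a function of it. *)
Let past_id n : {mfun T >-> past n} := mfun_Sub (mem_set (@measurable_past_id n)).

Let past_independent n A B : measurable A -> measurable B ->
  P (past_id n @^-1` A `&` X n.+1 @^-1` B) =
  (P (past_id n @^-1` A) * P (X n.+1 @^-1` B))%E.
Proof. by move=> mA mB; exact: observed_independent. Qed.

Variables (n : nat) (U : T -> R) (q : R -> R).
Hypotheses (aU : adapted n U) (mq : measurable_fun [set: R] q).
Hypotheses (iU : summable_rv P U) (iq : summable_rv P (fun w => q (X n.+1 w))).

Lemma summable_rvM_next : summable_rv P (fun w => U w * q (X n.+1 w)).
Proof. exact: (integrableM_independent (@past_independent n)). Qed.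

Lemma meanM_next :
  mean P (fun w => U w * q (X n.+1 w)) = mean P U * mean P (fun w => q (X n.+1 w)).
Proof. exact: (RintegralM_independent (@past_independent n)). Qed.

End adapted.

(** * Harmonic sums and elementary inequalities *)

Section real_sums.
Context {R : realType}.

Definition harmonic_sum (n : nat) : R := \sum_(i < n) i.+1%:R^-1.

Lemma harmonic_sum_ge0 n : 0 <= harmonic_sum n.
Proof. by apply: sumr_ge0 => i _; rewrite invr_ge0. Qed.

Lemma ln_harmonic_sum n : ln n.+1%:R <= harmonic_sum n.
Proof.
elim: n => [|n IH]; first by rewrite /harmonic_sum big_ord0 ln1.
rewrite /harmonic_sum big_ord_recr/= -/(harmonic_sum n).
have -> : n.+2%:R = n.+1%:R * (1 + n.+1%:R^-1) :> R.
  by rewrite mulrDr mulr1 divff// natr1.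
rewrite lnM ?posrE ?ltr_pwDl ?invr_ge0//.
apply: lerD => //; apply: le_ln1Dx.
by rewrite (lt_le_trans _ (_ : 0 <= _)) ?invr_ge0// ltrN10.
Qed.

Lemma harmonic_sum_le n (x : R) : n%:R <= x -> 1 <= x -> harmonic_sum n <= 1 + ln x.
Proof.
case: n => [|n] nx x1.
  by rewrite /harmonic_sum big_ord0 addr_ge0// ln_ge0.
apply: (@le_trans _ _ (1 + ln n.+1%:R)); last first.
  by rewrite lerD2l ler_ln ?posrE// (lt_le_trans _ x1).
elim: n {x nx x1} => [|n IH].
  by rewrite /harmonic_sum big_ord_recr big_ord0/= add0r invr1 ln1 addr0.
rewrite /harmonic_sum big_ord_recr/= -/(harmonic_sum n.+1).
have h : ln n.+1%:R - ln n.+2%:R <= - n.+2%:R^-1 :> R.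
  rewrite -ln_div ?posrE//.
  have -> : n.+1%:R / n.+2%:R = 1 + - n.+2%:R^-1 :> R.
    have : 0 < n.+1%:R :> R by [].
    by rewrite -[n.+2%:R]natr1; move: (n.+1%:R : R) => y y0; field; lra.
  by apply: le_ln1Dx; rewrite ltrN2 invf_lt1// ltr1n.
rewrite -lerBrDr; apply: le_trans IH _.
by rewrite -addrA lerD2l -lerBlDl.
Qed.

Lemma sum_invr_sqr_tail m n :
  \sum_(i < n) ((m.+1 + i).+1%:R ^+ 2)^-1 <= m.+1%:R^-1 - (m.+1 + n)%:R^-1 :> R.
Proof.
elim: n => [|n IH]; first by rewrite big_ord0 addn0 subrr.
rewrite big_ord_recr/= addnS.
set k := (m.+1 + n)%N.
have k0 : (0 < k)%N by [].
have : (k.+1%:R ^+ 2)^-1 <= k%:R^-1 - k.+1%:R^-1 :> R.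
  have -> : k%:R^-1 - k.+1%:R^-1 = (k%:R * k.+1%:R)^-1 :> R.
    have : 0 < k%:R :> R by rewrite ltr0n.
    by rewrite -natr1; move: (k%:R : R) => y y0; field; apply/andP; split; lra.
  by rewrite lef_pV2 ?posrE ?mulr_gt0 ?exprn_gt0 ?ltr0n// expr2 ler_pM2r ?ltr0n// ler_nat.
move=> /(lerD IH) /le_trans; apply; rewrite -/k.
by rewrite addrA subrK.
Qed.

Lemma sum_invr_sqr_le n : \sum_(i < n) (i.+1%:R ^+ 2)^-1 <= 2 :> R.
Proof.
case: n => [|n]; first by rewrite big_ord0.
rewrite big_ord_recl expr1n invr1 -[2]/(1 + 1) lerD2l.
under eq_bigr do rewrite /= -[bump 0 _]/(1 + _)%N.
apply: le_trans (sum_invr_sqr_tail 0 n) _.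
by rewrite invr1 gerBl invr_ge0.
Qed.

(** The first [N] terms, on which nothing is assumed, are paid for by their absolute values, so the
    extra constant does not depend on [n]. *)
Lemma ler_sum_eventually (u v : nat -> R) N : (forall i, 0 <= v i) ->
  (forall i, (N <= i)%N -> u i <= v i) ->
  forall n, \sum_(i < n) u i <= \sum_(i < n) v i + \sum_(i < N) `|u i|.
Proof.
move=> v0 uv n.
have h k : \sum_(i < k) u i <= \sum_(i < k) v i + \sum_(i < k | (i < N)%N) `|u i|.
  rewrite [X in _ + X]big_mkcond/= -big_split/=; apply: ler_sum => i _.
  case: ltnP => iN; last by rewrite addr0 uv.
  by rewrite (le_trans (ler_norm _))// lerDr.
apply: le_trans (h n) _; rewrite lerD2l.
have [nN|Nn] := leqP n N.
  rewrite (big_ord_widen_cond N (fun i => (i < N)%N) (fun i => `|u i|))//.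
  by rewrite [leLHS]big_mkcond/=; apply: ler_sum => i _; case: ifP.
by rewrite [leRHS](big_ord_widen n (fun i => `|u i|)) 1?ltnW.
Qed.

(** Either [k * x ^+ 2 <= 1], and the first term suffices, or [x ^+ 2 <= k * x ^+ 4]. The factor
    [h], later the indicator of running or of having stopped, survives in the first term only. *)
Lemma ler_sqr_split (x k h : R) : 0 <= h <= 1 -> 0 < k ->
  h * x ^+ 2 <= h / k + k * x ^+ 4.
Proof.
move=> /andP[h0 h1] k0.
have -> : x ^+ 4 = x ^+ 2 * x ^+ 2 by rewrite -exprD.
have y0 := sqr_ge0 x; move: (x ^+ 2) y0 => y y0.
have [yk|yk] := leP (k * y) 1.
  rewrite -[leLHS]addr0 lerD ?mulr_ge0 ?(ltW k0)//.
  by apply: ler_wpM2l => //; rewrite -div1r ler_pdivlMr// mulrC.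
rewrite -[leLHS]add0r lerD ?divr_ge0 ?(ltW k0)//.
rewrite mulrA; apply: ler_wpM2r => //.
exact: le_trans h1 (ltW yk).
Qed.

End real_sums.

Section real_inequalities.
Context {R : realType}.
Implicit Types a s x y M : R.

Lemma expR_ge_sqr x : 0 <= x -> x ^+ 2 / 2 <= expR x.
Proof.
move=> x0; apply: le_trans (expR_ge1Dxn 1 x0).
by rewrite lerDr ler01.
Qed.

(** This is [1 + u <= expR u] at [u = lam * (s + M)]. The product form separates the position [s],
    known from the past, from the bound [M] on the next step. *)
Lemma max0_le_expR lam s y M : 0 < lam -> y <= M ->
  Num.max (s + y) 0 <= expR (lam * s) * (expR (lam * M) / lam).
Proof.
move=> lam0 yM; rewrite ge_max; apply/andP; split; last first.
  by rewrite mulr_ge0 ?expR_ge0// divr_ge0 ?expR_ge0// ltW.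
rewrite mulrA -expRD -mulrDr ler_pdivlMr// mulrC.
apply: (@le_trans _ _ (lam * (s + M))); first by rewrite ler_pM2l// lerD2l.
by apply: le_trans (expR_ge1Dx _); rewrite lerDr.
Qed.

(** By convexity the exponential grows by at least [lam * expR (lam * s)] times the capped
    increment, and capping costs the increment at most [M ^+ 2 / cap]. *)
Lemma capped_expR_drift lam cap s y M : 0 < lam -> 0 < cap -> s <= 0 ->
  `|y| <= M ->
  lam * expR (lam * s) * (y - M ^+ 2 / cap) <=
  expR (lam * Num.min (s + y) cap) - expR (lam * s).
Proof.
move=> lam0 cap0 s0 yM.
set t := Num.min (s + y) cap - s.
have yt : y - M ^+ 2 / cap <= t.
  have M0 : 0 <= M by apply: le_trans yM.
  have yM2 : y ^+ 2 <= M ^+ 2.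
    by rewrite -real_normK ?num_real// lerXn2r ?nnegrE.
  rewrite /t /Num.min; case: ifPn => _.
    by rewrite addrAC subrr add0r gerBl divr_ge0 ?sqr_ge0// ltW.
  (* When the cap acts, the capped increment is [cap - s >= cap], and [y <= cap + M ^+ 2 / cap]
     follows from [(y - cap / 2) ^+ 2 >= 0]. *)
  rewrite lerBlDr.
  have -> : cap - s + M ^+ 2 / cap = (cap ^+ 2 - cap * s + M ^+ 2) / cap.
    by field; rewrite gt_eqF.
  rewrite ler_pdivlMr//; have := sqr_ge0 (y - cap / 2).
  have : 0 <= cap * - s by rewrite mulr_ge0 ?oppr_ge0// ltW.
  have := sqr_ge0 cap; nra.
have -> : Num.min (s + y) cap = s + t by rewrite /t addrCA subrr addr0.
have -> : expR (lam * (s + t)) = expR (lam * s) * expR (lam * t).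
  by rewrite mulrDr expRD.
rewrite -[X in _ <= _ - X]mulr1 -mulrBr (mulrC lam) -mulrA.
rewrite ler_pM2l ?expR_gt0//.
apply: (@le_trans _ _ (lam * t)); first by rewrite ler_pM2l.
by rewrite lerBrDl expR_ge1Dx.
Qed.

End real_inequalities.

Lemma measurable_ltr_cst {d : measure_display} {T : measurableType d}
    {R : realType} (f : T -> R) (b : R) : measurable_fun [set: T] f ->
  measurable_fun [set: T] (fun w => (f w < b)%R%:R : R).
Proof.
move=> mf; rewrite (_ : (fun _ => _) = \1_(`]-oo, b[) \o f); last first.
  by apply/funext => w /=; rewrite indicE mem_setE in_itv.
exact: measurableT_comp.
Qed.

Lemma adapted_ltr {d : measure_display} {T : measurableType d} {R : realType}
    (X : nat -> {mfun T >-> R}) n f (b : R) : adapted X n f ->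
  adapted X n (fun w => (f w < b)%R%:R).
Proof. exact: (@measurable_ltr_cst _ (past X n)). Qed.

(** * First passage of a walk with a small drift loss *)

(* In the application [walk] is [log Lambda_n], [l = ln],
   [A i = theta_(i+1) - theta_0], [C i] is the matching difference of
   [log Gamma], [Z i = theta_(i+1) - theta] and [I0 = I(theta, theta_0)], so that
   [drift_loss i = I(theta, theta_(i+1))]; below, [J = I(theta) / 2] and
   [rho = 1 / (2 kappa(theta))]. *)
Section stopped_sums.
Context {d : measure_display} {T : measurableType d} {R : realType}.
Variables (P : probability T R) (X : nat -> {mfun T >-> R}).
Hypothesis indX : mutually_independent P X [set n | (0 < n)%N].
Variables (l : R -> R) (A C Z : nat -> T -> R).
Hypothesis ml : measurable_fun [set: R] l.
Hypotheses (aA : forall i, adapted X i (A i)) (aC : forall i, adapted X i (C i)).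
Hypothesis aZ : forall i, adapted X i (Z i).

Local Notation intg := (summable_rv P).
Local Notation E := (mean P).
Local Notation L i w := (l (X i.+1 w)).

Hypotheses (iA : forall i, intg (A i)) (iC : forall i, intg (C i)).
Variable a : R.
Hypothesis a_gt0 : 0 < a.
Hypothesis iexp : intg (fun w => expR (a * `|L 0 w|)).
Hypothesis same_law : forall (q : R -> R) i, measurable_fun [set: R] q ->
  intg (fun w => q (L 0 w)) ->
  intg (fun w => q (L i w)) /\ E (fun w => q (L i w)) = E (fun w => q (L 0 w)).
Variable I0 : R.
Hypothesis I0_gt0 : 0 < I0.

Definition drift_loss i w := I0 - (A i w * E (fun v => L 0 v) - C i w).
Local Notation K := drift_loss.
Hypothesis K_ge0 : forall i w, 0 <= K i w.

Variables (delta B : R).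
Hypotheses (delta_gt0 : 0 < delta) (B_gt0 : 0 < B).
Hypothesis close : forall i w, `|Z i w| <= delta ->
  [/\ `|A i w| <= B, `|C i w| <= B & K i w <= I0 / 4].

Definition far (e : R) i w : R := (e < `|Z i w|)%R%:R.

Hypothesis far_bounded : forall e : R, 0 < e -> exists c, forall n,
  \sum_(i < n) E (fun w => far e i w * (1 + `|A i w| + `|C i w|)) <= c.

Definition increment i w := A i w * L i w - C i w.
Local Notation Y := increment.

Definition walk n w := \sum_(i < n) Y i w.
Local Notation S := walk.

(* [1(tau_b > n)], for [tau_b] the first passage of [walk] to [b] *)
Fixpoint running (b : R) n w : R :=
  if n is n'.+1 then running b n' w * (S n w < b)%R%:R else (S 0 w < b)%R%:R.
Local Notation run := running.

Lemma running01 (b : R) n w : run b n w = 0 \/ run b n w = 1 /\ S n w < b.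
Proof.
elim: n => [|n [IH|[IH _]]] /=.
- by case: ltP => _; [right|left].
- by left; rewrite IH mul0r.
- by rewrite IH; case: ltP => _; [right; rewrite mulr1|left; rewrite mulr0].
Qed.

Lemma running_ge0 b n w : 0 <= run b n w.
Proof. by have [->|[-> _]] := running01 b n w. Qed.

Lemma running_le1 b n w : run b n w <= 1.
Proof. by have [->|[-> _]] := running01 b n w. Qed.

Lemma runningS_le b n w : run b n.+1 w <= run b n w.
Proof. by rewrite /= ler_piMr ?running_ge0//; case: ltP. Qed.

Lemma running_nonincreasing b m n w : (m <= n)%N -> run b n w <= run b m w.
Proof.
by move=> /subnK <-; elim: (n - m)%N => // k IH; exact: le_trans (runningS_le _ _ _) IH.
Qed.

Lemma adapted_next i : adapted X i.+1 (fun w => L i w).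
Proof. exact: adapted_last. Qed.

Lemma adapted_walk n : adapted X n (S n).
Proof.
elim: n => [|n IH].
  rewrite (_ : walk 0 = fun=> 0); first exact: measurable_cst.
  by apply/funext => w; rewrite /walk big_ord0.
rewrite (_ : walk n.+1 = fun w => S n w + Y n w); last first.
  by apply/funext => w; rewrite /walk big_ord_recr.
apply: measurable_funD; first exact: adaptedS.
apply: measurable_funB; last exact: adaptedS.
by apply: measurable_funM; [exact: adaptedS|exact: adapted_next].
Qed.

Lemma adapted_running b n : adapted X n (run b n).
Proof.
elim: n => [|n IH]; first exact: (adapted_ltr b (@adapted_walk 0)).
apply: measurable_funM; first exact: adaptedS.
exact: (adapted_ltr b (@adapted_walk n.+1)).
Qed.

Lemma adapted_far e i : adapted X i (far e i).
Proof.
rewrite /adapted (_ : far e i = fun w => (- `|Z i w| < - e)%R%:R); last first.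
  by apply/funext => w; rewrite ltrN2.
apply: adapted_ltr; apply: measurable_funN.
by apply: measurableT_comp => //; exact: aZ.
Qed.

Lemma far_ge0 e i w : 0 <= far e i w.
Proof. by rewrite /far; case: ltP. Qed.

Lemma far_le1 e i w : far e i w <= 1.
Proof. by rewrite /far; case: ltP. Qed.

Lemma intg_L : intg (fun w => `|L 0 w|).
Proof.
apply: (summable_rv_le _ (summable_rvZ a^-1 iexp)).
  by apply: measurableT_comp => //; exact: measurableT_comp.
move=> w; rewrite normr_id mulrC ler_pdivlMr// mulrC.
by apply: le_trans (expR_ge1Dx _); rewrite lerDr.
Qed.

Let idL i : intg (fun w => L i w) /\ E (fun w => L i w) = E (fun w => L 0 w).
Proof.
apply: (same_law (q := id)) => //.
apply: (summable_rv_le _ intg_L) => //; exact: measurableT_comp.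
Qed.

Let absL i : intg (fun w => `|L i w|) /\
  E (fun w => `|L i w|) = E (fun w => `|L 0 w|).
Proof. exact: (same_law (q := Num.norm)) intg_L. Qed.

Lemma intg_drift_loss i : intg (K i).
Proof.
apply: summable_rvB; first exact: summable_rv_cst.
apply: summable_rvB => //; rewrite (_ : (fun _ => _) =
  (fun w => E (fun v => L 0 v) * A i w)); first exact: summable_rvZ.
by apply/funext => w; rewrite mulrC.
Qed.

Lemma intg_increment i : intg (Y i).
Proof.
apply: summable_rvB => //.
by apply: (@summable_rvM_next _ _ _ _ X indX i (A i) l) => //; case: (idL i).
Qed.

Section bounded_factor.
Variables (i : nat) (H : T -> R).
Hypotheses (aH : adapted X i H) (H0 : forall w, 0 <= H w) (H1 : forall w, H w <= 1).

Let mH : measurable_fun [set: T] H := adapted_measurable aH.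

Lemma summable_rvM_bounded f : intg f -> intg (fun w => H w * f w).
Proof.
move=> fi; apply: (summable_rv_le _ (summable_rv_norm fi)).
  by apply: measurable_funM => //; exact: summable_rv_measurable fi.
by move=> w; rewrite normrM ler_piMl// ger0_norm.
Qed.

(** Testing against an arbitrary adapted [H] expresses, without conditional expectation, that
    [I0 - K i] is the mean of [Y i] given the past: [H], [A i] and [C i] are known then, and only
    [L i] is integrated out. *)
Lemma mean_increment :
  E (fun w => H w * Y i w) = E (fun w => H w * (I0 - K i w)).
Proof.
have iHA := summable_rvM_bounded (iA i).
have [iL eL] := idL i.
have aHA : adapted X i (fun w => H w * A i w).
  by apply: measurable_funM; [exact: aH|exact: aA].
transitivity (E (fun w => (H w * A i w) * L i w - H w * C i w)).
  by apply: eq_mean => w; rewrite /increment mulrBr mulrA.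
rewrite meanB; last 2 first.
- exact: (summable_rvM_next indX aHA).
- exact: summable_rvM_bounded.
rewrite (meanM_next indX aHA)// eL mulrC -meanZ// -meanB; last 2 first.
- exact: summable_rvZ.
- exact: summable_rvM_bounded.
by apply: eq_mean => w; rewrite /drift_loss; ring.
Qed.

Lemma mean_abs_increment :
  E (fun w => H w * `|Y i w|) <=
  (1 + E (fun w => `|L 0 w|)) * E (fun w => H w * (1 + `|A i w| + `|C i w|)).
Proof.
have [iL eL] := absL i.
have iHA : intg (fun w => H w * `|A i w|).
  exact/summable_rvM_bounded/summable_rv_norm.
have iHC : intg (fun w => H w * `|C i w|).
  exact/summable_rvM_bounded/summable_rv_norm.
have aHA : adapted X i (fun w => H w * `|A i w|).
  apply: measurable_funM; first exact: aH.
  by apply: measurableT_comp => //; exact: aA.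
have iAC : intg (fun w => 1 + `|A i w| + `|C i w|).
  apply: summable_rvD; last exact: summable_rv_norm.
  by apply: summable_rvD; [exact: summable_rv_cst|exact: summable_rv_norm].
have mq : measurable_fun [set: R] (fun x => `|l x|) by exact: measurableT_comp.
have iHAL : intg (fun w => (H w * `|A i w|) * `|L i w|).
  exact: (summable_rvM_next indX aHA mq).
apply: (@le_trans _ _ (E (fun w => (H w * `|A i w|) * `|L i w| + H w * `|C i w|))).
  apply: ler_mean.
  - exact/summable_rvM_bounded/summable_rv_norm/intg_increment.
  - exact: summable_rvD.
  - move=> w; rewrite -mulrA -mulrDr ler_wpM2l// -normrM /increment.
    exact: ler_normB.
rewrite meanD// (meanM_next indX aHA mq)// eL.
set u := E (fun w => `|L 0 w|).
have u0 : 0 <= u by apply: mean_ge0.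
have HA : E (fun w => H w * `|A i w|) <= E (fun w => H w * (1 + `|A i w| + `|C i w|)).
  apply: ler_mean => //; first exact: summable_rvM_bounded.
  by move=> w; rewrite ler_wpM2l// -addrA addrCA lerDl addr_ge0.
have HC : E (fun w => H w * `|C i w|) <= E (fun w => H w * (1 + `|A i w| + `|C i w|)).
  apply: ler_mean => //; first exact: summable_rvM_bounded.
  by move=> w; rewrite ler_wpM2l// lerDr addr_ge0.
by rewrite mulrDl mul1r addrC lerD// mulrC ler_wpM2l.
Qed.

End bounded_factor.

(** * The stopped walk and its overshoot *)

Definition stopped b n w := \sum_(i < n) run b i w * Y i w.

(** At most one term is nonzero, the one at the crossing. For [b > 0] this is the overshoot if
    passage occurs by time [n], and zero otherwise; [stopped] is the walk at passage or at time [n],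
    whichever is first. *)
Definition excess b n w := \sum_(i < n) run b i w * Num.max (S i.+1 w - b) 0.

Lemma walkS n w : S n.+1 w = S n w + Y n w.
Proof. by rewrite /walk big_ord_recr. Qed.

Lemma stopped_running b n w : run b n w = 1 -> stopped b n w = S n w.
Proof.
elim: n => [_|n IH]; first by rewrite /stopped /walk !big_ord0.
have [r0|[r1 _]] := running01 b n w.
  by rewrite /= r0 mul0r => /esym/eqP; rewrite oner_eq0.
by move=> _; rewrite /stopped big_ord_recr/= r1 mul1r walkS -IH.
Qed.

Lemma stopped_ge b n w : 0 < b -> run b n w = 0 -> b <= stopped b n w.
Proof.
move=> b0; elim: n => [|n IH].
  by rewrite /= /walk big_ord0 b0 => /eqP; rewrite oner_eq0.
rewrite /stopped big_ord_recr/=.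
have [r0|[r1 _]] := running01 b n w; first by rewrite r0 !mul0r addr0 => _; exact: IH.
have := stopped_running r1; rewrite /stopped => ->.
rewrite r1 !mul1r -walkS; case: ltP => // _ /eqP.
by rewrite oner_eq0.
Qed.

Lemma excess_ge0 b n w : 0 <= excess b n w.
Proof. by apply: sumr_ge0 => i _; rewrite mulr_ge0 ?running_ge0// le_max lexx orbT. Qed.

Lemma stopped_le b n w : 0 < b -> stopped b n w <= b + excess b n w.
Proof.
move=> b0; elim: n => [|n IH].
  by rewrite /stopped big_ord0 addr_ge0 ?excess_ge0// ltW.
have [r0|[r1 _]] := running01 b n w.
  by rewrite /stopped /excess !big_ord_recr/= r0 !mul0r !addr0.
have := stopped_running r1.
rewrite {1}/stopped => sE; rewrite /stopped /excess !big_ord_recr/= sE r1 !mul1r -walkS.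
rewrite -lerBlDl -[leLHS]add0r lerD//; first exact: excess_ge0.
by rewrite le_max lexx.
Qed.

Lemma norm_stopped_le b n w :
  `|stopped b n w| <= \sum_(i < n) run b i w * `|Y i w|.
Proof.
apply: le_trans (ler_norm_sum _ _ _) _; apply: ler_sum => i _.
by rewrite normrM ger0_norm ?running_ge0.
Qed.

(** With this rate [lam * M y] is [a] times one plus the modulus of [y], so the exponential of
    [lam * M (L i w)] is integrable by [iexp]. *)
Let lam := a / B.

Let lam_gt0 : 0 < lam. Proof. exact: divr_gt0. Qed.

(** Bounds the increment on a close step through the new observation alone, hence independently of
    the past. *)
Let M (y : R) := B * (`|y| + 1).

Let M_ge0 y : 0 <= M y. Proof. by rewrite mulr_ge0 ?addr_ge0// ltW. Qed.

Let measurable_M : measurable_fun [set: R] M.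
Proof.
apply: measurable_funM; first exact: measurable_cst.
by apply: measurable_funD; [exact: normr_measurable|exact: measurable_cst].
Qed.

Let measurable_M_L i : measurable_fun [set: T] (fun w => M (L i w)).
Proof.
by apply: measurableT_comp => //; apply: measurableT_comp => //; exact: measurable_funP.
Qed.

Let expM i : intg (fun w => expR (lam * M (L i w)) / lam) /\
  E (fun w => expR (lam * M (L i w)) / lam) =
  E (fun w => expR (lam * M (L 0 w)) / lam).
Proof.
apply: (same_law (q := fun y => expR (lam * M y) / lam)).
  apply: measurable_funM; last exact: measurable_cst.
  by apply: measurableT_comp => //; apply: measurable_funM => //; exact: measurable_cst.
rewrite (_ : (fun _ => _) = fun w => expR a / lam * expR (a * `|L 0 w|)).
  exact: summable_rvZ.
apply/funext => w; rewrite /M /lam mulrA divfK ?gt_eqF// mulrDr mulr1 expRD.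
ring.
Qed.

Let sqrM i : intg (fun w => M (L i w) ^+ 2) /\
  E (fun w => M (L i w) ^+ 2) = E (fun w => M (L 0 w) ^+ 2).
Proof.
apply: (same_law (q := fun y => M y ^+ 2)); first exact: measurable_funX.
have [i0 _] := expM 0.
apply: (summable_rv_le _ (summable_rvZ (2 / lam) i0)).
  exact/measurable_funX/measurable_M_L.
move=> w; rewrite ger0_norm ?sqr_ge0//.
have -> : M (L 0 w) ^+ 2 = 2 / lam * ((lam * M (L 0 w)) ^+ 2 / 2 / lam).
  by field; rewrite gt_eqF.
apply: ler_wpM2l; first by rewrite divr_ge0// ltW.
apply: ler_wpM2r; first by rewrite invr_ge0 ltW.
by rewrite expR_ge_sqr// mulr_ge0// ltW.
Qed.

Let absM i : intg (fun w => M (L i w)) /\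
  E (fun w => M (L i w)) = E (fun w => M (L 0 w)).
Proof.
apply: same_law => //.
rewrite /M; apply: summable_rvZ; apply: summable_rvD; first exact: intg_L.
exact: summable_rv_cst.
Qed.

Lemma increment_close i w : `|Z i w| <= delta -> `|Y i w| <= M (L i w).
Proof.
move=> /close[AB CB _]; rewrite /increment /M mulrDr mulr1.
apply: le_trans (ler_normB _ _) _; rewrite lerD// normrM.
by rewrite ler_wpM2r.
Qed.

Let farP i w : (far delta i w = 0 /\ `|Z i w| <= delta) \/ far delta i w = 1.
Proof. by rewrite /far; case: ltP => h; [right|left]. Qed.

Let intg_run b i : intg (run b i).
Proof.
apply: (@summable_rv_bounded _ _ _ _ _ 1).
  exact: adapted_measurable (@adapted_running b i).
by move=> w; rewrite ger0_norm ?running_ge0 ?running_le1.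
Qed.

Let intg_far e i : intg (far e i).
Proof.
apply: (@summable_rv_bounded _ _ _ _ _ 1).
  exact: adapted_measurable (@adapted_far e i).
by move=> w; rewrite ger0_norm ?far_ge0 ?far_le1.
Qed.

Lemma far_increment : exists c, forall n,
  \sum_(i < n) E (fun w => far delta i w * `|Y i w|) <= c.
Proof.
have [c cE] := far_bounded delta_gt0.
exists ((1 + E (fun w => `|L 0 w|)) * c) => n.
apply: (@le_trans _ _ ((1 + E (fun w => `|L 0 w|)) *
    \sum_(i < n) E (fun w => far delta i w * (1 + `|A i w| + `|C i w|)))).
  rewrite mulr_sumr; apply: ler_sum => i _; apply: mean_abs_increment.
  - exact: adapted_far.
  - exact: far_ge0.
  - exact: far_le1.
by rewrite ler_wpM2l// addr_ge0// mean_ge0.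
Qed.

Let intg_weight i : intg (fun w => 1 + `|A i w| + `|C i w|).
Proof.
apply: summable_rvD; last exact: summable_rv_norm.
by apply: summable_rvD; [exact: summable_rv_cst|exact: summable_rv_norm].
Qed.

Lemma drift_loss_le i w :
  K i w <= (I0 + `|E (fun v => L 0 v)| + 1) * (1 + `|A i w| + `|C i w|).
Proof.
rewrite /drift_loss; set m := E _.
have h1 : - (A i w * m) <= `|A i w| * `|m| by rewrite -normrM -normrN ler_norm.
have h2 : C i w <= `|C i w| by exact: ler_norm.
have := normr_ge0 (A i w); have := normr_ge0 (C i w); have := normr_ge0 m.
move: h1 h2 I0_gt0; nra.
Qed.

Lemma far_drift_loss e : 0 < e -> exists c, forall n,
  \sum_(i < n) E (fun w => far e i w * K i w) <= c.
Proof.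
move=> e0; have [c cE] := far_bounded e0.
set k := I0 + `|E (fun v => L 0 v)| + 1.
have k0 : 0 <= k by rewrite !addr_ge0// ltW.
exists (k * c) => n.
apply: (@le_trans _ _
    (k * \sum_(i < n) E (fun w => far e i w * (1 + `|A i w| + `|C i w|)))).
  rewrite mulr_sumr; apply: ler_sum => i _.
  have iw : intg (fun w => far e i w * (1 + `|A i w| + `|C i w|)).
    exact: (summable_rvM_bounded (@adapted_far e i) (far_ge0 e i) (far_le1 e i)).
  rewrite -meanZ//; apply: ler_mean.
  - apply: (summable_rvM_bounded (@adapted_far e i) (far_ge0 e i) (far_le1 e i)).
    exact: intg_drift_loss.
  - exact: summable_rvZ.
  - by move=> w; rewrite mulrCA ler_wpM2l ?far_ge0// drift_loss_le.
by rewrite ler_wpM2l.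
Qed.

(** The sum telescopes to the value at passage or at time [n] minus the initial one; the former is
    at most [expR (lam * cap)] and the latter is nonnegative. *)
Lemma capped_telescope (b cap : R) n w :
  \sum_(i < n) run b i w * (expR (lam * Num.min (S i.+1 w - b) cap) -
                            expR (lam * Num.min (S i w - b) cap)) <= expR (lam * cap).
Proof.
pose V i := expR (lam * Num.min (S i w - b) cap).
have Vle i : V i <= expR (lam * cap) by rewrite ler_expR ler_pM2l// ge_min lexx orbT.
(* The invariant: while running, the sum is at most the current value of [V]; after passage, at most
   its ceiling. *)
suff : \sum_(i < n) run b i w * (V i.+1 - V i) <=
    run b n w * V n + (1 - run b n w) * expR (lam * cap).
  have := ler_wpM2l (running_ge0 b n w) (Vle n); rewrite /V; lra.
elim: n => [|n IH].
  rewrite big_ord0 addr_ge0// mulr_ge0 ?expR_ge0 ?running_ge0//.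
  by rewrite subr_ge0 running_le1.
rewrite big_ord_recr/=; have [r0|[r1 _]] := running01 b n w.
  by move: IH; rewrite r0 !mul0r !addr0 subr0.
move: IH; rewrite r1 subrr !mul1r mul0r addr0 => IH.
apply: (@le_trans _ _ (V n.+1)); first by move: IH; rewrite /V; lra.
by case: ltP => _; rewrite ?mul1r ?mul0r ?subrr ?mul0r ?addr0 ?subr0 ?add0r ?mul1r.
Qed.

(** The exponential on running, close steps. Below the level the cap is inactive, so it does not
    appear. *)
Let weight b i w := run b i w * (1 - far delta i w) * expR (lam * (S i w - b)).

Let weight_ge0 b i w : 0 <= weight b i w.
Proof.
by rewrite !mulr_ge0 ?expR_ge0 ?running_ge0// subr_ge0 far_le1.
Qed.

Let weight_le1 b i w : weight b i w <= 1.
Proof.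
rewrite /weight; have [->|[-> sb]] := running01 b i w; first by rewrite !mul0r.
rewrite mul1r; apply: mulr_ile1; rewrite ?expR_ge0 ?subr_ge0 ?far_le1//.
  by rewrite gerBl far_ge0.
by rewrite expR_le1 pmulr_rle0// subr_le0 ltW.
Qed.

Let adapted_weight b i : adapted X i (weight b i).
Proof.
apply: measurable_funM.
  apply: measurable_funM; first exact: adapted_running.
  by apply: measurable_funB; [exact: measurable_cst|exact: adapted_far].
apply: measurableT_comp => //; apply: measurable_funM; first exact: measurable_cst.
by apply: measurable_funB; [exact: adapted_walk|exact: measurable_cst].
Qed.

Let intg_weightM b i f : intg f -> intg (fun w => weight b i w * f w).
Proof. exact: (summable_rvM_bounded (@adapted_weight b i)). Qed.

Let intg_farM i f : intg f -> intg (fun w => far delta i w * f w).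
Proof.
exact: (summable_rvM_bounded (@adapted_far delta i) (far_ge0 _ _) (far_le1 _ _)).
Qed.

Let intg_runM b i f : intg f -> intg (fun w => run b i w * f w).
Proof.
exact: (summable_rvM_bounded (@adapted_running b i) (running_ge0 _ _) (running_le1 _ _)).
Qed.

Let intg_b_weight b i : intg (weight b i).
Proof.
have := @intg_weightM b i _ (summable_rv_cst P 1).
by congr summable_rv; apply/funext => w; rewrite mulr1.
Qed.

(** The drifts of the capped exponential add up to at most [expR (lam * cap)]. A close step
    contributes at least [lam * (I0 / 2)] times its weight: the mean increment is at least
    [3 * I0 / 4] and the cap costs at most [I0 / 4]. A far step lowers an exponential that is at
    most [1] while running, so it costs at most [1], and the probabilities of far steps are
    summable. *)
Lemma weight_sum : exists c, forall b n, \sum_(i < n) E (weight b i) <= c.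
Proof.
have [c cE] := far_bounded delta_gt0.
pose m2 := E (fun w => M (L 0 w) ^+ 2).
have m2_ge0 : 0 <= m2 by apply: mean_ge0 => w; exact: sqr_ge0.
(* Makes the cost [m2 / cap] of the cap at most [I0 / 4]; the added [1] gives positivity at once. *)
pose cap := 4 * m2 / I0 + 1.
have cap_gt0 : 0 < cap by rewrite ltr_pwDr// divr_ge0 ?mulr_ge0// ltW.
have m2cap : m2 / cap <= I0 / 4.
  rewrite ler_pdivrMr//.
  have -> : I0 / 4 * cap = m2 + I0 / 4 by rewrite /cap; field; rewrite gt_eqF.
  by rewrite lerDl divr_ge0// ltW.
exists ((expR (lam * cap) + c) / (lam * (I0 / 2))) => b n.
have lamI : 0 < lam * (I0 / 2) by apply: mulr_gt0 => //; exact: divr_gt0.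
rewrite ler_pdivlMr//.
have pointwise w : \sum_(i < n) (lam * (weight b i w * (Y i w - M (L i w) ^+ 2 / cap))
    - far delta i w) <= expR (lam * cap).
  apply: le_trans (capped_telescope b cap n w); apply: ler_sum => i _.
  rewrite /weight; have [->|[-> sb]] := running01 b i w.
    by rewrite !mul0r mulr0 sub0r oppr_le0 far_ge0.
  have s0 : S i w - b <= 0 by rewrite subr_le0 ltW.
  have -> : Num.min (S i w - b) cap = S i w - b.
    by rewrite min_l// (le_trans s0)// ltW.
  rewrite !mul1r walkS (addrAC (S i w)).
  have [[-> Zi]|->] := farP i w.
    rewrite !subr0 mul1r mulrA. apply: capped_expR_drift => //.
    exact: increment_close.
  rewrite subrr !mul0r mulr0 sub0r lerBrDl.
  have : expR (lam * (S i w - b)) <= 1 by rewrite expR_le1 pmulr_rle0.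
  have := expR_ge0 (lam * Num.min (S i w - b + Y i w) cap); lra.
have iterm i : intg (fun w => lam * (weight b i w * (Y i w - M (L i w) ^+ 2 / cap))
    - far delta i w).
  apply: summable_rvB => //; apply: summable_rvZ; apply: intg_weightM.
  apply: summable_rvB; first exact: intg_increment.
  rewrite (_ : (fun _ => _) = fun w => cap^-1 * M (L i w) ^+ 2).
    by apply: summable_rvZ; case: (sqrM i).
  by apply/funext => w; rewrite mulrC.
have : \sum_(i < n) (lam * (I0 / 2) * E (weight b i) -
    E (fun w => far delta i w * (1 + `|A i w| + `|C i w|))) <= expR (lam * cap).
  apply: (@le_trans _ _ (E (fun w => \sum_(i < n)
      (lam * (weight b i w * (Y i w - M (L i w) ^+ 2 / cap)) - far delta i w)))); last first.
    rewrite -[leRHS](mean_cst P); apply: ler_mean => //.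
    - exact: (@summable_rv_sum _ _ _ _ n (fun i w =>
        lam * (weight b i w * (Y i w - M (L i w) ^+ 2 / cap)) - far delta i w)).
    - exact: summable_rv_cst.
  rewrite (mean_sum (f := fun i w =>
    lam * (weight b i w * (Y i w - M (L i w) ^+ 2 / cap)) - far delta i w))//.
  apply: ler_sum => i _.
  have [iM eM] := sqrM i.
  have iWY : intg (fun w => weight b i w * Y i w).
    exact/intg_weightM/intg_increment.
  have iWM : intg (fun w => weight b i w * M (L i w) ^+ 2) by exact: intg_weightM.
  have iWK : intg (fun w => weight b i w * (I0 - K i w)).
    apply: intg_weightM; apply: summable_rvB; first exact: summable_rv_cst.
    exact: intg_drift_loss.
  have -> : E (fun w => lam * (weight b i w * (Y i w - M (L i w) ^+ 2 / cap))
      - far delta i w) =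
      lam * (E (fun w => weight b i w * (I0 - K i w)) - E (weight b i) * m2 / cap) -
      E (far delta i).
    rewrite meanB//; last first.
      apply: summable_rvZ; rewrite (_ : (fun _ => _) =
        fun w => weight b i w * Y i w - cap^-1 * (weight b i w * M (L i w) ^+ 2)).
        by apply: summable_rvB => //; exact: summable_rvZ.
      by apply/funext => w; ring.
    congr (_ - _); rewrite (eq_mean P (g := fun w => lam * (weight b i w * Y i w) -
        lam / cap * (weight b i w * M (L i w) ^+ 2))); last by move=> w; ring.
    rewrite meanB ?meanZ//; [|exact: summable_rvZ..].
    rewrite (mean_increment (@adapted_weight b i))//.
    rewrite (meanM_next indX (@adapted_weight b i) (q := fun y => M (l y) ^+ 2))//.
      by rewrite eM -/m2; ring.
    by apply: measurable_funX; exact: measurableT_comp.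
  apply: lerB.
    rewrite -[leLHS]mulrA (ler_pM2l lam_gt0).
    have hK : 3 * I0 / 4 * E (weight b i) <= E (fun w => weight b i w * (I0 - K i w)).
      rewrite -meanZ//; apply: ler_mean => //; first exact: summable_rvZ.
      move=> w; rewrite mulrC; have [[f0 Zi]|f1] := farP i w; last first.
        by rewrite /weight f1 subrr mulr0 !mul0r.
      by rewrite ler_wpM2l//; have [_ _] := close Zi; lra.
    have : E (weight b i) * (m2 / cap) <= E (weight b i) * (I0 / 4).
      by rewrite ler_wpM2l// mean_ge0.
    by rewrite mulrA; move: hK; lra.
  apply: ler_mean => //; first exact: intg_farM.
  move=> w; rewrite ler_peMr ?far_ge0// -addrA lerDl addr_ge0//.
rewrite sumrB -mulr_sumr lerBlDr mulrC => /le_trans; apply.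
by rewrite lerD2l.
Qed.

(** On a close step [max0_le_expR] bounds the excess by [weight] times a factor of the new
    observation with fixed mean, and [weight_sum] applies. On a far step the excess is at most the
    modulus of the increment, since the walk was below [b]. *)
Lemma overshoot : exists c, forall b n, 0 < b -> E (stopped b n) <= b + c.
Proof.
have [c1 c1E] := weight_sum; have [c2 c2E] := far_increment.
pose m := E (fun w => expR (lam * M (L 0 w)) / lam).
have m_ge0 : 0 <= m by apply: mean_ge0 => w; rewrite divr_ge0 ?expR_ge0// ltW.
exists (m * c1 + c2) => b n b_gt0.
pose f i w := weight b i w * (expR (lam * M (L i w)) / lam) + far delta i w * `|Y i w|.
have i1 i : intg (fun w => weight b i w * (expR (lam * M (L i w)) / lam)).
  by apply: intg_weightM; case: (expM i).
have i2 i : intg (fun w => far delta i w * `|Y i w|).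
  exact/intg_farM/summable_rv_norm/intg_increment.
have iF i : intg (f i) by exact: summable_rvD.
have iS : intg (stopped b n).
  apply: (@summable_rv_sum _ _ _ _ n (fun i w => run b i w * Y i w)) => i _.
  exact/intg_runM/intg_increment.
have iSF : intg (fun w => \sum_(i < n) f i w).
  exact: (@summable_rv_sum _ _ _ _ n f).
apply: (@le_trans _ _ (E (fun w => b + \sum_(i < n) f i w))).
  apply: ler_mean => //.
    by apply: summable_rvD => //; exact: summable_rv_cst.
  move=> w; apply: le_trans (stopped_le n w b_gt0) _; rewrite lerD2l.
  apply: ler_sum => i _; rewrite /f /weight.
  have [->|[-> sb]] := running01 b i w.
    by rewrite !mul0r add0r mulr_ge0 ?far_ge0.
  have [[-> Zi]|->] := farP i w.
    rewrite subr0 !mul1r mul0r addr0 walkS (addrAC (S i w)).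
    apply: max0_le_expR => //; apply: le_trans (ler_norm _) _.
    exact: increment_close.
  rewrite subrr mulr0 !mul0r add0r !mul1r ge_max normr_ge0 andbT.
  apply: le_trans (ler_norm _); rewrite walkS lerBlDr addrC lerD2l.
  exact: ltW.
rewrite meanD//; last exact: summable_rv_cst.
rewrite mean_cst lerD2l mean_sum//.
rewrite (eq_bigr (fun i : 'I_n => m * E (weight b i) +
  E (fun w => far delta i w * `|Y i w|))).
  by rewrite big_split/= -mulr_sumr; apply: lerD; [apply: (ler_wpM2l m_ge0); exact: c1E|exact: c2E].
move=> i _; rewrite meanD//; congr (_ + _).
have [ie ee] := expM i.
rewrite (meanM_next indX (@adapted_weight b i) (q := fun y => expR (lam * M (l y)) / lam))//.
  by rewrite ee mulrC.
apply: measurable_funM; last exact: measurable_cst.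
apply: measurableT_comp => //; apply: measurable_funM; first exact: measurable_cst.
exact: measurableT_comp.
Qed.

(** * Wald's identity and the truncated passage time *)

Definition run_mean b n := \sum_(i < n) E (run b i).

Definition run_loss b n := \sum_(i < n) E (fun w => run b i w * K i w).

(** Wald's identity for the passage time truncated at [n], whose mean is [run_mean b n]. Each
    [run b i] is adapted, so [mean_increment] applies term by term. *)
Lemma mean_stopped b n : E (stopped b n) = I0 * run_mean b n - run_loss b n.
Proof.
rewrite /stopped (mean_sum (f := fun i w => run b i w * Y i w)).
  rewrite /run_mean /run_loss mulr_sumr -sumrB; apply: eq_bigr => i _.
  rewrite (mean_increment (@adapted_running b i)).
  - rewrite -meanZ// -meanB; last 2 first.
    + exact: summable_rvZ.
    + exact/intg_runM/intg_drift_loss.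
    by apply: eq_mean => w; ring.
  - exact: running_ge0.
  - exact: running_le1.
by move=> i _; exact/intg_runM/intg_increment.
Qed.

(** A close step loses at most [I0 / 4], so three quarters of the drift survive up to a summable far
    part; Wald's identity and the overshoot bound then give linear growth in [b]. *)
Lemma run_mean_le : exists2 c, 0 < c & forall b n, 0 < b -> run_mean b n <= c * (b + 1).
Proof.
have [c1 c1E] := overshoot; have [c2 c2E] := far_drift_loss delta_gt0.
exists ((1 + `|c1| + `|c2|) * (4 / (3 * I0))).
  by rewrite mulr_gt0 ?divr_gt0 ?mulr_gt0// -addrA ltr_pwDl// addr_ge0.
move=> b n b_gt0.
have kle : run_loss b n <= I0 / 4 * run_mean b n + c2.
  apply: le_trans (_ : _ <= \sum_(i < n) (I0 / 4 * E (run b i) +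
      E (fun w => far delta i w * K i w))) _; last first.
    by rewrite big_split/= -mulr_sumr lerD2l; exact: c2E.
  apply: ler_sum => i _; rewrite -meanZ// -meanD; last 2 first.
  - exact: summable_rvZ.
  - exact/intg_farM/intg_drift_loss.
  apply: ler_mean.
  - exact/intg_runM/intg_drift_loss.
  - apply: summable_rvD; first exact: summable_rvZ.
    exact/intg_farM/intg_drift_loss.
  - move=> w; have [[-> Zi]|->] := farP i w.
      rewrite mul0r addr0 mulrC ler_wpM2r ?running_ge0//.
      by have [] := close Zi.
    rewrite mul1r -[leLHS]add0r; apply: lerD; last by rewrite ler_piMl ?running_le1.
    by apply: mulr_ge0; [apply: divr_ge0 => //; exact: ltW|exact: running_ge0].
have := c1E b n b_gt0; rewrite mean_stopped => h.
have h2 : I0 * run_mean b n * (3 / 4) <= b + c1 + c2 by move: h kle; lra.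
have h3 : b + c1 + c2 <= (1 + `|c1| + `|c2|) * (b + 1).
  have := ler_norm c1; have := ler_norm c2; have := normr_ge0 c1; have := normr_ge0 c2.
  move: b_gt0; nra.
have -> : (1 + `|c1| + `|c2|) * (4 / (3 * I0)) * (b + 1) =
    (1 + `|c1| + `|c2|) * (b + 1) * 4 / (3 * I0) by field; rewrite gt_eqF.
rewrite ler_pdivlMr; first by move: h2 h3; lra.
exact: mulr_gt0.
Qed.

Lemma run_mean_cvg b : 0 < b -> cvgn (run_mean b) /\
  (\int[P]_w (\sum_(0 <= i <oo) (run b i w)%:E) = (limn (run_mean b))%:E)%E.
Proof.
move=> b_gt0; have [c _ cE] := run_mean_le.
apply: (@integral_series _ _ _ P (run b) (c * (b + 1))).
- exact: running_ge0.
- exact: intg_run.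
- by move=> n; exact: cE.
Qed.

(** The sum of these costs dominates the stopped walk and is integrable by the linear bound on the
    running time. Each running step costs at least [b], so a finite sum forces passage. *)
Let cost b i w := run b i w * (b + `|Y i w|).

Let cost_ge0 b i w : 0 < b -> 0 <= cost b i w.
Proof. by move=> b0; rewrite mulr_ge0 ?running_ge0// addr_ge0// ltW. Qed.

Let intg_cost b i : intg (cost b i).
Proof.
apply: intg_runM; apply: summable_rvD; first exact: summable_rv_cst.
exact/summable_rv_norm/intg_increment.
Qed.

Let cost_bounded b : 0 < b -> exists c, forall n, \sum_(i < n) E (cost b i) <= c.
Proof.
move=> b_gt0; have [c1 c1_gt0 c1E] := run_mean_le; have [c2 c2E] := far_increment.
pose m := E (fun w => M (L 0 w)).
have m_ge0 : 0 <= m by exact: mean_ge0.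
exists ((b + m) * (c1 * (b + 1)) + c2) => n.
apply: (@le_trans _ _ (\sum_(i < n) ((b + m) * E (run b i) +
    E (fun w => far delta i w * `|Y i w|)))); last first.
  rewrite big_split/= -mulr_sumr; apply: lerD; last exact: c2E.
  by rewrite ler_wpM2l ?addr_ge0 ?(ltW b_gt0)//; exact: c1E.
apply: ler_sum => i _; have [iM eM] := absM i.
have i1 : intg (fun w => run b i w * M (L i w)) by exact: intg_runM.
have i2 : intg (fun w => far delta i w * `|Y i w|).
  exact/intg_farM/summable_rv_norm/intg_increment.
have i3 : intg (fun w => b * run b i w + run b i w * M (L i w)).
  by apply: summable_rvD => //; exact: summable_rvZ.
apply: (@le_trans _ _ (E (fun w => b * run b i w + run b i w * M (L i w) +
    far delta i w * `|Y i w|))).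
  apply: ler_mean => //; first exact: summable_rvD.
  move=> w; rewrite /cost mulrDr (mulrC _ b) -addrA lerD2l.
  have [[f0 Zi]|->] := farP i w.
    rewrite f0 mul0r addr0 ler_wpM2l ?running_ge0//; exact: increment_close.
  rewrite mul1r -[leLHS]add0r; apply: lerD.
    by rewrite mulr_ge0 ?running_ge0.
  by rewrite ler_piMl ?running_le1.
rewrite meanD// meanD//; last exact: summable_rvZ.
rewrite meanZ// (meanM_next indX (@adapted_running b i) (q := fun y => M (l y)))//.
  by rewrite eM -/m mulrDl (mulrC m).
exact: measurableT_comp.
Qed.

(** After passage [stopped] is at least [b]. The deficit can only come from the event of no passage
    by time [n]; its contribution [f n] tends to zero by dominated convergence. *)
Lemma mean_stopped_ge b eta : 0 < b -> 0 < eta ->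
  exists N, forall n, (N <= n)%N -> b - eta <= E (stopped b n).
Proof.
move=> b_gt0 eta_gt0; have [c cE] := cost_bounded b_gt0.
have [_ GE] := integral_series (fun i w => cost_ge0 i w b_gt0) (intg_cost b) cE.
pose G w := (\sum_(0 <= i <oo) (cost b i w)%:E)%E.
have G_ge0 w : (0 <= G w)%E.
  by apply: nneseries_ge0 => i _ _; rewrite lee_fin cost_ge0.
have mG : measurable_fun [set: T] G.
  apply: ge0_emeasurable_sum => [i w _ _|i _].
    by rewrite lee_fin cost_ge0.
  by apply/measurable_EFinP; exact: summable_rv_measurable (intg_cost b i).
have iG : P.-integrable [set: T] G.
  apply/integrableP; split => //.
  under eq_integral do rewrite gee0_abs//.
  by rewrite GE ltry.
have G_ge n w : ((\sum_(i < n) cost b i w)%:E <= G w)%E.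
  rewrite -sumEFin -(big_mkord xpredT (fun i => (cost b i w)%:E)).
  by apply: nneseries_lim_ge => i _ _; rewrite lee_fin cost_ge0.
pose f n w := run b n w * (stopped b n w - b).
have iS n : intg (stopped b n).
  apply: (@summable_rv_sum _ _ _ _ n (fun i w => run b i w * Y i w)) => i _.
  exact/intg_runM/intg_increment.
have iSb n : intg (fun w => stopped b n w - b).
  by apply: summable_rvB => //; exact: summable_rv_cst.
have i_f n : intg (f n) by exact: intg_runM.
have f_dom n w : (`|(f n w)%:E| <= G w)%E.
  apply: le_trans (G_ge n.+1 w); rewrite lee_fin /f normrM ger0_norm ?running_ge0//.
  have h1 : `|stopped b n w - b| <= \sum_(i < n) run b i w * `|Y i w| + b.
    apply: le_trans (ler_normB _ _) _; rewrite (gtr0_norm b_gt0) lerD2r.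
    exact: norm_stopped_le.
  rewrite big_ord_recr/=.
  have h2 : \sum_(i < n) run b i w * `|Y i w| <= \sum_(i < n) cost b i w.
    apply: ler_sum => i _; rewrite ler_wpM2l ?running_ge0// lerDr; exact: ltW.
  have h3 : run b n w * \sum_(i < n) run b i w * `|Y i w| <=
      \sum_(i < n) run b i w * `|Y i w|.
    rewrite ler_piMl ?running_le1// sumr_ge0// => i _.
    by rewrite mulr_ge0 ?running_ge0.
  apply: le_trans (ler_wpM2l (running_ge0 b n w) h1) _.
  rewrite mulrDr; apply: lerD; first exact: le_trans h2.
  by rewrite ler_wpM2l ?running_ge0// lerDl.
have f_cvg : {ae P, forall w, [set: T] w ->
    (fun n => (f n w)%:E) @ \oo --> (0%:E : \bar R)}.
  apply: filterS (integrable_ae measurableT iG) => w /(_ Logic.I) Gw _.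
  have [N rN] : exists N, run b N w = 0.
    apply: contrapT => /forallNP r1.
    have {}r1 n : run b n w = 1.
      by have [/(r1 n)|[]] := running01 b n w.
    have : forall n : nat, (n%:R * b <= fine (G w)).
      move=> n; rewrite -lee_fin fineK//; apply: le_trans (G_ge n w).
      rewrite lee_fin mulr_natl -[X in _ *+ X](card_ord n) -sumr_const.
      by apply: ler_sum => i _; rewrite /cost r1 mul1r lerDl.
    have G0 : 0 <= fine (G w) / b by rewrite divr_ge0 ?fine_ge0// ltW.
    move=> /(_ (Num.bound (fine (G w) / b))); apply/negP; rewrite -ltNge.
    by rewrite -ltr_pdivrMr// archi_boundP.
  apply: cvg_near_cst; exists N => // n /= Nn.
  have : run b n w <= 0 by rewrite -rN running_nonincreasing.
  by rewrite /f => r0; rewrite (le_anti (introT andP (conj r0 (running_ge0 b n w)))) mul0r.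
have [_ _ cvgI] := @dominated_convergence _ _ _ P _ measurableT
  (fun n w => (f n w)%:E) (cst 0%:E) G
  (fun n => (measurable_int P (i_f n))) (measurable_cst _) f_cvg iG
  (aeW _ (fun w n _ => f_dom n w)).
have : E (f n) @[n --> \oo] --> 0.
  apply: (fine_cvg (f := fun n => (E (f n))%:E)).
  rewrite (integral0 P setT) in cvgI.
  by under eq_fun do rewrite -meanE//.
move=> /cvgrPdist_lt /(_ _ eta_gt0) [N _ Nh]; exists N => n Nn.
have := Nh n Nn; rewrite /= sub0r normrN => h.
have h1 : E (f n) <= E (stopped b n) - b.
  rewrite -[X in _ - X](mean_cst P) -meanB//; last exact: summable_rv_cst.
  apply: ler_mean => // w; rewrite /f.
  have [r0|[r1 _]] := running01 b n w; last by rewrite r1 mul1r.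
  by rewrite r0 mul0r subr_ge0; exact: stopped_ge.
have := ler_norm (- E (f n)); rewrite normrN; move: h h1; lra.
Qed.

(** * The expected loss to logarithmic order *)

Variables (J rho c4 : R).
Hypotheses (J_ge0 : 0 <= J) (rho_gt0 : 0 < rho) (c4_ge0 : 0 <= c4).
Hypothesis quadratic_loss : forall e : R, 0 < e -> exists2 s : R, 0 < s &
  forall i w, `|Z i w| <= s -> `|K i w - J * Z i w ^+ 2| <= e * Z i w ^+ 2.
Hypothesis iZ2 : forall i, intg (fun w => Z i w ^+ 2).
Hypothesis iZ4 : forall i, intg (fun w => Z i w ^+ 4).
Hypothesis Z4_le : forall i, E (fun w => Z i w ^+ 4) <= c4 / i.+1%:R ^+ 2.
Hypothesis Z2_lim : forall e : R, 0 < e -> exists N, forall i, (N <= i)%N ->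
  `|J * E (fun w => Z i w ^+ 2) - rho / i.+1%:R| <= e / i.+1%:R.

(** [ler_sqr_split] with [k = i.+1] balances both terms at order [1 / i.+1]. *)
Lemma Z2_le i : E (fun w => Z i w ^+ 2) <= (1 + c4) / i.+1%:R.
Proof.
have i0 : 0 < i.+1%:R :> R by [].
apply: (@le_trans _ _ (E (fun w => 1 / i.+1%:R + i.+1%:R * Z i w ^+ 4))).
  apply: ler_mean => //.
    by apply: summable_rvD; [exact: summable_rv_cst|exact: summable_rvZ].
  by move=> w; rewrite -[leLHS]mul1r; apply: ler_sqr_split => //; rewrite ler01 lexx.
rewrite meanD ?mean_cst ?meanZ//; [|exact: summable_rv_cst|exact: summable_rvZ].
rewrite mulrDl lerD2l; apply: le_trans (ler_wpM2l (ltW i0) (Z4_le i)) _.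
move: (i.+1%:R : R) i0 => y y0; have -> // : y * (c4 / y ^+ 2) = c4 / y.
by field; rewrite gt_eqF.
Qed.

Lemma Z4_sum n : \sum_(i < n) E (fun w => Z i w ^+ 4) <= c4 * 2.
Proof.
apply: (@le_trans _ _ (c4 * \sum_(i < n) (i.+1%:R ^+ 2)^-1)).
  by rewrite mulr_sumr; apply: ler_sum => i _; exact: Z4_le.
by rewrite ler_wpM2l// sum_invr_sqr_le.
Qed.

(** Within radius [s] the quadratic expansion applies. Outside it [K i w] is kept whole, and
    [J * Z i w ^+ 2] becomes a fourth power because [s ^+ 2 <= Z i w ^+ 2]. *)
Lemma drift_loss_near e : 0 < e -> exists2 s, 0 < s & forall i w,
  `|K i w - J * Z i w ^+ 2| <=
    e * Z i w ^+ 2 + far s i w * K i w + J / s ^+ 2 * Z i w ^+ 4.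
Proof.
move=> e0; have [s s0 sE] := quadratic_loss e0; exists s => // i w.
have Z4 : 0 <= Z i w ^+ 4 by rewrite -[4%N]/(2 * 2)%N exprM sqr_ge0.
have Z2 : 0 <= Z i w ^+ 2 by exact: sqr_ge0.
have [Zs|Zs] := leP `|Z i w| s.
  rewrite /far ltNge Zs/= mul0r addr0; apply: le_trans (sE i w Zs) _.
  by rewrite lerDl mulr_ge0 ?divr_ge0 ?sqr_ge0.
rewrite /far Zs mul1r.
have h : J * Z i w ^+ 2 <= J / s ^+ 2 * Z i w ^+ 4.
  rewrite -mulrA ler_wpM2l// mulrC ler_pdivlMr ?exprn_gt0//.
  rewrite -[4%N]/(2 + 2)%N exprD ler_wpM2l//.
  by rewrite -[leRHS]real_normK ?num_real// lerXn2r ?nnegrE// ltW.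
have := K_ge0 i w; have := mulr_ge0 (ltW e0) Z2; have := mulr_ge0 J_ge0 Z2.
by rewrite ler_norml; move: h; move: (J / s ^+ 2 * Z i w ^+ 4) => u; lra.
Qed.

Lemma drift_loss_sum e : 0 < e -> exists c, forall n,
  `|\sum_(i < n) E (K i) - rho * harmonic_sum n| <= e * harmonic_sum n + c.
Proof.
(* By [Z2_le] this scaling makes the quadratic error at most [e / 2 / i.+1]; the other half of [e]
   is spent on [Z2_lim]. *)
move=> e0; pose e1 := e / (2 * (1 + c4)).
have c41 : 0 < 1 + c4 by rewrite ltr_pwDl.
have e10 : 0 < e1 by rewrite divr_gt0// mulr_gt0.
have [s s0 sE] := drift_loss_near e10.
have [N NE] := Z2_lim (divr_gt0 e0 (ltr0Sn R 1)).
have [c cE] := far_drift_loss s0.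
pose u i := `|J * E (fun w => Z i w ^+ 2) - rho / i.+1%:R|.
pose c' := \sum_(i < N) `|u i|.
exists (c + J / s ^+ 2 * (c4 * 2) + c') => n.
have termwise i : `|E (K i) - rho / i.+1%:R| <=
    e / 2 / i.+1%:R + E (fun w => far s i w * K i w) +
    J / s ^+ 2 * E (fun w => Z i w ^+ 4) + u i.
  have iJ : intg (fun w => J * Z i w ^+ 2) by exact: summable_rvZ.
  have iKJ : intg (fun w => K i w - J * Z i w ^+ 2).
    by apply: summable_rvB => //; exact: intg_drift_loss.
  have ifK : intg (fun w => far s i w * K i w).
    apply: (summable_rvM_bounded (@adapted_far s i) (far_ge0 s i) (far_le1 s i)).
    exact: intg_drift_loss.
  have h : `|E (K i) - J * E (fun w => Z i w ^+ 2)| <=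
      e1 * E (fun w => Z i w ^+ 2) + E (fun w => far s i w * K i w) +
      J / s ^+ 2 * E (fun w => Z i w ^+ 4).
    rewrite -!meanZ// -meanB//; last exact: intg_drift_loss.
    have i1 : intg (fun w => e1 * Z i w ^+ 2 + far s i w * K i w).
      by apply: summable_rvD => //; exact: summable_rvZ.
    have i2 : intg (fun w => J / s ^+ 2 * Z i w ^+ 4) by exact: summable_rvZ.
    rewrite -meanD//; last exact: summable_rvZ.
    rewrite -meanD//; apply: le_trans (ler_norm_mean iKJ) _.
    apply: ler_mean => //; first exact: summable_rv_norm.
    exact: summable_rvD.
  have h2 : e1 * E (fun w => Z i w ^+ 2) <= e / 2 / i.+1%:R.
    apply: le_trans (ler_wpM2l (ltW e10) (Z2_le i)) _.
    rewrite mulrA ler_pM2r ?invr_gt0// /e1 invfM mulrA divfK// gt_eqF//.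
  have -> : E (K i) - rho / i.+1%:R = (E (K i) - J * E (fun w => Z i w ^+ 2)) +
    (J * E (fun w => Z i w ^+ 2) - rho / i.+1%:R) by rewrite addrA subrK.
  apply: le_trans (ler_normD _ _) _; rewrite lerD2r.
  apply: le_trans h _; by rewrite -!addrA lerD2r.
have -> : \sum_(i < n) E (K i) - rho * harmonic_sum n =
    \sum_(i < n) (E (K i) - rho / i.+1%:R).
  by rewrite sumrB mulr_sumr.
apply: le_trans (ler_norm_sum _ _ _) _.
apply: (@le_trans _ _ (\sum_(i < n) (e / 2 / i.+1%:R +
    E (fun w => far s i w * K i w) + J / s ^+ 2 * E (fun w => Z i w ^+ 4) + u i))).
  exact: ler_sum.
rewrite !big_split/= -!mulr_sumr -/(harmonic_sum n).
have uE : \sum_(i < n) u i <= e / 2 * harmonic_sum n + c'.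
  rewrite mulr_sumr; apply: (@ler_sum_eventually _ u (fun i => e / 2 / i.+1%:R)).
    by move=> i; rewrite !divr_ge0// ltW.
  by move=> i Ni; exact: NE.
have hc := cE n.
have h4 : J / s ^+ 2 * \sum_(i < n) E (fun w => Z i w ^+ 4) <= J / s ^+ 2 * (c4 * 2).
  by rewrite ler_wpM2l ?divr_ge0 ?sqr_ge0// Z4_sum.
apply: le_trans (lerD (lerD (lerD (lexx _) hc) h4) uE) _.
move: (J / s ^+ 2 * (c4 * 2)) (harmonic_sum n) => q h.
by rewrite le_eqVlt; apply/orP; left; apply/eqP; field.
Qed.

Lemma run_loss_nondecreasing b m n : (m <= n)%N -> run_loss b m <= run_loss b n.
Proof.
move=> /subnK <-; elim: (n - m)%N => // k IH; apply: le_trans IH _.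
rewrite /run_loss addSn big_ord_recr/= lerDl mean_ge0// => w.
by rewrite mulr_ge0 ?running_ge0.
Qed.

(** A fixed radius, from the expansion with error [1]. The exact constant matters only for unstopped
    sums; this crude bound serves for the steps that stopping adds or removes. *)
Lemma drift_loss_far : exists s c, [/\ 0 < s, 0 <= c & forall i w,
  K i w <= c * Z i w ^+ 2 + far s i w * K i w].
Proof.
have [s s0 sE] := quadratic_loss ltr01; exists s, (J + 1); split => //.
  by rewrite addr_ge0.
move=> i w; rewrite /far; case: ltP => Zs; rewrite ?mul1r ?mul0r ?addr0.
  by rewrite lerDr mulr_ge0 ?addr_ge0 ?sqr_ge0.
by have := sE i w Zs; rewrite mul1r => /(le_trans (ler_norm _)); rewrite mulrDl mul1r; lra.
Qed.

(* Weighting by [b] the fourth moments beyond time [b] and by [1/b] the running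
   time makes both of the resulting sums bounded. *)
Lemma run_loss_le e : 0 < e -> exists c, forall b n, 1 <= b ->
  run_loss b n <= (rho + e) * ln b + c.
Proof.
move=> e0; have [c1 c1E] := drift_loss_sum e0.
have [s [cK [s0 cK0 KE]]] := drift_loss_far.
have [c2 c2E] := far_drift_loss s0; have [c3 c3_gt0 c3E] := run_mean_le.
exists ((rho + e) * (1 + ln 2) + c1 + (cK * (c3 * 2 + c4) + c2)) => b n b1.
have b0 : 0 < b by exact: lt_le_trans b1.
have lnb : 0 <= ln b by exact: ln_ge0.
(* Above [b], so that [b] times the tail of the inverse squares from [m] on is at most [1]; below
   [2 * b], so that [harmonic_sum m] is at most [ln b] plus a constant. *)
have [m [m_gt0 bm m2b]] : exists m : nat, [/\ (0 < m)%N, b < m%:R & m%:R <= 2 * b].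
  exists (Num.truncn b).+1; have /andP[pb bp] := truncn_itv (ltW b0); split=> //.
  by rewrite -natr1; move: pb b1; move: (_%:R) => x; lra.
apply: le_trans (run_loss_nondecreasing b (leq_addl m n)) _.
have ifK i : intg (fun w => far s i w * K i w).
  apply: (summable_rvM_bounded (@adapted_far s i) (far_ge0 s i) (far_le1 s i)).
  exact: intg_drift_loss.
rewrite /run_loss big_split_ord/= [leRHS]addrA; apply: lerD.
  apply: (@le_trans _ _ (\sum_(i < m) E (K i))).
    apply: ler_sum => i _; apply: ler_mean.
    - exact/intg_runM/intg_drift_loss.
    - exact: intg_drift_loss.
    - by move=> w; rewrite ler_piMl ?running_le1.
  have h1 : harmonic_sum m <= 1 + ln 2 + ln b.
    rewrite -addrA -lnM ?posrE//; apply: harmonic_sum_le => //.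
    by move: b1; lra.
  have h2 := le_trans (ler_norm _) (c1E m).
  have h3 : (rho + e) * harmonic_sum m <= (rho + e) * (1 + ln 2 + ln b).
    by rewrite ler_wpM2l// addr_ge0// ltW.
  by move: h2 h3; lra.
apply: (@le_trans _ _ (\sum_(j < n) (cK * (b^-1 * E (run b (m + j)) +
    b * (c4 / (m + j).+1%:R ^+ 2)) + E (fun w => far s (m + j) w * K (m + j) w)))).
  apply: ler_sum => j _; move: (m + j)%N => i.
  have i1 : intg (fun w => run b i w / b + b * Z i w ^+ 4).
    apply: summable_rvD; last exact: summable_rvZ.
    by under eq_fun do rewrite mulrC; exact: summable_rvZ.
  apply: (@le_trans _ _ (E (fun w => cK * (run b i w / b + b * Z i w ^+ 4) +
      far s i w * K i w))).
    apply: ler_mean => //.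
    - exact/intg_runM/intg_drift_loss.
    - by apply: summable_rvD => //; exact: summable_rvZ.
    - move=> w; have h := ler_wpM2l (running_ge0 b i w) (KE i w).
      apply: le_trans h _; rewrite mulrDr; apply: lerD; last first.
        by rewrite ler_piMl ?running_le1// mulr_ge0 ?far_ge0.
      rewrite mulrCA ler_wpM2l//; apply: ler_sqr_split => //.
      by rewrite running_ge0 running_le1.
  rewrite meanD//; last exact: summable_rvZ.
  rewrite lerD2r meanZ// ler_wpM2l// meanD; last 2 first.
  - by under eq_fun do rewrite mulrC; exact: summable_rvZ.
  - exact: summable_rvZ.
  rewrite meanZ// (eq_mean P (g := fun w => b^-1 * run b i w)); last first.
    by move=> w; rewrite mulrC.
  by rewrite meanZ// lerD2l ler_wpM2l ?(ltW b0).
rewrite big_split/= -mulr_sumr big_split/= -!mulr_sumr; apply: lerD; last first.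
  have := c2E (m + n)%N; rewrite big_split_ord/=; apply: le_trans.
  rewrite lerDr sumr_ge0// => i _; apply: mean_ge0 => w.
  by rewrite mulr_ge0 ?far_ge0.
rewrite ler_wpM2l//; apply: lerD.
  rewrite mulrC ler_pdivrMr//.
  apply: (@le_trans _ _ (run_mean b (m + n))).
    rewrite /run_mean big_split_ord/= lerDr sumr_ge0// => i _.
    by apply: mean_ge0 => w; exact: running_ge0.
  apply: le_trans (c3E b _ b0) _; rewrite -mulrA ler_pM2l//.
  by move: b1; lra.
apply: (@le_trans _ _ (b * (c4 * m%:R^-1))).
  rewrite ler_pM2l// ler_wpM2l//.
  have := @sum_invr_sqr_tail R m.-1 n; rewrite prednK// => /le_trans; apply.
  by rewrite gerBl invr_ge0.
by rewrite mulrCA -[leRHS]mulr1 ler_wpM2l// ler_pdivrMr ?mul1r ?ltW// (lt_trans b0).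
Qed.

(** Passage by time [n] needs increments adding up to at least [b]: Markov's inequality for the sum
    of their moduli. *)
Lemma stopped_early b n : 0 < b ->
  b * (1 - E (run b n)) <= \sum_(i < n) E (fun w => `|Y i w|).
Proof.
move=> b0; rewrite -[X in X - _](mean_cst P) -meanB//; last exact: summable_rv_cst.
have iY i : intg (fun w => `|Y i w|) by exact/summable_rv_norm/intg_increment.
rewrite -meanZ; last by apply: summable_rvB => //; exact: summable_rv_cst.
rewrite -(mean_sum (f := fun i w => `|Y i w|))//; apply: ler_mean.
- by apply/summable_rvZ/summable_rvB => //; exact: summable_rv_cst.
- exact: (@summable_rv_sum _ _ _ _ n (fun i w => `|Y i w|)).
- move=> w; have [r0|[-> _]] := running01 b n w; last by rewrite subrr mulr0 sumr_ge0.
  rewrite r0 subr0 mulr1; apply: le_trans (stopped_ge b0 r0) _.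
  apply: le_trans (ler_norm _) _; apply: le_trans (norm_stopped_le _ _ _) _.
  by apply: ler_sum => i _; rewrite ler_piMl ?running_le1.
Qed.

Lemma increment_mean_le : exists k c, [/\ 0 <= k, 0 <= c & forall n,
  \sum_(i < n) E (fun w => `|Y i w|) <= k * n%:R + c].
Proof.
have [c cE] := far_increment.
pose k := E (fun w => M (L 0 w)).
exists k, `|c|; split => //; first exact: mean_ge0.
move=> n; apply: (@le_trans _ _ (\sum_(i < n) (k + E (fun w => far delta i w * `|Y i w|)))).
  apply: ler_sum => i _; have [iM eM] := absM i.
  have i2 : intg (fun w => far delta i w * `|Y i w|).
    exact/intg_farM/summable_rv_norm/intg_increment.
  rewrite /k -eM -meanD//; apply: ler_mean.
  - exact/summable_rv_norm/intg_increment.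
  - exact: summable_rvD.
  - move=> w; have [[-> Zi]|->] := farP i w; last by rewrite mul1r lerDr.
    by rewrite mul0r addr0 increment_close.
rewrite big_split/= sumr_const card_ord mulr_natr lerD2l.
exact: le_trans (cE n) (ler_norm _).
Qed.

(** Only times up to [N], about [h ^+ 2 * b], are kept. The loss missed there through early passage
    is split by [ler_sqr_split] with [k = h * i.+1]: as early passage has probability of order
    [h ^+ 2], both halves are of order [h] times the harmonic sum. The lower limit [h ^+ 2] costs
    only a constant in the logarithm. *)
Lemma run_loss_ge e : 0 < e -> exists c, forall b, 1 <= b ->
  exists N, forall n, (N <= n)%N -> (rho - e) * ln b - c <= run_loss b n.
Proof.
move=> e0; have [c1 c1E] := drift_loss_sum (divr_gt0 e0 (ltr0Sn R 1)).
have [s [cK [s0 cK0 KE]]] := drift_loss_far.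
have [c2 c2E] := far_drift_loss s0.
have [k [c3 [k0 c30 YE]]] := increment_mean_le.
(* Dividing [e] by [g] makes the total error coefficient [cK * (k + c4) * h] at most [e / 2]. *)
pose g := 2 * (cK * (k + c4) + 1).
have g0 : 0 < g by rewrite mulr_gt0// ltr_wpDl// mulr_ge0// addr_ge0.
pose h := Num.min 1 (e / g).
have h0 : 0 < h by rewrite lt_min ltr01 divr_gt0.
have h1 : h <= 1 by rewrite ge_min lexx.
have he : cK * (k + c4) * h <= e / 2.
  have : g * h <= e by rewrite mulrC -ler_pdivlMr// ge_min lexx orbT.
  by move: h0; rewrite /g; lra.
have hh0 : 0 < h ^+ 2 by rewrite exprn_gt0.
have hh1 : h ^+ 2 <= 1 by rewrite exprn_ile1// ltW.
exists (rho * `|ln (h ^+ 2)| + e + c1 + c2 + 2 * (cK * c3 / h)) => b b1.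
have b0 : 0 < b by exact: lt_le_trans b1.
have lnb : 0 <= ln b by exact: ln_ge0.
pose N := Num.truncn (h ^+ 2 * b).
have [Nb bN] : N%:R <= h ^+ 2 * b /\ h ^+ 2 * b < N.+1%:R.
  by have /andP[] := truncn_itv (ltW (mulr_gt0 hh0 b0)).
have Nb1 : N%:R <= b by apply: le_trans Nb _; rewrite ler_piMl// ltW.
exists N => n Nn; apply: le_trans (run_loss_nondecreasing b Nn).
(* The probability of passage by time [N], which bounds that of passage by any earlier time. *)
pose q := 1 - E (run b N).
have q0 : 0 <= q.
  rewrite subr_ge0 -[leRHS](mean_cst P); apply: ler_mean => //.
    exact: summable_rv_cst.
  exact: running_le1.
have qle : q <= k * h ^+ 2 + c3 / b.
  have := le_trans (stopped_early N b0) (YE N); rewrite -/q => hq.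
  have -> : k * h ^+ 2 + c3 / b = (k * (h ^+ 2 * b) + c3) / b.
    by field; rewrite gt_eqF.
  rewrite ler_pdivlMr// mulrC; apply: le_trans hq _.
  by rewrite lerD2r ler_wpM2l.
have H0 := @harmonic_sum_ge0 R N.
have Hle : harmonic_sum N <= 1 + ln b by exact: harmonic_sum_le.
have Hge : ln b + ln (h ^+ 2) <= harmonic_sum N.
  apply: le_trans (@ln_harmonic_sum R N).
  by rewrite addrC -lnM ?posrE// ler_ln ?posrE ?mulr_gt0// ltW.
have ifK i : intg (fun w => far s i w * K i w).
  apply: (summable_rvM_bounded (@adapted_far s i) (far_ge0 s i) (far_le1 s i)).
  exact: intg_drift_loss.
have lost : \sum_(i < N) E (K i) <= run_loss b N +
    (cK * (q / h + h * c4) * harmonic_sum N + c2).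
  apply: (@le_trans _ _ (run_loss b N + (\sum_(i < N)
      (cK * (q / (h * i.+1%:R) + h * i.+1%:R * (c4 / i.+1%:R ^+ 2)) +
       E (fun w => far s i w * K i w))))).
    rewrite /run_loss -big_split/=; apply: ler_sum => i _.
    set y : R := h * i.+1%:R.
    have y0 : 0 < y by rewrite mulr_gt0.
    have i1 : intg (fun w => y^-1 * (1 - run b i w) + y * Z i w ^+ 4).
      apply: summable_rvD; apply: summable_rvZ => //.
      by apply: summable_rvB => //; exact: summable_rv_cst.
    have i2 : intg (fun w => cK * (y^-1 * (1 - run b i w) + y * Z i w ^+ 4) +
        far s i w * K i w).
      by apply: summable_rvD => //; exact: summable_rvZ.
    have irK : intg (fun w => run b i w * K i w) by exact/intg_runM/intg_drift_loss.
    apply: (@le_trans _ _ (E (fun w => run b i w * K i w +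
        (cK * (y^-1 * (1 - run b i w) + y * Z i w ^+ 4) + far s i w * K i w)))).
      apply: ler_mean; [exact: intg_drift_loss|exact: summable_rvD|].
      move=> w; rewrite -lerBlDl -[X in X - _]mul1r -mulrBl.
      have r0 : 0 <= 1 - run b i w by rewrite subr_ge0 running_le1.
      have r1 : 1 - run b i w <= 1 by rewrite gerBl running_ge0.
      apply: le_trans (ler_wpM2l r0 (KE i w)) _; rewrite mulrDr; apply: lerD.
        rewrite mulrCA ler_wpM2l// (mulrC y^-1); apply: ler_sqr_split => //.
        by rewrite r0 r1.
      by rewrite ler_piMl// mulr_ge0 ?far_ge0.
    have i3 : intg (fun w => 1 - run b i w).
      by apply: summable_rvB => //; exact: summable_rv_cst.
    rewrite meanD// lerD2l meanD//; last exact: summable_rvZ.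
    rewrite lerD2r meanZ// ler_wpM2l// meanD; [|exact: summable_rvZ..].
    rewrite meanZ// meanZ//; apply: lerD; last by rewrite ler_wpM2l ?(ltW y0).
    rewrite mulrC ler_wpM2r ?invr_ge0 ?(ltW y0)// meanB//; last exact: summable_rv_cst.
    rewrite mean_cst lerB//; apply: ler_mean => // w.
    by apply: running_nonincreasing; exact: ltnW.
  rewrite lerD2l big_split/=; apply: lerD; last exact: c2E.
  rewrite /harmonic_sum mulr_sumr le_eqVlt; apply/orP; left; apply/eqP.
  apply: eq_bigr => i _; have : 0 < i.+1%:R :> R by [].
  by move: (i.+1%:R : R) => y y0; field; rewrite !gt_eqF.
have total := c1E N; rewrite ler_norml in total; have /andP[total1 _] := total.
have lossE : cK * (q / h + h * c4) * harmonic_sum N <=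
    e / 2 * harmonic_sum N + 2 * (cK * c3 / h).
  apply: (@le_trans _ _ (cK * ((k * h ^+ 2 + c3 / b) / h + h * c4) * harmonic_sum N)).
    by rewrite ler_wpM2r// ler_wpM2l// lerD2r ler_wpM2r// invr_ge0 ltW.
  have -> : cK * ((k * h ^+ 2 + c3 / b) / h + h * c4) * harmonic_sum N =
      cK * (k + c4) * h * harmonic_sum N + cK * c3 / h * (harmonic_sum N / b).
    by field; rewrite !gt_eqF.
  apply: lerD; first by rewrite ler_wpM2r.
  rewrite mulrC ler_wpM2r ?divr_ge0 ?mulr_ge0 ?(ltW h0)// ler_pdivrMr//.
  apply: le_trans Hle _; have := ln_sublinear b0; move: b1; lra.
have eH : e * harmonic_sum N <= e * (1 + ln b) by rewrite ler_pM2l.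
have rH : rho * (ln b + ln (h ^+ 2)) <= rho * harmonic_sum N by rewrite ler_pM2l.
have rl : - (rho * `|ln (h ^+ 2)|) <= rho * ln (h ^+ 2).
  by rewrite -mulrN ler_pM2l// lerNl -normrN ler_norm.
move: lost total1 lossE eH rH rl; rewrite !mulrDr; lra.
Qed.

(* [I0 * E tau_b = E S_(tau_b) + E (total drift loss up to tau_b)] *)
Theorem mean_running_time e : 0 < e -> exists c, forall b, 1 <= b ->
  `|I0 * limn (run_mean b) - b - rho * ln b| <= e * ln b + c.
Proof.
move=> e0; have [c1 c1E] := overshoot; have [c2 c2E] := run_loss_le e0.
have [c3 c3E] := run_loss_ge e0.
exists (`|c1| + `|c2| + `|c3| + 1) => b b1.
have b0 : 0 < b by exact: lt_le_trans b1.
have [cvg_t _] := run_mean_cvg b0.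
have upper : I0 * limn (run_mean b) <= b + c1 + ((rho + e) * ln b + c2).
  rewrite mulrC -ler_pdivlMr//; apply: limr_le => //; apply: nearW => n.
  rewrite ler_pdivlMr// mulrC -lerBlDr.
  apply: le_trans (c1E b n b0); rewrite mean_stopped lerB//.
  exact: c2E.
(* One large [n] suffices for the lower bound because [run_mean b] is nondecreasing; the deficit of
   the stopped mean is fixed at [1]. *)
have [N1 N1E] := mean_stopped_ge b0 (@ltr01 R); have [N2 N2E] := c3E b b1.
have lower : b - 1 + ((rho - e) * ln b - c3) <= I0 * limn (run_mean b).
  set n := maxn N1 N2.
  apply: (@le_trans _ _ (I0 * run_mean b n)).
    have := N1E n (leq_maxl _ _); rewrite mean_stopped => h1.
    have := N2E n (leq_maxr _ _); move: h1; lra.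
  rewrite ler_pM2l//; apply: nondecreasing_cvgn_le => //.
  move=> i j ij; rewrite /run_mean -!(big_mkord xpredT (fun i => E (run b i))).
  rewrite [leRHS](big_cat_nat (n := i))//= lerDl sumr_ge0// => l' _.
  by apply: mean_ge0 => w; exact: running_ge0.
have := ler_norm c1; have := ler_norm c2; have := ler_norm c3.
have := normr_ge0 c1; have := normr_ge0 c2; have := normr_ge0 c3.
have := ln_ge0 b1; rewrite ler_norml; move: upper lower.
rewrite !mulrDl mulNr => u1 l1 *; apply/andP; split; lra.
Qed.
End stopped_sums.

(** * The Gamma law and its information numbers *)

Section density.
Local Open Scope ereal_scope.
Context {d : measure_display} {T : measurableType d} {R : realType}.
Variables (nu mu : {measure set T -> \bar R}) (f : T -> R).
Hypotheses (mf : measurable_fun [set: T] f) (f_ge0 : forall x, (0 <= f x)%R).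
Hypothesis nuE : forall B, measurable B -> nu B = \int[mu]_(x in B) (f x)%:E.

Import HBNNSimple.

Let mfE : measurable_fun [set: T] (EFin \o f).
Proof. exact/measurable_EFinP. Qed.

Let nnsfun_density (h : {nnsfun T >-> R}) :
  \int[nu]_x (h x)%:E = \int[mu]_x ((h x)%:E * (f x)%:E).
Proof.
have hE x : (h x)%:E = \sum_(y \in range h) (y * \1_(h @^-1` [set y]) x)%:E.
  by rewrite {1}fimfunE -fsumEFin.
have hfE x : (h x)%:E * (f x)%:E =
    \sum_(y \in range h) (y * \1_(h @^-1` [set y]) x)%:E * (f x)%:E.
  by rewrite hE ge0_mule_fsuml// => y; exact: nnfun_muleindic_ge0.
have mh y : measurable_fun [set: T] (fun x => (y * \1_(h @^-1` [set y]) x)%:E).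
  by apply/measurable_EFinP/measurable_funM.
under eq_integral do rewrite hE.
rewrite ge0_integral_fsum//; last by move=> y x _; exact: nnfun_muleindic_ge0.
under [RHS]eq_integral do rewrite hfE.
rewrite ge0_integral_fsum//; last 2 first.
- by move=> y; exact: emeasurable_funM.
- by move=> y x _; apply: mule_ge0; [exact: nnfun_muleindic_ge0|rewrite lee_fin].
apply: eq_fsbigr => y; rewrite inE => -[t _ <-].
under [LHS]eq_integral do rewrite EFinM.
rewrite integralZl_indic_nnsfun// integral_indic// setIT nuE//.
under [RHS]eq_integral do rewrite EFinM -muleA.
rewrite ge0_integralZl//.
- congr (_ * _); rewrite integral_mkcond; apply: eq_integral => x _.
  by rewrite patchE indicE; case: ifP => _; rewrite ?mul1e ?mul0e.
- by apply: emeasurable_funM => //; exact/measurable_EFinP.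
- by move=> x _; rewrite mule_ge0 ?lee_fin.
- by rewrite lee_fin.
Qed.

(** From indicators through simple functions to monotone limits. *)
Lemma ge0_integral_density (q : T -> \bar R) : measurable_fun [set: T] q ->
  (forall x, 0 <= q x) -> \int[nu]_x q x = \int[mu]_x (q x * (f x)%:E).
Proof.
move=> mq q0; pose h := nnsfun_approx measurableT mq.
have qE x : q x = lim ((EFin \o h n) x @[n --> \oo]).
  by apply/esym/cvg_lim => //; exact: cvg_nnsfun_approx.
transitivity (lim (\int[nu]_x (EFin \o h n) x @[n --> \oo])).
  under eq_integral do rewrite qE.
  apply: monotone_convergence => //.
  - by move=> n; exact/measurable_EFinP/measurable_funP.
  - by move=> n x _ /=; rewrite lee_fin.
  - by move=> x _ a b ab; rewrite lee_fin; exact/lefP/nd_nnsfun_approx.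
transitivity (lim (\int[mu]_x ((EFin \o h n) x * (f x)%:E) @[n --> \oo])).
  by apply: congr_lim; apply/funext => n; exact: nnsfun_density.
apply/esym; transitivity (\int[mu]_x lim ((EFin \o h n) x * (f x)%:E @[n --> \oo])).
  apply: eq_integral => x _; apply/esym/cvg_lim => //; apply: cvgeZr => //.
  exact: cvg_nnsfun_approx.
apply: monotone_convergence => //.
- by move=> n; apply: emeasurable_funM => //; exact/measurable_EFinP/measurable_funP.
- by move=> n x _ /=; rewrite mule_ge0 ?lee_fin.
- move=> x _ a b ab; apply: lee_wpmul2r; first by rewrite lee_fin.
  by rewrite lee_fin; exact/lefP/nd_nnsfun_approx.
Qed.

End density.

(** * Differentiating exponential moments *)

Section exponential_moments.
Context {d : measure_display} {T : measurableType d} {R : realType}.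
Variables (P : probability T R) (u : T -> R) (lo hi : R).
Hypothesis mu : measurable_fun [set: T] u.
Hypothesis iexp : forall t, lo < t < hi -> summable_rv P (fun w => expR (t * u w)).

Definition exp_moment k (t : R) := mean P (fun w => u w ^+ k * expR (t * u w)).

Lemma expR_normM_le (r x : R) : expR (r * `|x|) <= expR (r * x) + expR (- r * x).
Proof.
have [x0|x0] := leP 0 x; first by rewrite ger0_norm// lerDl expR_ge0.
by rewrite ltr0_norm// mulrN mulNr lerDr expR_ge0.
Qed.

(** The power is absorbed by [expR] of [r] times the modulus of [x], and so is the change from [t0]
    to [t]. The bound no longer depends on [t], as a dominating function must not. *)
Lemma powM_expR_le k (r t0 t x : R) : 0 < r -> `|t - t0| <= r ->
  `|x ^+ k * expR (t * x)| <=
  k`!%:R / r ^+ k * (expR ((t0 + 2 * r) * x) + expR ((t0 - 2 * r) * x)).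
Proof.
move=> r0 tr; rewrite normrM normrX (ger0_norm (expR_ge0 _)).
have pow_le : `|x| ^+ k <= k`!%:R / r ^+ k * expR (r * `|x|).
  rewrite mulrAC ler_pdivlMr ?exprn_gt0// -exprMn (mulrC _%:R) (mulrC `|x| r).
  case: k => [|k].
    by rewrite expr0 fact0 mulr1 -expR0 ler_expR mulr_ge0// ltW.
  rewrite -ler_pdivrMr ?ltr0n ?fact_gt0//.
  apply: le_trans (expR_ge1Dxn k _); last by rewrite mulr_ge0// ltW.
  by rewrite lerDr.
have exp_le : expR (t * x) <= expR (t0 * x) * expR (r * `|x|).
  rewrite -expRD ler_expR -lerBlDl -mulrBl.
  apply: le_trans (ler_norm _) _; rewrite normrM.
  by rewrite ler_wpM2r.
apply: le_trans (ler_pM _ _ pow_le exp_le) _; rewrite ?exprn_ge0 ?expR_ge0//.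
rewrite -[leLHS]mulrA; apply: ler_wpM2l; first by rewrite divr_ge0// exprn_ge0// ltW.
rewrite mulrCA -expRD -mulrDl (_ : r + r = 2 * r); last by rewrite mulr_natl.
apply: le_trans (ler_wpM2l (expR_ge0 _) (expR_normM_le _ _)) _.
by rewrite (mulrDl t0 (2 * r)) (mulrDl t0 (- (2 * r))) !expRD -mulrDr.
Qed.

(** The dominating function involves exponents at distance [2 * radius t] from [t]; a quarter of the
    distance to the ends keeps them inside the interval. *)
Let radius (t : R) : R := Num.min (t - lo) (hi - t) / 4.

Let radiusP t : lo < t < hi -> [/\ 0 < radius t,
  lo < t + 2 * radius t < hi & lo < t - 2 * radius t < hi].
Proof.
move=> /andP[lt th]; rewrite /radius.
have : 0 < Num.min (t - lo) (hi - t) by rewrite lt_min !subr_gt0 lt th.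
have : Num.min (t - lo) (hi - t) <= t - lo by rewrite ge_min lexx.
have : Num.min (t - lo) (hi - t) <= hi - t by rewrite ge_min lexx orbT.
by move: (Num.min _ _) => y *; split; [|apply/andP; split..]; lra.
Qed.

Let bound k (t : R) w : R := k`!%:R / radius t ^+ k *
  (expR ((t + 2 * radius t) * u w) + expR ((t - 2 * radius t) * u w)).

Let intg_bound k t : lo < t < hi -> summable_rv P (bound k t).
Proof.
move=> /radiusP[_ h1 h2]; apply: summable_rvZ.
by apply: summable_rvD; exact: iexp.
Qed.

Let measurable_moment k t : measurable_fun [set: T] (fun w => u w ^+ k * expR (t * u w)).
Proof.
apply: measurable_funM; first exact: measurable_funX.
by apply: measurableT_comp => //; apply: measurable_funM.
Qed.

Lemma summable_exp_moment k t : lo < t < hi ->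
  summable_rv P (fun w => u w ^+ k * expR (t * u w)).
Proof.
move=> tI; have [r0 _ _] := radiusP tI.
apply: (summable_rv_le _ (intg_bound k tI)) => // w.
by apply: powM_expR_le => //; rewrite subrr normr0 ltW.
Qed.

Let is_derive_moment k w (t : R) :
  is_derive t 1 (fun t : R => u w ^+ k * expR (t * u w)) (u w ^+ k.+1 * expR (t * u w)).
Proof.
have h : is_derive t 1 (fun t : R => expR (t * u w)) (expR (t * u w) * u w).
  apply: (is_derive1_comp (f := expR) (g := fun t : R => t * u w)).
  by apply: is_derive_eq; rewrite /= scaler0 add0r [_ *: _]mulr1.
by apply: is_derive_eq; rewrite exprSr mulrAC -mulrA.
Qed.

Lemma is_derive_exp_moment k t : lo < t < hi ->
  is_derive t 1 (exp_moment k) (exp_moment k.+1 t).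
Proof.
move=> tI; have [r0 h1 h2] := radiusP tI.
pose f (t : R) w : R := u w ^+ k * expR (t * u w).
have Iu : `]t - radius t, t + radius t[%classic t.
  by rewrite /= in_itv/= ltrBlDr !ltrDl r0.
have If s : `]t - radius t, t + radius t[%classic s ->
    P.-integrable [set: T] (EFin \o f s).
  rewrite /= in_itv/= => /andP[s1 s2]; apply: summable_exp_moment.
  by move: h1 h2 => /andP[a1 a2] /andP[b1 b2]; apply/andP; split; lra.
have df s w : (f ^~ w)^`()%classic s = u w ^+ k.+1 * expR (s * u w).
  by have h := is_derive_moment k w s; rewrite derive1E derive_val.
have dom s w : `]t - radius t, t + radius t[%classic s -> [set: T] w ->
    `|partial1of2 f s w| <= bound k.+1 t w.
  rewrite /= in_itv/= => /andP[s1 s2] _; rewrite /partial1of2 df.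
  by apply: powM_expR_le => //; rewrite ler_norml; apply/andP; split; lra.
have bound0 w : 0 <= bound k.+1 t w.
  by rewrite mulr_ge0 ?addr_ge0 ?expR_ge0// divr_ge0// exprn_ge0// ltW.
have der s w : `]t - radius t, t + radius t[%classic s -> [set: T] w ->
    derivable (f ^~ w) s 1.
  by move=> _ _; have h := is_derive_moment k w s; exact: ex_derive.
apply: DeriveDef.
  exact: (derivable_under_integral measurableT Iu If der bound0
    (intg_bound k.+1 tI) dom).
rewrite -derive1E (differentiation_under_integral measurableT Iu If der bound0
    (intg_bound k.+1 tI) dom).
by apply: eq_Rintegral => w _; rewrite /partial1of2 df.
Qed.

End exponential_moments.

(** * Integrals under the Gamma law *)

Section gamma_law.
Context {d : measure_display} {T : measurableType d} {R : realType}.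
Variables (P : R -> probability T R) (X : nat -> {mfun T >-> R}).
Hypothesis iid_X : forall theta, 0 < theta -> iid_gamma (P theta) X theta.
Local Notation leb := (@lebesgue_measure R).

Lemma Gamma_ge0 (t : R) : 0 <= Gamma t.
Proof.
by apply: Rintegral_ge0 => x _; rewrite mulr_ge0 ?powR_ge0 ?expR_ge0.
Qed.

Lemma gamma_pdf_ge0 (t x : R) : 0 <= gamma_pdf t x.
Proof.
rewrite /gamma_pdf; case: ifP => // _.
by rewrite divr_ge0 ?mulr_ge0 ?powR_ge0 ?expR_ge0 ?Gamma_ge0.
Qed.

Lemma gamma_pdf_le0 (t x : R) : x <= 0 -> gamma_pdf t x = 0.
Proof. by rewrite /gamma_pdf leNgt; case: ltP. Qed.

Lemma gamma_pdf_gt0E (t x : R) : 0 < x ->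
  gamma_pdf t x = expR ((t - 1) * ln x - x) / Gamma t.
Proof. by move=> x0; rewrite /gamma_pdf x0 /powR gt_eqF// -expRD. Qed.

Lemma measurable_gamma_pdf t : measurable_fun [set: R] (gamma_pdf t).
Proof.
apply: measurable_fun_ifT => //.
- exact: measurable_fun_ltr.
- apply: measurable_funM => //; apply: measurable_funM => //.
  by apply: measurableT_comp.
Qed.

Lemma integral_gamma_pdf (t : R) : 0 < t -> (\int[leb]_x (gamma_pdf t x)%:E = 1)%E.
Proof.
move=> t0; have [/(_ 1%N isT) pdf _] := iid_X t0.
by rewrite -(pdf setT measurableT) probability_setT.
Qed.

(** The density has total mass one; if [Gamma t] were [0], division by zero would make it vanish.
    This also excludes the default value [0] of a divergent integral. *)
Lemma Gamma_gt0 (t : R) : 0 < t -> 0 < Gamma t.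
Proof.
move=> t0; rewrite lt_neqAle Gamma_ge0 andbT; apply/negP => /eqP G0.
have := integral_gamma_pdf t0; rewrite (_ : (\int[leb]_x _ = 0)%E).
  by move=> /esym/eqP; rewrite onee_eq0.
by apply: integral0_eq => x _; rewrite /gamma_pdf -G0 invr0 mulr0; case: ifP.
Qed.

(** Exponential tilting by [ln x] moves the shape parameter, so the moment generating function of
    [ln X] is a quotient of Gamma values with no integral to compute. *)
Lemma gamma_pdf_shift (t h x : R) : 0 < t -> 0 < t + h ->
  expR (h * ln x) * gamma_pdf t x = Gamma (t + h) / Gamma t * gamma_pdf (t + h) x.
Proof.
move=> t0 th0; have [x0|x0] := leP x 0; first by rewrite !gamma_pdf_le0// !mulr0.
rewrite (gamma_pdf_gt0E t x0) (gamma_pdf_gt0E (t + h) x0).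
have -> : expR ((t + h - 1) * ln x - x) = expR (h * ln x) * expR ((t - 1) * ln x - x).
  by rewrite -expRD; congr expR; ring.
move: (Gamma_gt0 t0) (Gamma_gt0 th0); move: (Gamma t) (Gamma (t + h)) => u v u0 v0.
by field; rewrite !gt_eqF.
Qed.

Lemma ge0_integral_gamma t n (q : R -> \bar R) : 0 < t -> (0 < n)%N ->
  measurable_fun [set: R] q -> (forall x, 0 <= q x)%E ->
  (\int[P t]_w q (X n w) = \int[leb]_x (q x * (gamma_pdf t x)%:E))%E.
Proof.
move=> t0 n0 mq q0; have [/(_ n n0) pdf _] := iid_X t0.
(* Lebesgue measure lives on [measurableTypeR R], so measurability is restated for that copy of the
   line. *)
have mX : measurable_fun [set: T] (X n : T -> measurableTypeR R).
  by move=> mT B mB; exact: (@measurable_funPT _ _ _ _ (X n) mT B mB).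
have mpdf : measurable_fun [set: measurableTypeR R] (gamma_pdf t).
  by move=> mR B mB; exact: (@measurable_gamma_pdf t mR B mB).
have {}mq : measurable_fun [set: measurableTypeR R] q.
  by move=> mR B mB; exact: (mq mR B mB).
pose Xn : {mfun T >-> measurableTypeR R} :=
  @mfun_Sub _ _ T (measurableTypeR R) (X n) (mem_set mX).
rewrite -[LHS](@ge0_integral_distribution _ _ _ _ _ (P t) Xn q mq q0).
exact: (@ge0_integral_density _ (measurableTypeR R) R (distribution (P t) Xn)
  leb _ mpdf (gamma_pdf_ge0 t) pdf q mq q0).
Qed.

Lemma same_gamma_law t n (q : R -> R) : 0 < t -> (0 < n)%N ->
  measurable_fun [set: R] q -> summable_rv (P t) (fun w => q (X 1%N w)) ->
  summable_rv (P t) (fun w => q (X n w)) /\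
  mean (P t) (fun w => q (X n w)) = mean (P t) (fun w => q (X 1%N w)).
Proof.
move=> t0 n0 mq /integrableP[_ iq].
have e0 (p : R -> \bar R) : measurable_fun [set: R] p -> (forall x, 0 <= p x)%E ->
    (\int[P t]_w p (X n w) = \int[P t]_w p (X 1%N w))%E.
  by move=> mp p0; rewrite !ge0_integral_gamma.
have mqE : measurable_fun [set: R] (EFin \o q) by exact/measurable_EFinP.
split.
  apply/integrableP; split; first by apply: measurableT_comp mqE _.
  rewrite (e0 (fun x => `|(q x)%:E|)%E)//.
  exact: measurableT_comp.
rewrite /mean /Rintegral; congr fine; rewrite [LHS]integralE [RHS]integralE.
congr (_ - _)%E.
- rewrite (funepos_comp (EFin \o q) (X n)) (funepos_comp (EFin \o q) (X 1%N)).
  exact: (e0 _ (measurable_funepos mqE) (funepos_ge0 _)).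
- rewrite (funeneg_comp (EFin \o q) (X n)) (funeneg_comp (EFin \o q) (X 1%N)).
  exact: (e0 _ (measurable_funeneg mqE) (funeneg_ge0 _)).
Qed.

Lemma gamma_meanE t (q : R -> R) : 0 < t -> measurable_fun [set: R] q ->
  gamma_mean t q = mean (P t) (fun w => q (X 1%N w)).
Proof.
move=> t0 mq; rewrite /gamma_mean /mean /Rintegral; congr fine.
have -> : (\int[leb]_(x in `]0%R, +oo[) (q x * gamma_pdf t x)%:E =
    \int[leb]_x (q x * gamma_pdf t x)%:E)%E.
  rewrite [LHS]integral_mkcond; apply: eq_integral => x _.
  rewrite patchE; case: ifPn => //; rewrite notin_setE/= in_itv/= andbT => /negP.
  by rewrite -leNgt => x0; rewrite gamma_pdf_le0// mulr0.
have mqE : measurable_fun [set: R] (EFin \o q) by exact/measurable_EFinP.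
rewrite [LHS]integralE [RHS]integralE; congr (_ - _)%E.
- rewrite (funepos_comp (EFin \o q) (X 1%N)).
  rewrite [RHS](ge0_integral_gamma t0 _ (measurable_funepos mqE) (funepos_ge0 _))//.
  apply: eq_integral => x _; rewrite !funeposE /= -!EFin_max -EFinM; congr (_%:E).
  by rewrite maxr_pMl ?gamma_pdf_ge0// mul0r.
- rewrite (funeneg_comp (EFin \o q) (X 1%N)).
  rewrite [RHS](ge0_integral_gamma t0 _ (measurable_funeneg mqE) (funeneg_ge0 _))//.
  apply: eq_integral => x _; rewrite !funenegE /= -!EFin_max -EFinM; congr (_%:E).
  by rewrite maxr_pMl ?gamma_pdf_ge0// mul0r mulNr.
Qed.

Local Notation L w := (ln (X 1%N w)).

Lemma measurable_L : measurable_fun [set: T] (fun w => L w).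
Proof. by apply: measurableT_comp; [exact: measurable_ln|]. Qed.

Lemma gamma_mgf t h : 0 < t -> 0 < t + h ->
  summable_rv (P t) (fun w => expR (h * L w)) /\
  mean (P t) (fun w => expR (h * L w)) = Gamma (t + h) / Gamma t.
Proof.
move=> t0 th0; apply: summable_rv_fin.
- apply: measurableT_comp => //; apply: measurable_funM => //.
  exact: measurable_L.
- by move=> w; exact: expR_ge0.
have mq : measurable_fun [set: R] (fun x => (expR (h * ln x))%:E).
  apply/measurable_EFinP; apply: measurableT_comp => //.
  by apply: measurable_funM => //; exact: measurable_ln.
have q0 x : (0 <= (expR (h * ln x))%:E)%E by rewrite lee_fin expR_ge0.
rewrite (ge0_integral_gamma t0 (isT : (0 < 1)%N) mq q0).
under eq_integral do rewrite -EFinM gamma_pdf_shift// EFinM.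
rewrite ge0_integralZl ?integral_gamma_pdf ?mule1//.
- by apply/measurable_EFinP; exact: measurable_gamma_pdf.
- by move=> x _; rewrite lee_fin gamma_pdf_ge0.
- by rewrite lee_fin divr_ge0 ?Gamma_ge0.
Qed.

Lemma gamma_law_null t n : 0 < t -> (0 < n)%N -> P t [set w | X n w <= 0] = 0%E.
Proof.
move=> t0 n0; have [/(_ n n0) pdf _] := iid_X t0.
have := pdf `]-oo, 0]%classic (measurable_itv _).
rewrite (_ : (\int[leb]_(x in _) _ = 0)%E); last first.
  by apply: integral0_eq => x /=; rewrite in_itv/= => x0; rewrite gamma_pdf_le0.
by move=> <-; congr (P t _); apply/seteqP; split => w /=; rewrite in_itv.
Qed.

(** Off the null event [X <= 0], where [ln] has only a default value, [ln X = c] means [X = expR c],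
    a null event too. *)
Lemma ln_gamma_nonatomic t (c : R) : 0 < t -> P t [set w | L w = c] = 0%E.
Proof.
move=> t0; have [/(_ 1%N isT) pdf _] := iid_X t0.
have h : P t [set w | X 1%N w = expR c] = 0%E.
  have := pdf [set expR c] (measurable_set1 _).
  by rewrite integral_set1 => <-; congr (P t _).
have h0 := gamma_law_null t0 (ltn0Sn 0).
have mpre (f : T -> R) (B : set R) : measurable_fun [set: T] f -> measurable B ->
    measurable (f @^-1` B).
  by move=> mf mB; rewrite -[X in measurable X]setTI; exact: mf.
have m0 : measurable [set w | X 1%N w <= 0].
  rewrite (_ : [set w | _] = X 1%N @^-1` `]-oo, 0]); first exact: mpre.
  by apply/seteqP; split => w /=; rewrite in_itv.
have m1 : measurable [set w | X 1%N w = expR c] by exact: (mpre (X 1%N) [set expR c]).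
have mL : measurable [set w | L w = c].
  by apply: (mpre (fun w => L w) [set c]) => //; exact: measurable_L.
apply/eqP; rewrite -measure_le0 -[leRHS](adde0 0%E) -{1}h0 -h.
apply: le_trans (measureU2 _ m0 m1); apply: le_measure; rewrite ?inE//.
  exact: measurableU.
move=> w /= <-; case: (leP (X 1%N w) 0) => x0; first by left.
by right; rewrite /= lnK.
Qed.

End gamma_law.

Lemma ln_quotient {R : realType} (u v : R) : 0 < u -> 0 < v -> ln (u / v) = ln u - ln v.
Proof. by move=> u0 v0; rewrite ln_div ?posrE. Qed.

(** * Derivatives of the log-Gamma function and information numbers *)

Section log_gamma.
Context {d : measure_display} {T : measurableType d} {R : realType}.
Variables (P : R -> probability T R) (X : nat -> {mfun T >-> R}).
Hypothesis iid_X : forall theta : R, 0 < theta -> iid_gamma (P theta) X theta.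
Variable t : R.
Hypothesis t_gt0 : 0 < t.

Local Notation L w := (ln (X 1%N w)).
Local Notation E := (mean (P t)).
Local Notation intg := (summable_rv (P t)).

Definition ln_Gamma (s : R) : R := ln (Gamma s).

(** Since [M 0 h] is [Gamma (t + h) / Gamma t], its logarithm is the cumulant generating function of
    [ln X]. Below, [score h] is the digamma function at [t + h], and [V], the variance of [ln X], is
    the trigamma function at [t]. The range [- t < h < 1] keeps [t + h] positive; its right end is
    arbitrary. *)
Let M := exp_moment (P t) (fun w => L w).

Let itP (h : R) : - t < h < 1 -> 0 < t + h.
Proof. by move=> /andP[h1 _]; lra. Qed.

Let iexp (h : R) : - t < h < 1 -> intg (fun w => expR (h * L w)).
Proof. by move=> /itP th; case: (gamma_mgf iid_X t_gt0 th). Qed.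

Let I0 : - t < (0 : R) < 1. Proof. by rewrite oppr_lt0 t_gt0 ltr01. Qed.

Let M0E (h : R) : 0 < t + h -> M 0 h = Gamma (t + h) / Gamma t.
Proof.
move=> th; have [_ <-] := gamma_mgf iid_X t_gt0 th.
by apply: eq_mean => w; rewrite expr0 mul1r.
Qed.

Let M0_gt0 (h : R) : 0 < t + h -> 0 < M 0 h.
Proof. by move=> th; rewrite M0E// divr_gt0// (Gamma_gt0 iid_X). Qed.

Let M00 : M 0 (0 : R) = 1 :> R.
Proof. by rewrite M0E addr0// divff// gt_eqF// (Gamma_gt0 iid_X). Qed.

Let derM k (h : R) : - t < h < 1 -> is_derive h 1 (M k) (M k.+1 h).
Proof. exact: (is_derive_exp_moment (measurable_L X) iexp). Qed.

Lemma ln_Gamma_shift (h : R) : 0 < t + h -> ln_Gamma (t + h) = ln_Gamma t + ln (M 0 h).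
Proof.
move=> th; have G0 := Gamma_gt0 iid_X t_gt0; have G1 := Gamma_gt0 iid_X th.
rewrite (M0E th) (ln_quotient G1 G0) /ln_Gamma.
by move: (Gamma t) (Gamma (t + h)) => u v; ring.
Qed.

Let score (h : R) := M 1 h / M 0 h.

Let der_lnM (h : R) : - t < h < 1 -> is_derive h 1 (fun h => ln (M 0 h)) (score h).
Proof.
move=> hI; have M0h := M0_gt0 (itP hI).
have d1 := derM 0 hI; have d2 := is_derive1_ln M0h.
by rewrite /score mulrC; exact: (is_derive1_comp d2 d1).
Qed.

Let V := M 2 0 - M 1 0 ^+ 2.

Let der_score : is_derive (0 : R) 1 score V.
Proof.
have d0 := derM 0 I0; have d1 := derM 1 I0.
have M0h : M 0 0 != 0 by rewrite M00 oner_eq0.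
have d2 := is_deriveV (f := M 0) M0h d0.
apply: (is_derive_eq (is_deriveM d1 d2)).
by rewrite M00 expr1n invr1 scaleN1r scale1r /V -[_ *: _]/(_ * _); ring.
Qed.

(** The zeros of [f] lie in one level set of [ln X], which is null. Used both for the variance and
    for the Kullback-Leibler number. *)
Lemma mean_gt0 (f : T -> R) (c : R) : intg f -> (forall w, 0 <= f w) ->
  (forall w, f w = 0 -> L w = c) -> 0 < E f.
Proof.
move=> fi f0 fc; rewrite lt_neqAle mean_ge0// andbT; apply/negP => /eqP Ef.
have mf := summable_rv_measurable fi.
have : (\int[P t]_w `|(f w)%:E| = 0)%E.
  by under eq_integral do rewrite gee0_abs ?lee_fin//; rewrite meanE// -Ef.
move=> /(ae_eq_integral_abs (P t) measurableT).
have mfE : measurable_fun [set: T] (fun w => (f w)%:E) by exact/measurable_EFinP.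
move=> /(_ mfE) [N [mN N0 fN]].
have mL : measurable [set w | L w = c].
  rewrite -[X in measurable X]setTI.
  exact: (@measurable_L _ _ _ X measurableT [set c] (measurable_set1 c)).
have h : [set: T] `<=` N `|` [set w | L w = c].
  move=> w _; have [fw|fw] := eqVneq (f w) 0; first by right; exact: fc.
  left; apply: fN => /= /(_ Logic.I) /eqP; rewrite eqe; exact/negP.
have := ln_gamma_nonatomic iid_X c t_gt0.
have : (P t [set: T] <= P t N + P t [set w | L w = c])%E.
  apply: le_trans (measureU2 _ mN mL); apply: le_measure; rewrite ?inE//.
  exact: measurableU.
by rewrite probability_setT => h1 h2; move: h1; rewrite N0 h2 adde0 lee_fin ler10.
Qed.

Let intgM k : intg (fun w => L w ^+ k).
Proof.
have := summable_exp_moment (measurable_L X) iexp k I0.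
by congr summable_rv; apply/funext => w; rewrite mul0r expR0 mulr1.
Qed.

Let MkE k : M k 0 = E (fun w => L w ^+ k).
Proof. by apply: eq_mean => w; rewrite mul0r expR0 mulr1. Qed.

Let m := E (fun w => L w).

Let M1E : M 1 0 = m. Proof. exact: MkE. Qed.

Let intgL : intg (fun w => L w). Proof. exact: (intgM 1). Qed.

Let V_gt0 : 0 < V.
Proof.
have -> : V = E (fun w => (L w - m) ^+ 2).
  have i1 : intg (fun w => 2 * m * L w) by exact: summable_rvZ.
  have -> : E (fun w => (L w - m) ^+ 2) = E (fun w => (L w ^+ 2 - 2 * m * L w) + m ^+ 2).
    by apply: eq_mean => w; ring.
  rewrite meanD; last 2 first.
  - by apply: summable_rvB.
  - exact: summable_rv_cst.
  rewrite meanB// meanZ// mean_cst /V MkE M1E -/m; ring.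
apply: (@mean_gt0 _ m); last 2 first.
- by move=> w; exact: sqr_ge0.
- by move=> w /eqP; rewrite sqrf_eq0 subr_eq0 => /eqP.
have i1 : intg (fun w => L w ^+ 2 - 2 * m * L w + m ^+ 2).
  apply: summable_rvD; last exact: summable_rv_cst.
  by apply: summable_rvB => //; exact: summable_rvZ.
by move: i1; congr summable_rv; apply/funext => w; ring.
Qed.

Lemma near_gt0 (x : R) : 0 < x -> \forall y \near x, 0 < y.
Proof. exact: lt_nbhsr. Qed.

Let shift_der (f : R -> R) (x df : R) : is_derive (x - t) 1 f df ->
  is_derive x 1 (fun s => f (s - t)) df.
Proof.
move=> fd; rewrite -[df]mulr1; apply: (is_derive1_comp (f := f) (g := fun s => s - t)).
by apply: is_derive_eq; rewrite subr0.
Qed.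

Lemma is_derive_ln_Gamma (s : R) : 0 < s < t + 1 ->
  is_derive s 1 ln_Gamma (score (s - t)).
Proof.
move=> /andP[s0 st]; have sI : - t < s - t < 1 by apply/andP; split; lra.
apply: (@near_eq_is_derive _ _ _ (fun s => ln_Gamma t + ln (M 0 (s - t)))).
  near=> y; rewrite -ln_Gamma_shift ?subrKC//.
  by near: y; exact: near_gt0.
have dl := shift_der (der_lnM sI).
apply: (is_derive_eq (is_deriveD (is_derive_cst (ln_Gamma t) s 1) dl)).
exact: add0r.
Unshelve. end_near. Qed.

(** The second derivative of the log density in the parameter is [- V] for every [x > 0], so its
    mean is that of a constant. *)
Lemma fisher_infoE : fisher_info t = V.
Proof.
have second (x : R) : 0 < x -> (fun s => ln (gamma_pdf s x))^`(2)%classic t = - V.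
  move=> x0; rewrite derive1nS derive1n1.
  have d1 (s : R) : 0 < s < t + 1 ->
      is_derive s 1 (fun s => ln (gamma_pdf s x)) (ln x - score (s - t)).
    move=> /andP[s0 st].
    apply: (@near_eq_is_derive _ _ _ (fun s : R => ((s - 1) * ln x - x) - ln_Gamma s)).
      near=> y; have y0 : 0 < y by near: y; exact: near_gt0.
      rewrite gamma_pdf_gt0E// ln_div ?expRK//  ?posrE ?expR_gt0//.
      exact: (Gamma_gt0 iid_X).
    have dl : is_derive s 1 ln_Gamma (score (s - t)).
      by apply: is_derive_ln_Gamma; rewrite s0.
    have dx : is_derive s 1 (fun s : R => (s - 1) * ln x - x) (ln x).
      apply: is_derive_eq; rewrite scaler0 add0r !subr0; exact: mulr1.
    exact: (is_deriveB dx dl).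
  rewrite derive1E.
  have ds : is_derive t 1 (fun s => ln x - score (s - t)) (- V).
    have dd : is_derive t 1 (fun s => score (s - t)) V.
      by apply: shift_der; rewrite subrr; exact: der_score.
    apply: (is_derive_eq (is_deriveB (is_derive_cst (ln x) t 1) dd)).
    exact: sub0r.
  rewrite (@near_eq_derive _ _ _ _ (fun s => ln x - score (s - t))) ?oner_eq0//.
    by rewrite derive_val.
  near=> s; have sI : 0 < s < t + 1.
    apply/andP; split; near: s; first exact: near_gt0.
    by apply: lt_nbhsl; rewrite ltrDl.
  by rewrite derive1E; have ds' := d1 s sI; rewrite derive_val.
rewrite /fisher_info /gamma_mean.
rewrite (_ : \int[_]_(x in _) _ = gamma_mean t (cst (- V))); last first.
  apply: eq_Rintegral.
  move=> x; rewrite inE/= in_itv/= andbT => x0.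
  by congr (_ * _); exact: second.
by rewrite (gamma_meanE iid_X t_gt0 (measurable_cst _)) mean_cst opprK.
Unshelve. all: end_near. Qed.

Lemma fisher_info_gt0 : 0 < fisher_info t.
Proof. by rewrite fisher_infoE. Qed.

Lemma kl_infoE (phi : R) : 0 < phi ->
  kl_info t phi = (t - phi) * m - ln_Gamma t + ln_Gamma phi.
Proof.
move=> phi0; have Gt := Gamma_gt0 iid_X t_gt0; have Gp := Gamma_gt0 iid_X phi0.
rewrite /kl_info {1}/gamma_mean (_ : \int[_]_(x in _) _ =
    gamma_mean t (fun x => (t - phi) * ln x - ln_Gamma t + ln_Gamma phi)); last first.
  apply: eq_Rintegral.
  move=> x; rewrite inE/= in_itv/= andbT => x0; congr (_ * _).
  rewrite (gamma_pdf_gt0E t x0) (gamma_pdf_gt0E phi x0) /ln_Gamma.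
  move: Gt Gp; move: (Gamma t) (Gamma phi) => u v u0 v0.
  rewrite !ln_quotient ?divr_gt0 ?expR_gt0// !expRK; ring.
have mq : measurable_fun [set: R] (fun x => (t - phi) * ln x - ln_Gamma t + ln_Gamma phi).
  apply: measurable_funD => //; apply: measurable_funB => //.
  by apply: measurable_funM => //; exact: measurable_ln.
rewrite (gamma_meanE iid_X t_gt0 mq); move: (ln_Gamma t) (ln_Gamma phi) {mq} => u v.
have i1 : intg (fun w => (t - phi) * L w) by exact: summable_rvZ.
rewrite meanD; last 2 first.
- by apply: summable_rvB => //; exact: summable_rv_cst.
- exact: summable_rv_cst.
rewrite meanB//; last exact: summable_rv_cst.
by rewrite !mean_cst meanZ.
Qed.

Let kl_shift (phi : R) : 0 < phi ->
  kl_info t phi = ln (M 0 (phi - t)) - (phi - t) * m.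
Proof.
move=> phi0; rewrite kl_infoE//.
have := @ln_Gamma_shift (phi - t); rewrite subrKC => /(_ phi0) ->; ring.
Qed.

(* [exp y >= 1 + y], with [y = ln (f_phi (X) / f_t (X))] *)
Let kl_gap (phi : R) : 0 < phi -> exists y : T -> R,
  [/\ intg (fun w => expR (y w) - 1 - y w),
      kl_info t phi = E (fun w => expR (y w) - 1 - y w) &
      forall w, y w = (phi - t) * L w - ln (M 0 (phi - t))].
Proof.
move=> phi0; have th : 0 < t + (phi - t) by rewrite subrKC.
have [i1 e1] := gamma_mgf iid_X t_gt0 th.
set k := ln (M 0 (phi - t)).
pose y w := (phi - t) * L w - k; exists y.
have ey w : expR (y w) = (M 0 (phi - t))^-1 * expR ((phi - t) * L w).
  by rewrite /y /k expRB lnK ?posrE ?M0_gt0// mulrC.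
have i2 : intg (fun w => expR (y w)).
  rewrite (_ : (fun _ => _) = (fun w =>
    (M 0 (phi - t))^-1 * expR ((phi - t) * L w))); first exact: summable_rvZ.
  by apply/funext => w; exact: ey.
have i3 : intg y.
  by apply: summable_rvB; [exact: summable_rvZ|exact: summable_rv_cst].
have i4 : intg (fun w => expR (y w) - 1).
  by apply: summable_rvB => //; exact: summable_rv_cst.
split => //; first exact: summable_rvB.
rewrite meanB// meanB//; last exact: summable_rv_cst.
have -> : E (fun w => expR (y w)) = 1.
  rewrite (eq_mean (P t) ey) meanZ// e1 -M0E// mulVf// gt_eqF// M0_gt0//.
rewrite mean_cst /y meanB ?mean_cst; [|exact: summable_rvZ|exact: summable_rv_cst].
by rewrite meanZ// kl_shift// -/k -/m; ring.
Qed.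

Lemma kl_info_ge0 (phi : R) : 0 < phi -> 0 <= kl_info t phi.
Proof.
move=> phi0; have [y [_ -> _]] := kl_gap phi0; apply: mean_ge0 => w.
by rewrite -addrA -opprD subr_ge0 expR_ge1Dx.
Qed.

(** Equality in [1 + y <= expR y] holds only at [y = 0], which pins [ln X] to one value when
    [t != phi]. *)
Lemma kl_info_gt0 (phi : R) : 0 < phi -> t != phi -> 0 < kl_info t phi.
Proof.
move=> phi0 tphi; have [y [iy -> yE]] := kl_gap phi0.
apply: (@mean_gt0 _ (ln (M 0 (phi - t)) / (phi - t))) => //.
  by move=> w; rewrite -addrA -opprD subr_ge0 expR_ge1Dx.
move=> w /eqP; rewrite -addrA -opprD subr_eq0 => /eqP ew.
have y0 : y w = 0.
  apply/eqP/contraT => /expR_gt1Dx; by rewrite ew ltxx.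
have pt : phi - t != 0 by rewrite subr_eq0 eq_sym.
by apply/eqP; rewrite -(inj_eq (mulIf pt)) divfK// mulrC -subr_eq0 -yE y0.
Qed.

(** The remainder [F] vanishes at [0] and has derivative [score x - m - V * x], which is [o(x)]
    because [V] is the derivative of [score] at [0]. The mean value theorem on either side gives the
    bound. *)
Lemma kl_info_quadratic (e : R) : 0 < e -> exists2 s, 0 < s & forall phi, 0 < phi ->
  `|phi - t| <= s ->
  `|kl_info t phi - fisher_info t / 2 * (phi - t) ^+ 2| <= e * (phi - t) ^+ 2.
Proof.
move=> e0.
have [s [s0 st s1 sE]] : exists s, [/\ 0 < s, s < t, s < 1 & forall h, `|h| <= s ->
    `|score h - m - V * h| <= e * `|h|].
  have [der dval] := der_score.
  have : h^-1 *: (score (h *: 1 + 0) - score 0) @[h --> 0^'] --> V.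
    by rewrite -dval; exact: der.
  move=> /cvgrPdist_le /(_ _ e0) /= [r r0 rE].
  pose s := Num.min (Num.min (r / 2) (t / 2)) (1 / 2).
  have sr : s <= r / 2 by rewrite ge_min ge_min lexx.
  have s1 : s <= t / 2 by rewrite ge_min ge_min lexx orbT.
  have s2 : s <= 1 / 2 by rewrite ge_min lexx orbT.
  have s0 : 0 < s by rewrite !lt_min !divr_gt0.
  exists s; split => //; [by move: s1 t_gt0; lra|by move: s2; lra|].
  move=> h hs; have [->|h0] := eqVneq h 0.
    by rewrite /score M00 divr1 M1E subrr mulr0 subrr normr0 mulr0.
  have := rE h; rewrite /ball_/= sub0r normrN => /(_ _ h0).
  rewrite addr0 [_ *: 1]mulr1 => H.
  have {}H : `|V - h^-1 * (score h - score 0)| <= e.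
    by apply: H; apply: le_lt_trans hs _; move: sr r0; lra.
  have -> : score h - m - V * h = - (V - h^-1 * (score h - score 0)) * h.
    have -> : score 0 = m by rewrite /score M00 divr1.
    by field.
  by rewrite normrM normrN ler_wpM2r.
exists s => // phi phi0; set h := phi - t => hs.
rewrite kl_shift// fisher_infoE -/h.
pose F (x : R) := ln (M 0 x) - x * m - V / 2 * x ^+ 2.
have inI (x : R) : `|x| <= s -> - t < x < 1.
  by move=> /ler_normlP[x1 x2]; apply/andP; split; lra.
have dF (x : R) : `|x| <= s -> is_derive x 1 F (score x - m - V * x).
  move=> /inI xI; have dl := der_lnM xI.
  have d1 : is_derive x 1 (fun x : R => x * m) m.
    by apply: is_derive_eq; rewrite scaler0 add0r; exact: mulr1.
  have d2 : is_derive x 1 (fun x : R => V / 2 * x ^+ 2) (V * x).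
    by apply: is_derive_eq; rewrite -[x%:A]/(x * 1) -[_ *: _]/(_ * _); field.
  exact: (is_deriveB (is_deriveB dl d1) d2).
have F0 : F 0 = 0 by rewrite /F M00 ln1 mul0r expr0n/= mulr0 !subr0.
suff : `|F h| <= e * h ^+ 2 by rewrite /F; apply: le_trans; rewrite mulrAC.
have cont (a b : R) : (forall x, x \in `[a, b] -> `|x| <= s) ->
    {within `[a, b], continuous F}.
  move=> abs; apply: derivable_within_continuous => x /abs /dF dx.
  exact: ex_derive.
have bound (c : R) : `|c| <= `|h| -> `|(score c - m - V * c) * h| <= e * h ^+ 2.
  move=> ch; rewrite normrM -[h ^+ 2]real_normK ?num_real// expr2 mulrA.
  rewrite ler_wpM2r//; apply: le_trans (sE _ (le_trans ch hs)) _.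
  by rewrite ler_pM2l.
have [h0|h0] := leP 0 h.
- have abs x : x \in `[0, h] -> `|x| <= s.
    rewrite in_itv/= => /andP[x0 xh]; rewrite ger0_norm//.
    by apply: le_trans xh _; apply: le_trans (ler_norm _) hs.
  have [||c ch] := @MVT_segment R F (fun x => score x - m - V * x) 0 h h0.
  + by move=> x xI; apply/dF/abs; apply: subset_itv_oo_cc xI.
  + exact: cont.
  rewrite F0 !subr0 => ->; apply: bound.
  by move: ch; rewrite in_itv/= => /andP[c0 ch]; rewrite !ger0_norm.
- have abs x : x \in `[h, 0] -> `|x| <= s.
    rewrite in_itv/= => /andP[xh x0]; rewrite ler0_norm//.
    by apply: le_trans hs; rewrite ltr0_norm// lerN2.
  have [||c ch] := @MVT_segment R F (fun x => score x - m - V * x) h 0 (ltW h0).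
  + by move=> x xI; apply/dF/abs; apply: subset_itv_oo_cc xI.
  + exact: cont.
  rewrite F0 sub0r => /eqP; rewrite sub0r mulrN eqr_opp => /eqP ->; apply: bound.
  move: ch; rewrite in_itv/= => /andP[c0 ch]; rewrite ler0_norm// ltr0_norm//.
  by rewrite lerN2.
Qed.

End log_gamma.

(** * Upper bounds for the Gamma function *)

Section gamma_bounds.
Context {R : realType}.
Local Notation leb := (@lebesgue_measure R).

Let weight (phi x : R) := x `^ (phi - 1) * expR (- x).

Let weight_ge0 phi x : 0 <= weight phi x.
Proof. by rewrite mulr_ge0 ?powR_ge0 ?expR_ge0. Qed.

(* [lebesgue_measure] lives on [measurableTypeR R], whose sigma-algebra is the
   one of [R] only up to conversion. *)
Let measurable_leb (f : R -> R) (D : set R) : measurable_fun [set: R] f ->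
  measurable_fun (D : set (measurableTypeR R)) (fun x : measurableTypeR R => (f x)%:E).
Proof.
move=> /measurable_EFinP mf mD B mB.
exact: (measurable_funS measurableT (@subsetT _ D) mf mD mB).
Qed.

Let measurable_weight phi : measurable_fun [set: R] (weight phi).
Proof. by apply: measurable_funM => //; apply: measurableT_comp. Qed.

Let Gamma_le phi (c : R) :
  (\int[leb]_(x in `]0%R, +oo[) (weight phi x)%:E <= c%:E)%E -> Gamma phi <= c.
Proof.
move=> h; rewrite /Gamma /Rintegral -lee_fin fineK//.
rewrite ge0_fin_numE; first exact: le_lt_trans h (ltry _).
by apply: integral_ge0 => x _; rewrite lee_fin weight_ge0.
Qed.

Let exp_pdf_ge0 (r x : R) : 0 < r -> (0 <= (exponential_pdf r x)%:E)%E.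
Proof. by move=> r0; rewrite lee_fin exponential_pdf_ge0// ltW. Qed.

(** From [ln x <= x / (2 * phi) + 2 * phi] the integrand is at most [expR (2 * phi ^+ 2 - x / 2)], a
    multiple of an exponential density of rate one half. A quadratic bound on the logarithm is
    enough, as second powers of the estimation error are controlled. *)
Lemma Gamma_le_large (phi : R) : 1 <= phi -> Gamma phi <= 2 * expR (2 * phi ^+ 2).
Proof.
move=> phi1; apply: Gamma_le; have phi0 : 0 < phi by exact: lt_le_trans phi1.
pose k := 2 * expR (2 * phi ^+ 2); have k0 : 0 <= k by rewrite mulr_ge0 ?expR_ge0.
have half0 : 0 < 2^-1 :> R by rewrite invr_gt0.
have mexp := @measurable_exponential_pdf R 2^-1.
apply: (@le_trans _ _ (\int[leb]_(x in `]0%R, +oo[) (k * exponential_pdf 2^-1 x)%:E)%E).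
  apply: ge0_le_integral => //.
  - by move=> x _; rewrite lee_fin weight_ge0.
  - exact: measurable_leb.
  - by apply: measurable_leb; exact: measurable_funM.
  move=> x; rewrite /= in_itv/= andbT => x0; rewrite lee_fin.
  have -> : weight phi x = expR ((phi - 1) * ln x - x).
    by rewrite /weight /powR gt_eqF// -expRD.
  have -> : k * exponential_pdf 2^-1 x = expR (2 * phi ^+ 2 - x / 2).
    rewrite exponential_pdfE ?ltW// /k expRD.
    have -> : - 2^-1 * x = - (x / 2) by field.
    by field.
  rewrite ler_expR.
  have y0 : 0 < x / (2 * phi) by rewrite divr_gt0// mulr_gt0.
  have h1 : ln x <= x / (2 * phi) + 2 * phi.
    have p0 : 0 < 2 * phi by rewrite mulr_gt0.
    have -> : ln x = ln (x / (2 * phi)) + ln (2 * phi).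
      by rewrite -lnM ?posrE// divfK// gt_eqF.
    by apply: lerD; exact/ltW/ln_sublinear.
  have s0 : 0 <= phi - 1 by rewrite subr_ge0.
  have h2 := ler_wpM2l s0 h1.
  have h3 : (phi - 1) * (x / (2 * phi)) <= x / 2.
    have -> : x / 2 = phi * (x / (2 * phi)) by field; rewrite gt_eqF.
    by rewrite ler_wpM2r ?(ltW y0)// gerBl.
  have h4 : (phi - 1) * (2 * phi) <= 2 * phi ^+ 2 by move: phi0; nra.
  by move: h2; rewrite mulrDr; move: h3 h4; lra.
under eq_integral do rewrite EFinM.
rewrite ge0_integralZl//; last 2 first.
- exact: measurable_leb.
- by move=> x _; exact: exp_pdf_ge0.
rewrite -[leRHS]mule1; apply: lee_wpmul2l; first by rewrite lee_fin.
rewrite -(integral_exponential_pdf half0); apply: ge0_subset_integral => //.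
  exact: measurable_leb.
by move=> x _; exact: exp_pdf_ge0.
Qed.

Lemma integral_powR01_le (phi : R) : 0 < phi ->
  (\int[leb]_(x in `]0%R, 1%R]) (x `^ (phi - 1))%:E <= (phi^-1)%:E)%E.
Proof.
move=> phi0; pose F n : set R := `[n.+1%:R^-1, 1]%classic.
have FE : `]0, 1]%classic = \bigcup_n F n.
  apply/seteqP; split => [x|x [n _]]; rewrite /F /= !in_itv/= => /andP[x0 x1].
    have [n _ xn] := @near_infty_natSinv_lt R (PosNum x0).
    exists n => //=; rewrite in_itv/= x1 andbT ltW//; exact: xn (leqnn n).
  by rewrite x1 andbT (lt_le_trans _ x0)// invr_gt0.
have mp : measurable_fun [set: R] (fun x : R => x `^ (phi - 1)) by [].
have nF : {homo F : n m / (n <= m)%N >-> (n <= m)%O}.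
  move=> m n mn; rewrite subsetEset; apply: subset_itvr; rewrite bnd_simp.
  by rewrite lef_pV2 ?posrE// ler_nat ltnS.
have := @ge0_nondecreasing_set_cvg_integral _ (measurableTypeR R) R F
  (fun x => (x `^ (phi - 1))%:E) leb nF (fun n => measurable_itv _)
  (fun n => @measurable_leb _ (F n) mp)
  (fun n x _ => powR_ge0 x (phi - 1)).
rewrite FE => cvgF; rewrite -(cvg_lim _ cvgF)//.
apply: lime_le; first by apply/cvg_ex; eexists; exact: cvgF.
apply: nearW => n; set a : R := n.+1%:R^-1.
have a0 : 0 < a by rewrite invr_gt0.
have a1 : a <= 1 by rewrite invf_le1// ler1n.
(* For [n = 0] the interval is a single point, while the fundamental theorem of calculus needs
   [a < 1]. *)
move: a1; rewrite le_eqVlt => /orP[/eqP a1|a1].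
  by rewrite /F -/a a1 set_itv1 integral_set1 lee_fin invr_ge0 ltW.
have pos x : a <= x -> x \in `]0, +oo[ by move=> ax; rewrite in_itv/= andbT (lt_le_trans a0).
have dp x : a <= x -> is_derive x 1 (fun x : R => phi^-1 * x `^ phi) (x `^ (phi - 1)).
  move=> /pos xp; have dx : is_derive x 1 (fun x : R => x `^ phi) (phi * x `^ (phi - 1)).
    apply: DeriveDef; first exact: derivable_powR.
    by rewrite -derive1E powR_derive1.
  by apply: is_derive_eq; rewrite -[_ *: _]/(_ * _) mulrA mulVf ?mul1r ?gt_eqF.
have cont x : a <= x -> {for x, continuous (fun x : R => phi^-1 * x `^ phi)}.
  move=> /dp dx; apply/differentiable_continuous/derivable1_diffP; exact: ex_derive.
rewrite (@continuous_FTC2 _ _ (fun x : R => phi^-1 * x `^ phi) _ _ a1).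
- by rewrite -EFinB lee_fin powR1 mulr1 gerBl mulr_ge0 ?powR_ge0// invr_ge0 ltW.
- apply: derivable_within_continuous => x; rewrite in_itv/= => /andP[ax _].
  by apply: derivable_powR; exact: pos.
- split.
  + move=> x; rewrite in_itv/= => /andP[/ltW ax _]; have := dp x ax.
    by move=> dx; exact: ex_derive.
  + by apply: cvg_at_right_filter; exact: cont.
  + by apply: cvg_at_left_filter; apply: cont; exact: ltW.
- move=> x; rewrite in_itv/= => /andP[/ltW ax _]; have := dp x ax => dx.
  by rewrite derive1E derive_val.
Qed.

(** Cut at [1]: the power alone gives [phi^-1] below, the exponential alone at most [1 <= phi^-1]
    above. *)
Lemma Gamma_le_small (phi : R) : 0 < phi < 1 -> Gamma phi <= 2 / phi.
Proof.
move=> /andP[phi0 phi1]; apply: Gamma_le.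
have -> : `]0, +oo[%classic = `]0, 1]%classic `|` `]1, +oo[%classic :> set R.
  by rewrite -itv_bndbnd_setU// bnd_simp.
rewrite ge0_integral_setU//=; last 3 first.
- exact: measurable_leb.
- by move=> x _; rewrite lee_fin weight_ge0.
- apply/disj_setPS => x [] /=; rewrite !in_itv/= andbT => /andP[_ x1] x2.
  by move: (lt_le_trans x2 x1); rewrite ltxx.
apply: (@le_trans _ _ ((phi^-1)%:E + 1)%E).
  apply: leeD.
    apply: le_trans (integral_powR01_le phi0); apply: ge0_le_integral => //.
    - by move=> x _; rewrite lee_fin weight_ge0.
    - exact: measurable_leb.
    - exact: measurable_leb.
    - move=> x; rewrite /= in_itv/= => /andP[x0 _].
      by rewrite lee_fin ler_piMr ?powR_ge0// expR_le1 oppr_le0 ltW.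
  rewrite -(integral_exponential_pdf (@ltr01 R)).
  apply: (@le_trans _ _ (\int[leb]_(x in `]1%R, +oo[) (exponential_pdf 1 x)%:E)%E).
    apply: ge0_le_integral => //.
    - by move=> x _; rewrite lee_fin weight_ge0.
    - exact: measurable_leb.
    - by apply: measurable_leb; exact: measurable_exponential_pdf.
    - move=> x; rewrite /= in_itv/= andbT => x1.
      have x0 : 0 < x by exact: lt_trans x1.
      rewrite lee_fin exponential_pdfE ?(ltW x0)// mul1r mulN1r /weight.
      have p0 : phi - 1 <= 0 by rewrite subr_le0 ltW.
      have := ler_powR (ltW x1) p0; rewrite powRr0 => px.
      by rewrite ler_piMl ?expR_ge0.
  apply: ge0_subset_integral => //.
    by apply: measurable_leb; exact: measurable_exponential_pdf.
  by move=> x _; apply: exp_pdf_ge0.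
rewrite -EFinD lee_fin mulr_natl mulr2n lerD2l.
by rewrite invf_ge1// ltW.
Qed.

End gamma_bounds.

(** * The adaptive likelihood ratio *)

Section waiting_time.
Context {R : realType}.

(** A [stopping_time] at a fixed outcome, with the crossing condition abstracted to a boolean
    sequence. *)
Definition first_time (p : nat -> bool) : \bar R :=
  match pselect (exists n, (1 <= n)%N && p n) with
  | left crossed => (ex_minn crossed)%:R%:E
  | right _ => +oo%E
  end.

(** A waiting time is the sum over [i] of the indicators that it exceeds [i]; this also holds when
    it is infinite. *)
Lemma first_time_series (p : nat -> bool) :
  (first_time p = \sum_(0 <= i <oo) (\prod_(j < i) (~~ p j.+1)%:R)%:E)%E.
Proof.
pose q i : R := \prod_(j < i) (~~ p j.+1)%:R.
have q0 i : (0 <= (q i)%:E)%E by rewrite lee_fin prodr_ge0.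
have q1 n : (forall j, (1 <= j <= n)%N -> ~~ p j) -> q n = 1.
  by move=> pn; rewrite /q big1// => j _; rewrite pn//= ltn_ord.
rewrite /first_time; case: pselect => [crossed|nocross]; last first.
  have {}q1 n : q n = 1.
    apply: q1 => j /andP[j1 _]; apply/negP => pj; apply: nocross.
    by exists j; rewrite j1.
  apply/esym/eqyP => A A0.
  have [n An] : exists n : nat, A <= n%:R by exists (Num.bound A); rewrite ltW// archi_boundP// ltW.
  apply: (@le_trans _ _ n%:R%:E); first by rewrite lee_fin.
  have := @nneseries_lim_ge R (fun i => (q i)%:E) xpredT 0 n (fun i _ _ => q0 i).
  apply: le_trans; rewrite big_mkord sumEFin lee_fin.
  by rewrite (eq_bigr (fun=> 1)) ?sumr_const ?card_ord.
case: ex_minnP => n /andP[n1 pn] nmin.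
have qlt i : (i < n)%N -> q i = 1.
  move=> ilt; apply: q1 => j /andP[j1 ji]; apply/negP => pj.
  by have := nmin j; rewrite j1 pj => /(_ isT); rewrite leqNgt (leq_ltn_trans ji).
have qge i : (n <= i)%N -> q i = 0.
  case: n n1 pn {nmin qlt} => // n _ pn ni.
  by rewrite /q (bigD1 (Ordinal ni))//= pn mul0r.
rewrite (nneseries_split 0 n)//; last by move=> i _; exact: q0.
rewrite eseries0 ?adde0; last by move=> i; rewrite add0n => ni _; rewrite -/(q i) qge.
rewrite add0n big_mkord sumEFin (eq_bigr (fun=> 1)); first by rewrite sumr_const card_ord.
by move=> i _; rewrite -/(q i) qlt.
Qed.

End waiting_time.

Section log_gamma_bounds.
Context {d : measure_display} {T : measurableType d} {R : realType}.
Variables (P : R -> probability T R) (X : nat -> {mfun T >-> R}).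
Hypothesis iid_X : forall theta : R, 0 < theta -> iid_gamma (P theta) X theta.
Variable t : R.
Hypothesis t_gt0 : 0 < t.

Lemma measurable_ln_Gamma : measurable_fun (`]0, +oo[ : set R) (@ln_Gamma R).
Proof.
apply: open_continuous_measurable_fun; first exact: interval_open.
move=> s; rewrite inE/= in_itv/= andbT => s0.
have sI : 0 < s < s + 1 by rewrite s0 ltrDl ltr01.
have ds := is_derive_ln_Gamma iid_X s0 sI.
by apply/differentiable_continuous/derivable1_diffP; exact: ex_derive.
Qed.

Definition estimator_weight (c phi : R) : R :=
  1 + (phi - t) ^+ 2 + Num.max (ln phi^-1) 0 * (phi < c)%R%:R.

Lemma estimator_weight_ge1 c phi : 1 <= estimator_weight c phi.
Proof.
rewrite /estimator_weight -addrA lerDl addr_ge0 ?sqr_ge0//.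
by rewrite mulr_ge0// le_max lexx orbT.
Qed.

Lemma sqr_le_estimator_weight c phi : 1 + (phi - t) ^+ 2 <= estimator_weight c phi.
Proof. by rewrite lerDl mulr_ge0// le_max lexx orbT. Qed.

(** From below, nonnegativity of [kl_info t phi] puts [ln_Gamma] above its tangent at [t]. From
    above there are three cases: [1 <= phi] uses the quadratic term, [phi < 1] below [c] the
    logarithmic term, and [c <= phi < 1] the constant [ln c]. *)
Lemma ln_Gamma_norm_le (c : R) : 0 < c -> exists2 k, 0 < k & forall phi, 0 < phi ->
  `|ln_Gamma phi| <= k * estimator_weight c phi.
Proof.
move=> c0; set m := mean (P t) (fun w => ln (X 1%N w)).
pose k := `|ln_Gamma t| + `|m| + 4 + 4 * t ^+ 2 + `|ln c|.
have t2 : 0 <= t ^+ 2 by exact: sqr_ge0.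
have k1 : `|ln_Gamma t| + `|m| <= k.
  by have := normr_ge0 (ln c); rewrite /k; lra.
have k2 : 4 + 4 * t ^+ 2 + `|ln c| <= k.
  have := normr_ge0 (ln_Gamma t); have := normr_ge0 m; rewrite /k; lra.
have k0 : 0 < k.
  by apply: lt_le_trans k2; have := normr_ge0 (ln c); lra.
exists k => // phi phi0; set W := estimator_weight c phi.
have W1 : 1 <= W := estimator_weight_ge1 c phi.
have W0 : 0 <= W by apply: le_trans W1.
have WZ1 : 1 + (phi - t) ^+ 2 <= W := sqr_le_estimator_weight c phi.
have WZ : (phi - t) ^+ 2 <= W by apply: le_trans WZ1; rewrite lerDr.
have G0 := Gamma_gt0 iid_X phi0.
rewrite ler_norml; apply/andP; split.
  have := kl_info_ge0 iid_X t_gt0 phi0; rewrite (kl_infoE iid_X)// -/m => h.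
  have h1 : (phi - t) * m <= W * `|m|.
    apply: le_trans (ler_norm _) _; rewrite normrM; apply: ler_wpM2r => //.
    rewrite -ler_sqr ?nnegrE//.
    rewrite real_normK ?num_real//; apply: le_trans WZ _.
    by rewrite expr2 ler_peMr//.
  have h1' : - (W * `|m|) <= (phi - t) * m.
    rewrite lerNl -mulNr; apply: le_trans (ler_norm _) _.
    rewrite normrM normrN; apply: ler_wpM2r => //.
    rewrite -ler_sqr ?nnegrE//.
    rewrite real_normK ?num_real//; apply: le_trans WZ _.
    by rewrite expr2 ler_peMr//.
  have h2 : - (W * `|ln_Gamma t|) <= ln_Gamma t.
    rewrite lerNl; apply: le_trans (_ : `|ln_Gamma t| <= _).
      by rewrite -normrN ler_norm.
    by rewrite ler_peMl.
  have h3 : W * (`|ln_Gamma t| + `|m|) <= W * k.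
    by exact: ler_wpM2l.
  move: h h1' h2 h3; clearbody k m; move: (ln_Gamma phi) (ln_Gamma t) => u v; lra.
have [phi1|phi1] := leP 1 phi.
  have h : ln_Gamma phi <= 2 + 2 * phi ^+ 2.
    have := Gamma_le_large phi1; rewrite -ler_ln ?posrE ?mulr_gt0 ?expR_gt0//.
    rewrite lnM ?posrE ?expR_gt0// expRK => /le_trans; apply.
    by rewrite lerD2r; exact/ltW/ln_sublinear.
  have h2 : phi ^+ 2 <= 2 * (phi - t) ^+ 2 + 2 * t ^+ 2.
    by have := sqr_ge0 (phi - 2 * t); lra.
  have h3 : (4 + 4 * t ^+ 2 + `|ln c|) * W <= k * W.
    by exact: ler_wpM2r.
  have h4 : 4 * t ^+ 2 <= 4 * t ^+ 2 * W by rewrite ler_peMr// mulr_ge0.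
  have h5 : 0 <= `|ln c| * W by exact: mulr_ge0.
  move: h h2 h3 h4 h5 WZ1; lra.
have h : ln_Gamma phi <= 2 + ln phi^-1.
  have := Gamma_le_small (introT andP (conj phi0 phi1)).
  rewrite -ler_ln ?posrE ?divr_gt0// lnM ?posrE ?invr_gt0// => /le_trans; apply.
  by rewrite lerD2r; exact/ltW/ln_sublinear.
have h3 : (4 + 4 * t ^+ 2 + `|ln c|) * W <= k * W.
  by exact: ler_wpM2r.
have h4 : 0 <= 4 * t ^+ 2 * W by apply: mulr_ge0 => //; apply: mulr_ge0.
have h5 : `|ln c| <= `|ln c| * W by rewrite ler_peMr.
have [phic|phic] := ltP phi c.
  have h6 : ln phi^-1 <= W.
    rewrite /W /estimator_weight phic mulr1.
    apply: (@le_trans _ _ (Num.max (ln phi^-1) 0)); first by rewrite le_max lexx.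
    by rewrite lerDr addr_ge0// sqr_ge0.
  move: h h3 h4 h5 h6 W1; have := normr_ge0 (ln c); lra.
have h6 : ln phi^-1 <= `|ln c|.
  rewrite lnV ?posrE//; apply: (@le_trans _ _ (- ln c)).
    by rewrite lerN2 ler_ln ?posrE.
  by rewrite -normrN ler_norm.
move: h h3 h4 h5 h6 W1; lra.
Qed.

End log_gamma_bounds.

Lemma norm_sub_le {R : realType} (u v : R) : 0 <= u -> u <= v / 4 -> `|u - v| <= 2 * v.
Proof. by move=> u0 uv; rewrite ler_norml; apply/andP; split; lra. Qed.

Section adaptive_likelihood.
Context {d : measure_display} {T : measurableType d} {R : realType}.
Variables (P : R -> probability T R) (X : nat -> {mfun T >-> R}).
Hypothesis iid_X : forall theta : R, 0 < theta -> iid_gamma (P theta) X theta.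
Variables (est : nat -> T -> R) (theta0 : R).
Hypothesis theta0_gt0 : 0 < theta0.
Hypothesis est_gt0 : forall n w, (0 < n)%N -> 0 < est n w.
Hypothesis est_pred : nonanticipating X est.
Variable t : R.
Hypotheses (t_gt0 : 0 < t) (t_neq : t != theta0).

Let A i w := est i.+1 w - theta0.
Let C i w := ln_Gamma (est i.+1 w) - ln_Gamma theta0.
Let Z i w := est i.+1 w - t.

Let ml : measurable_fun [set: R] (@ln R).
Proof. exact: measurable_ln. Qed.

Let aE i : adapted X i (est i.+1).
Proof. exact: nonanticipating_adapted. Qed.

Let aA i : adapted X i (A i).
Proof. by apply: measurable_funB => //; exact: aE. Qed.

Let aZ i : adapted X i (Z i).
Proof. by apply: measurable_funB => //; exact: aE. Qed.

Let aC i : adapted X i (C i).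
Proof.
apply: measurable_funB => //.
apply: (@measurable_comp _ _ _ (past X i) R R `]0, +oo[ (@ln_Gamma R) setT (est i.+1)).
- exact: measurable_itv.
- by move=> _ [w _ <-] /=; rewrite in_itv/= est_gt0.
- exact: measurable_ln_Gamma iid_X.
- exact: aE.
Qed.

(** For [x <= 0] both densities vanish and [0 / 0] is [0], whence the indicator. *)
Lemma gamma_pdf_ratioE (r s x : R) : 0 < r -> 0 < s ->
  gamma_pdf r x / gamma_pdf s x =
  (0 < x)%R%:R * expR ((r - s) * ln x - (ln_Gamma r - ln_Gamma s)).
Proof.
move=> r0 s0; case: (ltP 0 x) => [x0|x0]; last by rewrite gamma_pdf_le0// !mul0r.
rewrite (gamma_pdf_gt0E r x0) (gamma_pdf_gt0E s x0) /ln_Gamma.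
move: (Gamma_gt0 iid_X r0) (Gamma_gt0 iid_X s0).
move: (Gamma r) (Gamma s) => u v u0 v0.
rewrite -[u in LHS]lnK ?posrE// -[v in LHS]lnK ?posrE//.
by rewrite mul1r -(expRN (ln u)) -(expRN (ln v)) -!expRD -expRN -expRD; congr expR; ring.
Qed.

Local Notation ratio := (likelihood_ratio X est theta0).
Local Notation S := (walk X (@ln R) A C).

Lemma likelihood_ratioS n w : ratio n.+1 w =
  ratio n w * ((0 < X n.+1 w)%R%:R * expR (increment X (@ln R) A C n w)).
Proof.
rewrite /likelihood_ratio big_nat_recr; last by [].
congr (_ * _); exact: (gamma_pdf_ratioE _ (est_gt0 w (ltn0Sn n)) theta0_gt0).
Qed.

Lemma measurable_likelihood_ratio n : measurable_fun [set: T] (ratio n).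
Proof.
elim: n => [|n IH].
  by rewrite (_ : ratio 0%N = cst 1)//; apply/funext => w; rewrite /likelihood_ratio big_geq.
rewrite (_ : ratio n.+1 = fun w => ratio n w *
    ((0 < X n.+1 w)%R%:R * expR (increment X (@ln R) A C n w))); last first.
  by apply/funext => w; exact: likelihood_ratioS.
apply: measurable_funM => //; apply: measurable_funM.
  have -> : (fun w => (0 < X n.+1 w)%R%:R : R) = (fun w => (- X n.+1 w < 0)%R%:R).
    by apply/funext => w; rewrite oppr_lt0.
  by apply: measurable_ltr_cst; exact: measurableT_comp.
apply: measurableT_comp => //; apply: measurable_funB.
  2: by apply: (@adapted_measurable _ _ _ X n); exact: aC.
apply: measurable_funM; first by apply: (@adapted_measurable _ _ _ X n); exact: aA.
exact: measurableT_comp.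
Qed.

Lemma likelihood_ratio_walk w : (forall n, 0 < X n.+1 w) ->
  forall n, ratio n w = expR (S n w).
Proof.
move=> X0; elim=> [|n IH]; first by rewrite /likelihood_ratio big_geq// /walk big_ord0 expR0.
by rewrite likelihood_ratioS X0 mul1r IH -expRD /walk big_ord_recr.
Qed.

Lemma running_likelihood b w : 0 < b -> (forall n, 0 < X n.+1 w) -> forall i,
  \prod_(j < i) (~~ (expR b <= ratio j.+1 w))%:R = running X (@ln R) A C b i w.
Proof.
move=> b0 X0; elim=> [|i IH]; first by rewrite big_ord0/= /walk big_ord0 b0.
by rewrite big_ord_recr/= IH likelihood_ratio_walk// ler_expR -ltNge.
Qed.

(** The likelihood ratio is the exponential of the walk only when all observations are positive, so
    the two running indicators agree almost surely rather than everywhere. *)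
Lemma integral_stopping_time b : 0 < b ->
  (\int[P t]_w stopping_time X est theta0 b w =
   \int[P t]_w (\sum_(0 <= i <oo) (running X (@ln R) A C b i w)%:E))%E.
Proof.
move=> b0; pose q i w : R := \prod_(j < i) (~~ (expR b <= ratio j.+1 w))%:R.
have q0 i w : (0 <= (q i w)%:E)%E by rewrite lee_fin prodr_ge0.
have r0 i w : (0 <= (running X (@ln R) A C b i w)%:E)%E.
  by rewrite lee_fin; case: (running01 X (@ln R) A C b i w) => [->//|[-> _]].
have mq i : measurable_fun setT (fun w => (q i w)%:E).
  apply/measurable_EFinP; elim: i => [|i IH].
    by rewrite (_ : q _ = cst 1)//; apply/funext => w; rewrite /q big_ord0.
  rewrite (_ : q _ = fun w => q i w * (ratio i.+1 w < expR b)%R%:R); last first.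
    by apply/funext => w; rewrite /q big_ord_recr/= -ltNge.
  apply: measurable_funM => //; apply: measurable_ltr_cst.
  exact: measurable_likelihood_ratio.
have mr i : measurable_fun setT (fun w => (running X (@ln R) A C b i w)%:E).
  apply/measurable_EFinP; elim: i => [|i IH] /=.
    by apply: measurable_ltr_cst; apply: (@adapted_measurable _ _ _ X 0%N);
      exact: adapted_walk.
  apply: measurable_funM => //; apply: measurable_ltr_cst.
  by apply: (@adapted_measurable _ _ _ X i.+1); exact: adapted_walk.
transitivity (\int[P t]_w (\sum_(0 <= i <oo) (q i w)%:E))%E.
  apply: eq_integral => w _; exact: (first_time_series (fun n => expR b <= ratio n w)).
apply: ge0_ae_eq_integral => //.
- by apply: ge0_emeasurable_sum => // i w _ _; exact: q0.
- by apply: ge0_emeasurable_sum => // i w _ _; exact: r0.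
- by move=> w _; apply: nneseries_ge0 => i _ _; exact: q0.
- by move=> w _; apply: nneseries_ge0 => i _ _; exact: r0.
have : {ae P t, forall w n, 0 < X n.+1 w}.
  apply: ae_foralln => n; exists [set w | X n.+1 w <= 0]; split.
  - rewrite (_ : mkset _ = X n.+1 @^-1` `]-oo, 0]); last first.
      by apply/seteqP; split=> w /=; rewrite in_itv.
    by rewrite -[X in measurable X]setTI; exact: measurable_funPT.
  - exact: gamma_law_null.
  - by move=> w /= /negP; rewrite -leNgt.
apply: filterS => w X0 _; apply: eq_eseriesr => i _; congr (_%:E).
exact: running_likelihood.
Qed.

(** * The hypotheses on the estimators, put in the form needed by the walk *)

Variable kappa : R.
Hypothesis kappa_gt0 : 0 < kappa.
Hypothesis efficiency : exists2 r : nat -> R, r =o_\oo (fun=> 1 : R) &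
  forall n : nat, (0 < n)%N -> 'E_(P t)[fun w => ((est n w - t) ^+ 2)%R]%E =
    ((1 + r n) / (n%:R * fisher_info t * kappa))%:E.
Hypothesis moment4 : exists2 r : nat -> R, r =O_\oo (fun n => n%:R ^- 2 : R) &
  forall n : nat, (0 < n)%N ->
    'E_(P t)[fun w => ((est n w - t) ^+ 4)%R]%E = (r n)%:E.
Hypothesis log_series : exists2 c : R, 0 < c &
  (\sum_(1 <= n <oo) 'E_(P t)[fun w => (Num.max (ln (est n w)^-1) 0
     * \1_[set v | est n v < c] w)%R] < +oo)%E.

Let mE i : measurable_fun [set: T] (est i.+1).
Proof. apply: (@adapted_measurable _ _ _ X i); exact: aE. Qed.

Let mZ i : measurable_fun [set: T] (Z i).
Proof. apply: (@adapted_measurable _ _ _ X i); exact: aZ. Qed.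

Let fisher_gt0 : 0 < fisher_info t.
Proof. exact: (fisher_info_gt0 iid_X). Qed.

Let mean_sqr_estimator : exists2 r : nat -> R, r =o_\oo (fun=> 1 : R) &
  forall i, summable_rv (P t) (fun w => Z i w ^+ 2) /\
    mean (P t) (fun w => Z i w ^+ 2) =
    (1 + r i.+1) / (i.+1%:R * fisher_info t * kappa).
Proof.
case: efficiency => r ro rE; exists r => // i.
have := rE i.+1 isT; rewrite unlock => h.
apply: summable_rv_fin h; first by apply: measurable_funX; exact: mZ.
by move=> w; exact: sqr_ge0.
Qed.

Let iZ2 i : summable_rv (P t) (fun w => Z i w ^+ 2).
Proof. by have [r _ rE] := mean_sqr_estimator; have [] := rE i. Qed.

Let Z2_lim (e : R) : 0 < e -> exists N : nat, forall i, (N <= i)%N ->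
  `|fisher_info t / 2 * mean (P t) (fun w => Z i w ^+ 2) - (2 * kappa)^-1 / i.+1%:R|
  <= e / i.+1%:R.
Proof.
move=> e0; have [r ro rE] := mean_sqr_estimator.
have /eqoP : r =o_\oo (fun=> 1 : R) by [].
(* The Fisher information cancels and leaves [(1 + r n) / (2 * kappa * n)] with [n = i.+1], so the
   relative error [r] may be as large as [e * (2 * kappa)]. *)
move=> /(_ (e * (2 * kappa))) []; first by rewrite !mulr_gt0.
move=> N _ rN; exists N => i Ni.
have /= := rN i.+1 (leqW Ni); rewrite normr1 mulr1 => ri.
have [_ ->] := rE i.
have -> : fisher_info t / 2 * ((1 + r i.+1) / (i.+1%:R * fisher_info t * kappa)) -
    (2 * kappa)^-1 / i.+1%:R = r i.+1 / (2 * kappa) / i.+1%:R.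
  by field; rewrite !gt_eqF.
rewrite normrM (gtr0_norm (_ : 0 < i.+1%:R^-1)) ?invr_gt0//.
rewrite ler_pM2r ?invr_gt0// normrM (gtr0_norm (_ : 0 < (2 * kappa)^-1)) ?invr_gt0 ?mulr_gt0//.
by rewrite ler_pdivrMr ?mulr_gt0.
Qed.

Let mean_sqr2_estimator : (forall i, summable_rv (P t) (fun w => Z i w ^+ 4)) /\
  exists2 c4, 0 <= c4 &
    forall i, mean (P t) (fun w => Z i w ^+ 4) <= c4 / i.+1%:R ^+ 2.
Proof.
case: moment4 => r rO rE.
have h i : summable_rv (P t) (fun w => Z i w ^+ 4) /\
    mean (P t) (fun w => Z i w ^+ 4) = r i.+1.
  have := rE i.+1 isT; rewrite unlock => h.
  apply: summable_rv_fin h; first by apply: measurable_funX; exact: mZ.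
  by move=> w; rewrite exprn_even_ge0.
split=> [i|]; first by have [] := h i.
have /eqO_exP[k k0 [N _ rN]] : r =O_\oo (fun n => n%:R ^- 2 : R) by [].
(* The sum covers the finitely many indices before the asymptotic bound holds. *)
exists (k + \sum_(i < N) `|r i.+1| * i.+1%:R ^+ 2).
  by rewrite addr_ge0 ?sumr_ge0 ?(ltW k0)// => i _; rewrite mulr_ge0 ?sqr_ge0.
move=> i; have [_ ->] := h i; rewrite ler_pdivlMr ?exprn_gt0//.
have [Ni|iN] := leqP N i.
  apply: (@le_trans _ _ k); last first.
    by rewrite lerDl sumr_ge0// => j _; rewrite mulr_ge0 ?sqr_ge0.
  have /= := rN i.+1 (leqW Ni).
  rewrite (ger0_norm (_ : 0 <= i.+1%:R ^- 2)) ?invr_ge0 ?sqr_ge0// => ri.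
  by rewrite -ler_pdivlMr ?exprn_gt0// (le_trans _ ri)// ler_norm.
rewrite (bigD1 (Ordinal iN))//=.
apply: (@le_trans _ _ (`|r i.+1| * i.+1%:R ^+ 2)).
  by rewrite ler_wpM2r ?sqr_ge0// ler_norm.
by rewrite addrCA lerDl addr_ge0 ?(ltW k0)// sumr_ge0.
Qed.

Let logm (c : R) i w : R := Num.max (ln (est i.+1 w)^-1) 0 * (est i.+1 w < c)%R%:R.

Let logm_ge0 c i w : 0 <= logm c i w.
Proof. by rewrite mulr_ge0// le_max lexx orbT. Qed.

Let log_sum : exists2 c, 0 < c &
  (forall i, summable_rv (P t) (logm c i)) /\
  exists L, forall n, \sum_(i < n) mean (P t) (logm c i) <= L.
Proof.
case: log_series => c c0 sum_fin; exists c => //.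
pose u n : \bar R := 'E_(P t)[fun w => (Num.max (ln (est n w)^-1) 0 *
  \1_[set v | est n v < c] w)%R]%E.
pose L := (\sum_(1 <= n <oo) u n)%E; rewrite -/L in sum_fin.
have EE i : (u i.+1 = \int[P t]_w (logm c i w)%:E)%E.
  rewrite /u unlock; apply: eq_integral => w _; congr (_%:E).
  rewrite /logm indicE; congr (_ * _%:R); congr nat_of_bool.
  by apply/idP/idP => [/set_mem|/mem_set].
have mlogm i : measurable_fun [set: T] (logm c i).
  apply: measurable_funM; last exact: measurable_ltr_cst.
  apply: measurable_maxr => //.
  rewrite (_ : (fun _ => _) = fun w => - ln (est i.+1 w)); last first.
    by apply/funext => w; rewrite lnV// posrE est_gt0.
  by apply: measurableT_comp => //; exact: measurableT_comp.
have E0 i : (0 <= \int[P t]_w (logm c i w)%:E)%E.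
  by apply: integral_ge0 => w _; rewrite lee_fin.
have u0 n : (1 <= n)%N -> (0 <= u n)%E by case: n => [//|n] _; rewrite EE.
have L0 : (0 <= L)%E by apply: nneseries_ge0 => n n1 _; exact: u0.
have LE : L = (fine L)%:E by rewrite fineK// ge0_fin_numE.
have part n : (\sum_(i < n) \int[P t]_w (logm c i w)%:E <= L)%E.
  have := @nneseries_lim_ge R u xpredT 1 n.+1 (fun n n1 _ => u0 n n1).
  by rewrite big_add1 big_mkord (eq_bigr (fun i => \int[P t]_w (logm c (nat_of_ord i) w)%:E)%E).
have ilogm i : summable_rv (P t) (logm c i).
  apply/integrableP; split; first exact/measurable_EFinP.
  under eq_integral do rewrite /= ger0_norm//.
  apply: le_lt_trans sum_fin; apply: le_trans (part i.+1).
  by rewrite big_ord_recr/= leeDr// sume_ge0.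
split=> //; exists (fine L) => n.
rewrite -lee_fin -LE -sumEFin; apply: le_trans (part n).
by apply: lee_sum => i _; rewrite meanE.
Qed.

Local Notation m := (mean (P t) (fun w => ln (X 1%N w))).
Local Notation I0 := (kl_info t theta0).

(** One weight for both coefficients: [A i] is linear in the error, [C i] is handled by
    [ln_Gamma_norm_le], and [g] is the logarithmic term with summable means. *)
Let kl_weight : exists g : nat -> T -> R, exists k : R, [/\ 0 <= k,
  forall i, summable_rv (P t) (g i),
  exists L, forall n, \sum_(i < n) mean (P t) (g i) <= L,
  forall i w, 0 <= g i w &
  forall i w, 1 + `|A i w| + `|C i w| <= k * (1 + Z i w ^+ 2 + g i w)].
Proof.
have [c c0 [ig gL]] := log_sum.
have [k k0 lnG] := ln_Gamma_norm_le iid_X t_gt0 c0.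
exists (logm c), (2 + `|t - theta0| + (k + `|ln_Gamma theta0|)); split=> //.
  by have := normr_ge0 (t - theta0); have := normr_ge0 (ln_Gamma theta0); lra.
move=> i w; rewrite -[1 + _ + logm c i w]/(estimator_weight t c (est i.+1 w)).
set W := estimator_weight _ _ _.
have W1 : 1 <= W := estimator_weight_ge1 _ _ _.
have W0 : 0 <= W by apply: le_trans W1.
have Zle : `|Z i w| <= W.
  apply: le_trans (sqr_le_estimator_weight _ _ _).
  rewrite -/(Z i w) -(real_normK (num_real (Z i w))).
  by have := sqr_ge0 (`|Z i w| - 1); have := sqr_ge0 `|Z i w|; lra.
have Ale : `|A i w| <= (1 + `|t - theta0|) * W.
  have -> : A i w = Z i w + (t - theta0) by rewrite /A /Z; ring.
  apply: le_trans (ler_normD _ _) _; rewrite mulrDl mul1r lerD//.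
  by rewrite ler_peMr.
have Cle : `|C i w| <= (k + `|ln_Gamma theta0|) * W.
  apply: le_trans (ler_normB _ _) _; rewrite mulrDl lerD//.
    by apply: lnG; exact: est_gt0.
  by rewrite ler_peMr.
by move: W1 Ale Cle; lra.
Qed.

Let iA i : summable_rv (P t) (A i).
Proof.
have [g [k [k0 ig _ g0 W]]] := kl_weight.
apply: (@summable_rv_le _ _ _ _ _ (fun w => k * (1 + Z i w ^+ 2 + g i w))).
- by apply: (@adapted_measurable _ _ _ X i); exact: aA.
- apply: summable_rvZ; apply: summable_rvD => //.
  by apply: summable_rvD => //; exact: summable_rv_cst.
- by move=> w; have := W i w; have := normr_ge0 (C i w); lra.
Qed.

Let iC i : summable_rv (P t) (C i).
Proof.
have [g [k [k0 ig _ g0 W]]] := kl_weight.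
apply: (@summable_rv_le _ _ _ _ _ (fun w => k * (1 + Z i w ^+ 2 + g i w))).
- by apply: (@adapted_measurable _ _ _ X i); exact: aC.
- apply: summable_rvZ; apply: summable_rvD => //.
  by apply: summable_rvD => //; exact: summable_rv_cst.
- by move=> w; have := W i w; have := normr_ge0 (A i w); lra.
Qed.

Let lossE i w : drift_loss (P t) X (@ln R) A C I0 i w = kl_info t (est i.+1 w).
Proof.
have e0 := est_gt0 w (ltn0Sn i).
rewrite /drift_loss (kl_infoE iid_X t_gt0 theta0_gt0) (kl_infoE iid_X t_gt0 e0) /A /C.
by move: (ln_Gamma _) (ln_Gamma t) (ln_Gamma _) m => u v x y; ring.
Qed.

Let I0_gt0 : 0 < I0.
Proof. exact: (kl_info_gt0 iid_X). Qed.

Let loss_ge0 i w : 0 <= drift_loss (P t) X (@ln R) A C I0 i w.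
Proof. by rewrite lossE (kl_info_ge0 iid_X)// est_gt0. Qed.

Let close_bounds : exists delta B : R, [/\ 0 < delta, 0 < B & forall i w,
  `|Z i w| <= delta -> [/\ `|A i w| <= B, `|C i w| <= B &
    drift_loss (P t) X (@ln R) A C I0 i w <= I0 / 4]].
Proof.
have [s s0 hs] := kl_info_quadratic iid_X t_gt0 ltr01.
pose J := fisher_info t / 2.
have J0 : 0 < J by rewrite divr_gt0.
(* Radius [s] gives a loss of at most [(J + 1) * Z i w ^+ 2]; the two other bounds on [Z i w] make
   this at most [I0 / 4]. The bound on [C i] then follows from that on [A i], as [C i w] is loss
   minus [I0] plus [A i w * m]. *)
pose delta := Num.min s (Num.min 1 (I0 / (4 * (J + 1)))).
have J1 : 0 < 4 * (J + 1) by lra.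
have d0 : 0 < delta by rewrite !lt_min s0 ltr01 divr_gt0.
pose B := 1 + `|t - theta0| + (2 * I0 + (1 + `|t - theta0|) * `|m|).
have nt := normr_ge0 (t - theta0).
have B0 : 0 <= (1 + `|t - theta0|) * `|m| by rewrite mulr_ge0// addr_ge0.
exists delta, B; split=> //; first by move: I0_gt0 nt B0; rewrite /B; lra.
move=> i w; rewrite !le_min => /andP[Zs /andP[Z1 ZI]].
have Ale : `|A i w| <= 1 + `|t - theta0|.
  have -> : A i w = Z i w + (t - theta0) by rewrite /A /Z; ring.
  by apply: le_trans (ler_normD _ _) _; rewrite lerD2r.
have Kle : kl_info t (est i.+1 w) <= I0 / 4.
  have := hs _ (est_gt0 w (ltn0Sn i)) Zs; rewrite -/J -/(Z i w) mul1r.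
  rewrite ler_norml => /andP[_]; rewrite lerBlDr => /le_trans; apply.
  have Z2 : Z i w ^+ 2 <= I0 / (4 * (J + 1)).
    rewrite -(real_normK (num_real (Z i w))) expr2 -[leRHS]mul1r.
    by apply: ler_pM.
  apply: (@le_trans _ _ ((J + 1) * (I0 / (4 * (J + 1))))).
    have J10 : 0 <= J + 1 by lra.
    by move: (ler_wpM2l J10 Z2); lra.
  have J10 : J + 1 != 0 by rewrite gt_eqF//; lra.
  by rewrite [leLHS](_ : _ = I0 / 4)//; field.
split; first by apply: le_trans Ale _; rewrite lerDl addr_ge0// mulr_ge0// ltW.
  have -> : C i w = kl_info t (est i.+1 w) - I0 + A i w * m.
    by rewrite -lossE /drift_loss; ring.
  apply: le_trans (ler_normD _ _) _.
  apply: (@le_trans _ _ (2 * I0 + (1 + `|t - theta0|) * `|m|)); last first.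
    by rewrite lerDr addr_ge0.
  apply: lerD; last by rewrite normrM; exact: ler_wpM2r.
  have := loss_ge0 i w; rewrite lossE => K0.
  exact: norm_sub_le K0 Kle.
by rewrite lossE.
Qed.

Let far_bounds (e : R) : 0 < e -> exists c, forall n,
  \sum_(i < n) mean (P t) (fun w => far Z e i w * (1 + `|A i w| + `|C i w|)) <= c.
Proof.
move=> e0; have [g [k [k0 ig [L gL] g0 W]]] := kl_weight.
have [iZ4 [c4 c40 Z4]] := mean_sqr2_estimator.
(* When the error exceeds [e], [1] is at most [e ^- 4] and its square at most [e ^- 2] times its
   fourth power. *)
pose q := e ^- 4 + e ^- 2.
have q0 : 0 <= q by rewrite addr_ge0 ?invr_ge0 ?exprn_ge0// ltW.
exists (k * (q * (c4 * 2) + L)) => n.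
have far01 i w : far Z e i w = 0 \/ far Z e i w = 1.
  by rewrite /far; case: (_ < _)%R; [right|left].
have farZ i w : far Z e i w * (1 + Z i w ^+ 2) <= q * Z i w ^+ 4.
  rewrite /far; case: ltP => eZ; last by rewrite mul0r mulr_ge0// exprn_even_ge0.
  rewrite mul1r /q mulrDl.
  have e2 : e ^+ 2 <= Z i w ^+ 2.
    by rewrite -(real_normK (num_real (Z i w))) lerXn2r ?nnegrE// ltW.
  have Z4E : Z i w ^+ 4 = Z i w ^+ 2 * Z i w ^+ 2 by rewrite -exprD.
  have e4E : e ^+ 4 = e ^+ 2 * e ^+ 2 by rewrite -exprD.
  have e20 : 0 < e ^+ 2 by rewrite exprn_gt0.
  apply: lerD.
    rewrite mulrC ler_pdivlMr ?exprn_gt0// mul1r Z4E e4E.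
    by apply: ler_pM => //; exact: ltW.
  rewrite mulrC ler_pdivlMr// Z4E; apply: ler_wpM2l => //.
  exact: sqr_ge0.
have b i : mean (P t) (fun w => far Z e i w * (1 + `|A i w| + `|C i w|)) <=
    k * (q * (c4 * i.+1%:R ^- 2) + mean (P t) (g i)).
  have ibound : summable_rv (P t) (fun w => k * (q * Z i w ^+ 4 + g i w)).
    by apply: summable_rvZ; apply: summable_rvD => //; exact: summable_rvZ.
  have le w : far Z e i w * (1 + `|A i w| + `|C i w|) <= k * (q * Z i w ^+ 4 + g i w).
    apply: (@le_trans _ _ (far Z e i w * (k * (1 + Z i w ^+ 2 + g i w)))).
      by apply: ler_wpM2l => //; have [->|->] := far01 i w.
    rewrite mulrCA; apply: ler_wpM2l => //; rewrite mulrDr; apply: lerD => //.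
    by have [->|->] := far01 i w; rewrite ?mul0r ?mul1r.
  apply: (@le_trans _ _ (mean (P t) (fun w => k * (q * Z i w ^+ 4 + g i w)))).
    apply: ler_mean => //; apply: summable_rv_le ibound _.
      apply: measurable_funM.
        by apply: (@adapted_measurable _ _ _ X i); exact: adapted_far.
      have mN (f : nat -> T -> R) : adapted X i (f i) -> measurable_fun setT (fun w => `|f i w|).
        by move=> af; apply: measurableT_comp => //; apply: (@adapted_measurable _ _ _ X i).
      by apply: measurable_funD; [apply: measurable_funD => //; exact: mN|exact: mN].
    move=> w; rewrite ger0_norm//; apply: mulr_ge0; last by rewrite !addr_ge0.
    by have [->|->] := far01 i w.
  rewrite meanZ; last by apply: summable_rvD => //; exact: summable_rvZ.
  apply: ler_wpM2l => //; rewrite meanD//; last exact: summable_rvZ.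
  by rewrite meanZ// lerD2r; apply: ler_wpM2l.
apply: le_trans (ler_sum _ (fun (i : 'I_n) _ => b i)) _.
rewrite -mulr_sumr; apply: ler_wpM2l => //; rewrite big_split/=; apply: lerD; last exact: gL.
rewrite -mulr_sumr; apply: ler_wpM2l => //; rewrite -mulr_sumr.
by apply: ler_wpM2l => //; exact: sum_invr_sqr_le.
Qed.

(** The negative moment of [X] of order [h] is finite for [h < t]; half of [t] is a safe choice. *)
Let iexp : summable_rv (P t) (fun w => expR (t / 2 * `|ln (X 1%N w)|)).
Proof.
have [ip _] := gamma_mgf (h := t / 2) iid_X t_gt0 ltac:(by rewrite addr_gt0 ?divr_gt0).
have tB : 0 < t + - (t / 2) by move: t_gt0; lra.
have [im _] := gamma_mgf iid_X t_gt0 tB.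
apply: summable_rv_le (summable_rvD ip im) _.
  apply: measurableT_comp => //; apply: measurable_funM => //.
  by apply: measurableT_comp => //; exact: measurableT_comp.
move=> w; rewrite ger0_norm ?expR_ge0//.
by apply: le_trans (expR_normM_le _ _) _; rewrite mulNr.
Qed.

Let same_law (q : R -> R) i : measurable_fun [set: R] q ->
  summable_rv (P t) (fun w => q (ln (X 1%N w))) ->
  summable_rv (P t) (fun w => q (ln (X i.+1 w))) /\
  mean (P t) (fun w => q (ln (X i.+1 w))) = mean (P t) (fun w => q (ln (X 1%N w))).
Proof.
move=> mq iq; apply: (same_gamma_law (q := fun x => q (ln x)) iid_X) => //.
exact: measurableT_comp.
Qed.

Lemma integral_stopping_time_asymp : exists F : R -> R,
  (forall b, 0 < b -> (\int[P t]_w stopping_time X est theta0 b w)%E = (F b)%:E) /\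
  forall e, 0 < e -> exists c, forall b, 1 <= b ->
    `|I0 * F b - b - (2 * kappa)^-1 * ln b| <= e * ln b + c.
Proof.
have indX : mutually_independent (P t) X [set n | (0 < n)%N] := (iid_X t_gt0).2.
have [delta [B [delta0 B0 close]]] := close_bounds.
have [iZ4 [c4 c40 Z4]] := mean_sqr2_estimator.
have a0 : 0 < t / 2 by rewrite divr_gt0.
exists (fun b => limn (run_mean (P t) X (@ln R) A C b)); split=> [b b0|e e0].
  rewrite integral_stopping_time//.
  by have [_] := run_mean_cvg indX ml aA aC aZ iA iC a0 iexp same_law I0_gt0
    loss_ge0 delta0 B0 close far_bounds b0.
have J0 : 0 <= fisher_info t / 2 by rewrite ltW// divr_gt0.
have rho0 : 0 < (2 * kappa)^-1 by rewrite invr_gt0 mulr_gt0.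
have quadratic (r : R) : 0 < r -> exists2 s, 0 < s & forall i w, `|Z i w| <= s ->
    `|drift_loss (P t) X (@ln R) A C I0 i w - fisher_info t / 2 * Z i w ^+ 2|
    <= r * Z i w ^+ 2.
  move=> r0; have [s s0 hs] := kl_info_quadratic iid_X t_gt0 r0.
  by exists s => // i w Zs; rewrite lossE; apply: hs => //; exact: est_gt0.
exact: (mean_running_time indX ml aA aC aZ iA iC a0 iexp same_law I0_gt0
  loss_ge0 delta0 B0 close far_bounds J0 rho0 c40 quadratic iZ2 iZ4 Z4 Z2_lim e0).
Qed.

End adaptive_likelihood.

Theorem theorem3 (R : realType) (d : measure_display) (T : measurableType d)
    (P : R -> probability T R) (X : nat -> {mfun T >-> R})
    (est : nat -> T -> R) (kappa : R -> R) (theta0 : R)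
    (iid_X : forall theta : R, 0 < theta -> iid_gamma (P theta) X theta)
    (theta0_gt0 : 0 < theta0)
    (est_gt0 : forall n w, (0 < n)%N -> 0 < est n w)
    (est_pred : nonanticipating X est)
    (kappa_gt0 : forall theta : R, 0 < theta -> 0 < kappa theta)
    (est_efficiency : forall theta : R, 0 < theta ->
      exists2 r : nat -> R, r =o_\oo (fun=> 1 : R) &
        forall n : nat, (0 < n)%N ->
          'E_(P theta)[fun w => ((est n w - theta) ^+ 2)%R]%E =
          ((1 + r n) / (n%:R * fisher_info theta * kappa theta))%:E)
    (est_moment4 : forall theta : R, 0 < theta ->
      exists2 r : nat -> R, r =O_\oo (fun n => n%:R ^- 2 : R) &
        forall n : nat, (0 < n)%N ->
          'E_(P theta)[fun w => ((est n w - theta) ^+ 4)%R]%E = (r n)%:E)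
    (est_log : forall theta : R, 0 < theta ->
      exists2 c : R, 0 < c &
        (\sum_(1 <= n <oo)
           'E_(P theta)[fun w => (Num.max (ln (est n w)^-1) 0
                                  * \1_[set v | est n v < c] w)%R] < +oo)%E) :
  forall theta : R, 0 < theta -> theta != theta0 ->
    exists2 r : R -> R, r =o_+oo (@ln R) &
      \forall b \near +oo,
        (\int[P theta]_w stopping_time X est theta0 b w)%E =
        ((kl_info theta theta0)^-1 * (b + ln b / (2 * kappa theta)) + r b)%:E.

Proof.
move=> t t0 tneq.
have k0 := kappa_gt0 t t0.
have [F [FE Fasymp]] := integral_stopping_time_asymp iid_X theta0_gt0 est_gt0 est_pred
  t0 tneq k0 (est_efficiency t t0) (est_moment4 t t0) (est_log t t0).
have I0 : 0 < kl_info t theta0 := kl_info_gt0 iid_X t0 theta0_gt0 tneq.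
set I := kl_info t theta0 in I0 Fasymp *.
(* The remainder is the exact difference, so only its order of growth is to be proved. *)
exists (fun b => F b - I^-1 * (b + ln b / (2 * kappa t))); last first.
  near=> b; rewrite FE; last by near: b; exact: nbhs_pinfty_gt.
  by congr (_%:E); rewrite addrC subrK.
apply/eqoP => e e0.
(* Half of the tolerance, scaled by [I], goes to the logarithmic error; the other half absorbs the
   constant [c] once [ln b] is large. *)
have [c hc] := Fasymp (e * I / 2) ltac:(by rewrite divr_gt0// mulr_gt0).
near=> b.
have b1 : 1 <= b by near: b; exact: nbhs_pinfty_ge.
have lb : 0 <= ln b by rewrite ln_ge0.
have cb : c <= e * I / 2 * ln b.
  have eI : 0 < e * I / 2 by rewrite divr_gt0// mulr_gt0.
  by rewrite mulrC -ler_pdivrMr// -[leLHS]expRK ler_ln ?posrE ?expR_gt0 ?(lt_le_trans ltr01 b1)//.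
rewrite (ger0_norm lb).
have -> : F b - I^-1 * (b + ln b / (2 * kappa t)) =
    I^-1 * (I * F b - b - (2 * kappa t)^-1 * ln b).
  by field; rewrite !gt_eqF.
rewrite normrM gtr0_norm ?invr_gt0// mulrC ler_pdivrMr//.
by have := hc b b1; lra.
Unshelve. all: by end_near. Qed.
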